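(* Let $G$ be a finite group with a redundant Sylow $2$-subgroup. Then $\nu_2(G)\ge 27$.
   Context: For a finite group $G$ and a prime $p$, $\nu_p(G)$ denotes the number of Sylow $p$-subgroups of $G$. A $p$-element of $G$ is an element whose order is a power of $p$. A Sylow $p$-subgroup $P$ of $G$ is called redundant if every $p$-element of $G$ lies in a Sylow $p$-subgroup of $G$ different from $P$. *)

(* Defs.v *)
From mathcomp Require Import all_boot all_fingroup all_solvable.

Set Implicit Arguments.
Unset Strict Implicit.
Unset Printing Implicit Defensive.

Local Open Scope group_scope.

Definition nu (gT : finGroupType) (p : nat) (G : {group gT}) : nat :=
  #|'Syl_p(G)|.

(* p is meant to be prime, as everywhere in the library's theory of p-groups. *)
Definition redundant_Sylow (gT : finGroupType) (p : nat) (G P : {group gT}) :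
    Prop :=
  p.-Sylow(G) P /\
  (forall x : gT, x \in G -> p.-elt x ->
     exists Q : {group gT}, [/\ p.-Sylow(G) Q, Q != P & x \in Q]).

(* Main.v *)
Require Import Defs.
From mathcomp Require Import all_boot all_fingroup all_solvable.
From mathcomp Require Import zify.

(** The Sylow 2-subgroups of G are treated as the points of a geometry on which
    G acts by conjugation. A 2-element normalises a point only if it lies in
    it, so redundancy, which passes from one point to all of them by conjugacy,
    says that every element of a point T fixes a point other than T. The number
    n of points is odd; a contradiction is derived from n <= 25.

    A group is not the union of two proper subgroups. Hence the intersections
    of a point P with the other points are not all contained in one of two
    proper subgroups of P ([redundant_index2]). The P-orbit of a point Q has
    #|P : Q| elements, a power of two called here the distance of P and Q, and
    the intersections of P with the points of one orbit lie in one subgroup of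
    index two. So P has at least three orbits on the other points, and n - 1 is
    a sum of multiples of 2, 4, 8 and 16, one for each distance.

    Dividing by the kernel of the action on the points changes neither n nor
    redundancy, so the action may be taken to be faithful. It is also primitive
    ([no_intermediate]): if 'N_G(P) < H < G, then n is the product of |G : H|
    and of the number of Sylow 2-subgroups of H, which are among 3, 5 and 7.
    With so few points, the intersections of P with the other points of H lie
    in one subgroup of index two ([small_Syl_cover]), and the same is shown for
    the conjugates of H, except in one case where three subgroups of index two
    are compared; this contradicts redundancy.

    Let k be the least distance between points. If P and Q are at distance k
    and A = P :&: Q, the points above A form a line: any two of them meet in A,
    and 'N_G(A) permutes them transitively. A 2-group that normalises two lines
    with a common point fixes this point, unless the lines coincide
    ([line_norm_fix]). This makes many families of lines disjoint, and thus
    bounds the size of the lines ([normal_line_small], [partner_bound]): in all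
    cases that survive, lines have three points.

    If k = 4, every line A has a normal subgroup E of P of index two in A, and
    one follows A and then its conjugate in another point of the line. Either
    one always stays at distance four from P; then E is normal in at least nine
    points, and counting the conjugates of E is impossible ([step4_contra]). Or
    n = 21, and P has too few orbits or is covered by three pairs of conjugate
    subgroups of index four, which is impossible for a 2-group
    ([three_D8_contra]). If k >= 8, then n = 25 and the geometry is a Steiner
    triple system; the subgroup of P fixing a subsystem of nine points has
    index at most two in the lines contained in this subsystem, so that the
    twelve lines through P are too small to cover P ([distance8_contra]). If k
    = 2, each point has six neighbours, on three lines. By primitivity the
    subgroup of P fixing them all is trivial, which gives |P| = 4, then
    |'N_G(P)| = 12 and |G| = 12 n, with n = 15, 19 or 23; these orders are
    excluded by Sylow arguments ([distance2_contra]). *)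

Set Implicit Arguments.
Unset Strict Implicit.
Unset Printing Implicit Defensive.

Local Open Scope group_scope.

(** * Subgroups of index two and actions of 2-groups *)

Section Generalities.

Variable gT : finGroupType.
Implicit Types (A B G H K L M P Q T : {group gT}) (x y z : gT).

Lemma sub_union_group P (M1 M2 : {group gT}) :
  P \subset M1 :|: M2 -> (P \subset M1) || (P \subset M2).
Proof.
move=> sP; apply: contraT => /norP[/subsetPn[x Px M1x] /subsetPn[y Py M2y]].
have M2x : x \in M2 by move/subsetP/(_ x Px): sP; rewrite inE (negPf M1x).
have M1y : y \in M1.
  by move/subsetP/(_ y Py): sP; rewrite inE (negPf M2y) orbF.
have /setUP[] := subsetP sP _ (groupM Px Py).
  by rewrite groupMr ?(negPf M1x).
by rewrite groupMl // (negPf M2y).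
Qed.

Lemma pgroup_maximal_above (p : nat) P B :
    p.-group P -> ~~ (P \subset B) ->
  exists M : {group gT}, [/\ P :&: B \subset M, M <| P & #|P : M| = p].
Proof.
move=> pP nPB; have [eB|[M maxM sBM]] := maximal_exists (subsetIl P B).
  by rewrite -eB subsetIr in nPB.
by exists M; rewrite (p_maximal_normal pP) // (p_maximal_index pP).
Qed.

(** M has a single coset in P besides itself. *)
Lemma index2_mul P M x y :
    M \subset P -> #|P : M| = 2 -> x \in P -> y \in P ->
  (x * y \in M) = ((x \in M) == (y \in M)).
Proof.
move=> sM iM Px Py; have [Mx|Mx] := boolP (x \in M).
  by rewrite groupMl //; case: (y \in M).
have [My|My] := boolP (y \in M); first by rewrite groupMr // (negPf Mx).
rewrite eqxx -{1}[y]invgK -mem_rcoset.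
suff -> : M :* y^-1 = P :\: M by rewrite inE Mx.
apply/eqP; rewrite eqEcard card_rcoset; apply/andP; split.
  apply/subsetP=> _ /rcosetP[z Mz ->].
  by rewrite inE groupMl // groupV My groupM ?groupV // (subsetP sM).
have := Lagrange sM; rewrite iM -(cardsID M P) (setIidPr sM) muln2 -addnn => e.
by rewrite -(leq_add2l #|M|) -e.
Qed.

Lemma index2_sqr P M x :
  M \subset P -> #|P : M| = 2 -> x \in P -> x ^+ 2 \in M.
Proof. by move=> sM iM Px; rewrite expgS expg1 (index2_mul sM). Qed.

Lemma odd_index2 P M x :
  M \subset P -> #|P : M| = 2 -> x \in P -> odd #[x] -> x \in M.
Proof.
move=> sM iM Px ox.
have: x ^+ #[x] \in M by rewrite expg_order group1.
rewrite -[#[x]]odd_double_half ox expgD expg1 -mul2n expgM groupMr //.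
by rewrite groupX ?(index2_sqr sM).
Qed.

Lemma index2_between P M L :
  M \subset L -> L \subset P -> #|P : M| = 2 -> (P \subset L) || (L \subset M).
Proof.
move=> sML sLP iM; rewrite -!indexg_eq1; have := Lagrange_index sLP sML.
rewrite iM => e; have: #|P : L| <= 2 by rewrite dvdn_leq // -e dvdn_mulr.
by case: #|P : L| e => [|[|[|]]] //; case: #|L : M| => [|[|q]] //; rewrite mulnC.
Qed.

Lemma index2_meet P M A : M <| P -> #|P : M| = 2 -> A \subset P ->
  ~~ (A \subset M) -> #|A : M| = 2.
Proof.
move=> nM iM sA nA; have [sM nMP] := andP nM.
have sMA : M \subset A <*> M by apply: joing_subr.
have sAP : A <*> M \subset P by rewrite join_subG sA.
have eP : A * M = P.
  apply/eqP; rewrite -norm_joinEl ?(subset_trans sA) // eqEsubset sAP /=.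
  have /orP[//|sAM] := index2_between sMA sAP iM.
  by case/negP: nA; apply: subset_trans sAM; apply: joing_subl.
apply/eqP; rewrite -(eqn_pmul2r (cardG_gt0 M)) LagrangeMr eP.
by rewrite -iM mulnC Lagrange.
Qed.

(** An element y of M1 and M2 outside M3 corrects an element outside M1 and M2
    that happens to lie in M3. *)
Lemma three_index2 P (M1 M2 M3 : {group gT}) :
    ~~ (P \subset M1) -> ~~ (P \subset M2) ->
    M3 \subset P -> #|P : M3| = 2 -> ~~ (P :&: (M1 :&: M2) \subset M3) ->
  exists2 x, x \in P & [/\ x \notin M1, x \notin M2 & x \notin M3].
Proof.
move=> n1 n2 s3 i3 /subsetPn[y /setIP[Py /setIP[M1y M2y]] M3y].
have /subsetPn[x Px] : ~~ (P \subset M1 :|: M2).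
  by apply/negP=> /sub_union_group; rewrite (negPf n1) (negPf n2).
rewrite inE => /norP[M1x M2x].
have [M3x|M3x] := boolP (x \in M3); last by exists x.
exists (x * y); first by rewrite groupM.
by rewrite (groupMr _ M1y) (groupMr _ M2y) (index2_mul s3) // M3x (negPf M3y).
Qed.

End Generalities.

Lemma dvdn_acts (aT : finGroupType) (D : {group aT}) (rT : finType)
    (to : action D rT) (A : {group aT}) (S : {set rT}) k :
    [acts A, on S | to] -> (forall x, x \in S -> k %| #|orbit to A x|) ->
  k %| #|S|.
Proof.
move=> actS kS; rewrite -(acts_sum_card_orbit actS).
by apply: dvdn_sum => _ /imsetP[x Sx ->]; apply: kS.
Qed.

Lemma odd_acts2_fix (aT : finGroupType) (rT : finType)
    (to : {action aT &-> rT}) (A : {group aT}) (S : {set rT}) x a :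
    odd #|A| -> [acts A, on S | to] -> #|S| <= 2 ->
  x \in S -> a \in A -> to x a = x.
Proof.
move=> oA aA S2 Sx Aa.
have sO : orbit to A x \subset S by rewrite acts_sub_orbit.
have O1 : #|orbit to A x| = 1%N.
  have := leq_trans (subset_leq_card sO) S2.
  have : odd #|orbit to A x| by apply: dvdn_odd oA; apply: dvdn_orbit.
  have : 0 < #|orbit to A x| by apply/card_gt0P; exists x; apply: orbit_refl.
  by move: #|_| => [|[|[|n]]].
have /eqP/cards1P[y eO] := O1.
have xy : x = y by apply/set1P; rewrite -eO orbit_refl.
by apply/set1P; rewrite {2}xy -eO mem_orbit.
Qed.

Lemma acts2_sqr_fix (aT : finGroupType) (rT : finType)
    (to : {action aT &-> rT}) (A : {group aT}) (S : {set rT}) x a :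
    [acts A, on S | to] -> #|S| <= 2 ->
  x \in S -> a \in A -> to x (a ^+ 2) = x.
Proof.
move=> aA S2 Sx Aa; have Sa := actsP aA a Aa.
have [e|ne] := eqVneq (to x a) x; first by rewrite expgS expg1 actM e e.
apply/eqP; apply: contraT => ne2.
have ne1 : to x (a ^+ 2) != to x a.
  by rewrite expgS expg1 actM (inj_eq (act_inj to a)).
have : to x (a ^+ 2) |: [set x; to x a] \subset S.
  by rewrite !subUset !sub1set expgS expg1 actM !Sa Sx.
move/subset_leq_card; rewrite cardsU1 cards2 in_set2 negb_or ne2 ne1 eq_sym ne.
by move/leq_trans/(_ S2).
Qed.

Lemma sum_disjoint_le (I J : finType) (D : {set I}) (B : I -> {set J}) (C : {set J}) :
    (forall i, i \in D -> B i \subset C) ->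
    (forall i j x, i \in D -> j \in D -> x \in B i -> x \in B j -> i = j) ->
  \sum_(i in D) #|B i| <= #|C|.
Proof.
move=> sBC disB.
have -> : (\sum_(i in D) #|B i| = \sum_(i in D) \sum_(x in C) (x \in B i))%N.
  apply: eq_bigr => i Di; rewrite -sum1_card big_mkcond [RHS]big_mkcond /=.
  apply: eq_bigr => x _; case Bx: (x \in B i); first by rewrite (subsetP (sBC i Di)).
  by case: ifP.
rewrite exchange_big -sum1_card; apply: leq_sum => x Cx /=.
have [i /andP[Di Bi]|noi] := pickP (fun i => (i \in D) && (x \in B i)).
  rewrite (bigD1 i) //= Bi big1 // => j /andP[Dj neji].
  by apply/eqP; rewrite eqb0; apply: contra neji => /(disB j i x Dj Di)/(_ Bi)->.
by rewrite big1 // => i Di; have := noi i; rewrite Di /= => ->.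
Qed.

(** * Sylow 2-subgroups as points *)

Section SylowPoints.

Variables (gT : finGroupType) (G : {group gT}).
Implicit Types (A B H K L M P Q T U : {group gT}) (x y z : gT).

Local Notation Om := 'Syl_2(G).

(** As [#|P : Q|] is the index of the intersection P :&: Q in P, it is
    symmetric in two points P and Q ([index_Syl_sym]) and is the size of the
    P-orbit of Q ([card_Syl_orbit]); it serves as their distance. *)
Definition Syl_at P (k : nat) := [set Q in Om | #|P : Q| == k].

Definition Syl_above (A : {set gT}) := [set Q in Om | A \subset gval Q].

Lemma Syl_atP P k Q :
  reflect (Q \in Om /\ #|P : Q| = k) (Q \in Syl_at P k).
Proof.
rewrite [X in reflect _ X]in_set.
by apply: (iffP andP) => [[-> /eqP]|[-> ->]].
Qed.

Lemma SylP P : reflect (2.-Sylow(G) P) (P \in Om).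
Proof. by rewrite inE; apply: idP. Qed.

Arguments SylP {P}.

Lemma Syl_sub P : P \in Om -> P \subset G.
Proof. by move/SylP/pHall_sub. Qed.

Lemma Syl_pgroup P : P \in Om -> 2.-group P.
Proof. by move/SylP/pHall_pgroup. Qed.

Lemma SylJ P x : x \in G -> ((P :^ x)%G \in Om) = (P \in Om).
Proof. by move=> Gx; rewrite !inE pHallJ. Qed.

Lemma Syl_conj P Q :
  P \in Om -> Q \in Om -> exists2 x, x \in G & Q = (P :^ x)%G.
Proof.
move=> /SylP sylP /SylP sylQ; have [x Gx eQ] := Sylow_trans sylP sylQ.
by exists x => //; apply: group_inj.
Qed.

Lemma Syl_card P Q : P \in Om -> Q \in Om -> #|P| = #|Q|.
Proof. by move=> /SylP/card_Hall-> /SylP/card_Hall->. Qed.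

Lemma Syl_eq P Q : P \in Om -> Q \in Om -> P \subset Q -> P = Q.
Proof.
by move=> oP oQ sPQ; apply/eqP; rewrite -val_eqE eqEcard sPQ /= (Syl_card oQ oP).
Qed.

Lemma Syl_norm A Q :
  Q \in Om -> 2.-group A -> A \subset G -> A \subset 'N(Q) -> A \subset Q.
Proof.
move=> /SylP sylQ pA sAG nQA; apply: (norm_sub_max_pgroup (Hall_max sylQ)) => //.
Qed.

(** For elements of a point, to fix a point is to belong to it. *)
Lemma norm_Syl P Q x :
  P \in Om -> Q \in Om -> x \in P -> x \in 'N(Q) -> x \in Q.
Proof.
move=> oP oQ Px nQx; rewrite -cycle_subG.
apply: Syl_norm => //; rewrite ?cycle_subG ?(subsetP (Syl_sub oP)) //.
by rewrite (pgroupS _ (Syl_pgroup oP)) // cycle_subG.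
Qed.

Lemma index_Syl_sym P Q : P \in Om -> Q \in Om -> #|P : Q| = #|Q : P|.
Proof.
move=> oP oQ; rewrite -(indexgI P) -(indexgI Q) setIC -!divgS ?subsetIl ?subsetIr //.
by rewrite (Syl_card oP oQ).
Qed.

Lemma index_Syl_gt1 P Q : P \in Om -> Q \in Om -> P != Q -> 1 < #|P : Q|.
Proof.
move=> oP oQ neq; rewrite ltn_neqAle eq_sym indexg_gt0 andbT.
by rewrite indexg_eq1; apply: contra neq => /(Syl_eq oP oQ)->.
Qed.

Lemma index_Syl_pow P Q : P \in Om -> exists i, #|P : Q| = (2 ^ i)%N.
Proof.
move=> oP; rewrite -indexgI.
have /p_natP[i ->] : 2.-nat #|P : P :&: Q|; last by exists i.
exact: pnat_dvd (dvdn_indexg _ _) (Syl_pgroup oP).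
Qed.

Lemma card_Syl_orbit P Q :
  P \in Om -> Q \in Om -> #|orbit 'JG P Q| = #|P : Q|.
Proof.
move=> oP oQ; rewrite card_orbit astab1JG -[RHS]indexgI.
congr #|_ : _|; apply/setP=> x; rewrite !in_setI; case Px: (x \in P) => //=.
apply/idP/idP => [nQx|/(subsetP (normG Q))//].
exact: (norm_Syl oP oQ Px nQx).
Qed.

Lemma acts_Syl_at P k : P \in Om -> [acts P, on Syl_at P k | 'JG].
Proof.
move=> oP; apply/actsP=> x Px Q; rewrite !inE /=.
rewrite pHallJ ?(subsetP (Syl_sub oP)) //.
by rewrite -{1}(conjGid Px) indexJg.
Qed.

Lemma dvdn_Syl_at P k : P \in Om -> k %| #|Syl_at P k|.
Proof.
move=> oP; apply: (dvdn_acts (acts_Syl_at k oP)) => Q.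
by rewrite inE => /andP[oQ /eqP<-]; rewrite card_Syl_orbit.
Qed.

Lemma index_Syl_le P Q : P \in Om -> Q \in Om -> #|P : Q| <= #|Om|.
Proof.
move=> oP oQ; apply: leq_trans (_ : #|Syl_at P #|P : Q| | <= _).
  apply: dvdn_leq (dvdn_Syl_at _ oP); apply/card_gt0P; exists Q.
  by rewrite inE oQ /=.
by apply/subset_leq_card/subsetP=> T; rewrite inE => /andP[].
Qed.

Lemma Syl_at1 P : P \in Om -> Syl_at P 1%N = [set P].
Proof.
move=> oP; apply/setP=> Q; rewrite !inE; apply/andP/eqP=> [[sylQ]|->].
  by rewrite indexg_eq1 => /(Syl_eq oP) ->; rewrite ?inE.
by rewrite indexgg; split=> //; apply/SylP.
Qed.

(** The distance from P to Q is a power of two, and at most the number of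
    points since the P-orbit of Q has that size. *)
Lemma card_Syl_split P : P \in Om -> #|Om| <= 25 ->
  #|Om| = (1 + #|Syl_at P 2| + #|Syl_at P 4| + #|Syl_at P 8| + #|Syl_at P 16|)%N.
Proof.
move=> oP le25.
have -> : #|Om| = (\sum_(i < 5) #|Syl_at P (2 ^ i)|)%N.
  rewrite -sum1_card (partition_big (fun Q => inord (logn 2 #|P : Q|) : 'I_5) xpredT) //=.
  apply: eq_bigr => i _; rewrite -sum1_card; apply: eq_bigl => Q.
  rewrite [RHS]in_set; case oQ: (Q \in Om) => //=.
  have [j ej] := index_Syl_pow Q oP; rewrite ej pfactorK //.
  have lt5j: j < 5.
    have := index_Syl_le oP oQ; rewrite ej => le2j.
    rewrite -(@ltn_exp2l 2) //; lia.
  by rewrite eqn_exp2l // -(inj_eq val_inj) /= inordK.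
by rewrite !big_ord_recl big_ord0 /= Syl_at1 // cards1 !addnA addn0.
Qed.

End SylowPoints.

Arguments SylP {gT G P}.
Arguments Syl_atP {gT G P k Q}.

Section NormalPoints.

Variables (gT : finGroupType) (G : {group gT}).
Implicit Types (A B E P Q T : {group gT}).
Local Notation Om := 'Syl_2(G).

Lemma Syl_normaliserE E P : P \in Om -> P \subset 'N(E) ->
  'Syl_2('N_G(E)) = [set T in Om | gval T \subset 'N(E)].
Proof.
move=> oP nPE; have sPN : P \subset 'N_G(E) by rewrite subsetI Syl_sub.
have sylP : 2.-Sylow('N_G(E)) P by apply: pHall_subl (SylP oP); rewrite ?subsetIl.
apply/setP=> T; rewrite [RHS]in_set; apply/SylP/andP=> [sylT|[oT nT]].
  have [x /setIP[Gx nx] eT] := Sylow_trans sylP sylT.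
  have -> : T = (P :^ x)%G by apply: group_inj.
  by rewrite SylJ //= -(normP nx) normJ conjSg.
by apply: pHall_subl (SylP oT); rewrite ?subsetIl // subsetI Syl_sub.
Qed.

(** Both sides are the index in G of the common normaliser of P and E. *)
Lemma card_Syl_normaliser E P : P \in Om -> P \subset 'N(E) ->
  (#|Om| * #|'N_G(P) : 'N(E)|)%N = (#|G : 'N_G(E)| * #|'Syl_2('N_G(E))|)%N.
Proof.
move=> oP nPE; have sPN : P \subset 'N_G(E) by rewrite subsetI Syl_sub.
have sylP : 2.-Sylow('N_G(E)) P by apply: pHall_subl (SylP oP); rewrite ?subsetIl.
rewrite (card_Syl sylP) (card_Syl (SylP oP)) -(indexgI 'N_G(P)).
have e1 := Lagrange_index (subsetIl G 'N(P)) (subsetIl 'N_G(P) 'N(E)).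
have s2 : 'N_G(P) :&: 'N(E) \subset 'N_G(E) by rewrite setIAC subsetIl.
have e2 := Lagrange_index (subsetIl G 'N(E)) s2.
by rewrite e1 -e2 setIAC.
Qed.

Lemma odd_card_Syl (H : {group gT}) : odd #|'Syl_2(H)|.
Proof. by have := card_Syl_mod H (isT : prime 2); rewrite modn2; case: odd. Qed.

End NormalPoints.

Lemma index_Syl_cases (gT : finGroupType) (G P U : {group gT}) :
    P \in 'Syl_2(G) -> U \in 'Syl_2(G) -> U != P -> #|'Syl_2(G)| <= 25 ->
  [\/ #|P : U| = 2, #|P : U| = 4, #|P : U| = 8 | #|P : U| = 16].
Proof.
move=> oP oU ne le25; have [i ei] := index_Syl_pow U oP.
have le := leq_trans (index_Syl_le oP oU) le25.
have gt1 : 1 < #|P : U| by apply: index_Syl_gt1 oP oU _; rewrite eq_sym.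
move: le gt1; rewrite ei; clear.
case: i => [|[|[|[|[|i]]]]] //= le _; [exact: Or41|exact: Or42|exact: Or43|exact: Or44|].
have : 2 ^ 5 <= 2 ^ i.+4.+1 by rewrite leq_pexp2l.
lia.
Qed.

(** * Redundancy and lines *)

Section Lines.

Variables (gT : finGroupType) (G : {group gT}).
Implicit Types (A B H K L M P Q T U : {group gT}) (x y z : gT).

Local Notation Om := 'Syl_2(G).
Local Notation F := (Syl_above G).

(** One redundant Sylow 2-subgroup gives this property at every point, by
    conjugacy. *)
Definition redundant := forall T x, T \in Om -> x \in T ->
  exists Q : {group gT}, [/\ Q \in Om, Q != T & x \in Q].

(** P is not the union of M1 and M2, and an element outside both lies in some
    point other than P. *)
Lemma redundant_index2 P (M1 M2 : {group gT}) :
    redundant -> P \in Om -> ~~ (P \subset M1) -> ~~ (P \subset M2) ->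
  exists Q, [/\ Q \in Om, Q != P, ~~ (P :&: Q \subset M1) & ~~ (P :&: Q \subset M2)].
Proof.
move=> red oP n1 n2.
have /subsetPn[x Px] : ~~ (P \subset M1 :|: M2).
  by apply/negP=> /sub_union_group; rewrite (negPf n1) (negPf n2).
rewrite inE => /norP[M1x M2x]; have [Q [oQ neQ Qx]] := red P x oP Px.
by exists Q; split=> //; apply/subsetPn; exists x; rewrite // inE Px.
Qed.

Lemma Syl_aboveP A Q : reflect (Q \in Om /\ A \subset Q) (Q \in F A).
Proof. by rewrite [X in reflect _ X]in_set; apply: andP. Qed.

Arguments Syl_aboveP {A Q}.

Lemma Syl_aboveJ A Q x :
  x \in 'N_G(A) -> ((Q :^ x)%G \in F A) = (Q \in F A).
Proof.
case/setIP=> Gx nAx; apply/Syl_aboveP/Syl_aboveP; rewrite SylJ //=.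
  by rewrite -{1}(normP nAx) conjSg.
by case=> oQ sAQ; rewrite -(normP nAx) conjSg.
Qed.

Lemma card_Syl_at P T k : P \in Om -> T \in Om ->
  #|Syl_at G P k| = #|Syl_at G T k|.
Proof.
move=> oP oT; have [x Gx ->] := Syl_conj oP oT.
rewrite -(card_imset _ (act_inj 'JG x)) /=; apply: eq_card => Q.
apply/imsetP/idP=> [[R /Syl_atP[oR iR] ->]|/Syl_atP[oQ iQ]].
  by apply/Syl_atP; rewrite SylJ //= indexJg.
exists ((Q :^ x^-1)%G).
  by apply/Syl_atP; rewrite SylJ ?groupV // -(indexJg _ _ x) /= conjsgKV.
by apply: group_inj; rewrite /= conjsgKV.
Qed.

Lemma norm_cap_index2 P Q : #|P : Q| = 2 -> P \subset 'N(P :&: Q).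
Proof.
move=> iPQ; apply: normal_norm; apply: index2_normal; rewrite ?subsetIl //.
by rewrite indexgI.
Qed.

Lemma norm_sub_Syl A T :
  T \in Om -> 2.-group A -> A \subset G -> T \subset 'N(A) -> A \subset T.
Proof.
move=> oT pA sAG nAT; have sTG := Syl_sub oT.
have pTA : 2.-group (T <*> A) by rewrite norm_joinEl // pgroupM (Syl_pgroup oT).
have sTA : T <*> A \subset G by rewrite join_subG sTG.
by rewrite -(sub_pHall (SylP oT) pTA (joing_subl _ _) sTA) joing_subr.
Qed.

(** Let S be P :&: Q. If T normalises S then S is contained in T by maximality
    of T. Otherwise T :&: P and T :&: Q, which normalise S and have index two
    in T, are both equal to the normaliser of S in T; so they coincide, lie in
    S, and equal S by order. *)
Lemma no_triangle P Q T : P \in Om -> Q \in Om -> T \in Om ->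
  #|P : Q| = 2 -> #|T : P| = 2 -> #|T : Q| = 2 -> P :&: Q \subset T.
Proof.
move=> oP oQ oT iPQ iTP iTQ; apply: contraT => nST.
have cardI (U V : {group gT}) : #|U : V| = 2 -> (#|U :&: V| * 2)%N = #|U|.
  by move=> <-; rewrite -indexgI Lagrange ?subsetIl.
have nS : T \subset 'N(P :&: Q).
  have := subsetIl T 'N(P :&: Q); have := subsetIl T P.
  have sP : T :&: P \subset T :&: 'N(P :&: Q).
    by rewrite setIS // norm_cap_index2.
  have sQ : T :&: Q \subset T :&: 'N(P :&: Q).
    by rewrite setIS // setIC norm_cap_index2 // (index_Syl_sym oQ oP).
  have [//|ltY] := boolP (T \subset 'N(P :&: Q)).
  have cPQ : #|T :&: P| = #|T :&: Q|.
    by apply/eqP; rewrite -(eqn_pmul2r (isT : 0 < 2)) !cardI.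
  have sN (U : {group gT}) : #|T : U| = 2 -> T :&: U \subset T :&: 'N(P :&: Q) ->
      T :&: 'N(P :&: Q) \subset T :&: U.
    move=> iTU sU; have := index2_between sU (subsetIl _ _); rewrite indexgI.
    by case/(_ iTU)/orP=> // /subsetIP[_]; rewrite (negPf ltY).
  have {sN} [eP eQ] : T :&: P = T :&: 'N(P :&: Q) /\ T :&: Q = T :&: 'N(P :&: Q).
    by split; apply/eqP; rewrite eqEsubset ?sP ?sQ sN.
  case/negP: nST; have sPQ : T :&: P \subset P :&: Q.
    by rewrite subsetI subsetIr eP -eQ subsetIr.
  suff /eqP <- : T :&: P == P :&: Q by apply: subsetIl.
  rewrite eqEcard sPQ -(leq_pmul2r (isT : 0 < 2)) !cardI //.
  by rewrite (Syl_card oP oT) /=.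
case/negP: nST; apply: norm_sub_Syl => //.
  by rewrite (pgroupS _ (Syl_pgroup oP)) ?subsetIl.
by rewrite subIset // (Syl_sub oP).
Qed.

(** Both sides are the index in G of the common normaliser of A and P. *)
Lemma card_line_orbit A P : P \in F A ->
    (forall T, T \in F A -> exists2 x, x \in 'N_G(A) & T = (P :^ x)%G) ->
  (#|Om| * #|'N_G(P) : 'N(A)|)%N = (#|G : 'N_G(A)| * #|F A|)%N.
Proof.
move=> PA trA; have [oP sAP] := Syl_aboveP PA.
have -> : F A = orbit 'JG 'N_G(A) P.
  apply/setP=> T; apply/idP/orbitP=> [/trA[x nx ->]|[x nx <-]]; first by exists x.
  by rewrite Syl_aboveJ.
rewrite card_orbit astab1JG (card_Syl (SylP oP)) -(indexgI 'N_G(P)).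
have -> : 'N_('N_G(A))(P) = 'N_G(P) :&: 'N(A) by rewrite setIAC.
have e1 := Lagrange_index (subsetIl G 'N(P)) (subsetIl 'N_G(P) 'N(A)).
have s2 : 'N_G(P) :&: 'N(A) \subset 'N_G(A) by rewrite setIAC subsetIl.
by have e2 := Lagrange_index (subsetIl G 'N(A)) s2; rewrite e1 e2.
Qed.

Section MinIndex.

Variable k : nat.
Hypothesis minK : forall T U, T \in Om -> U \in Om -> T != U -> k <= #|T : U|.

(** When k is the least distance between distinct points, F A is then a line
    of the geometry: by [line_cap] any two of its points meet in A. *)
Definition isline A := 1 < #|F A| /\ (forall T, T \in F A -> #|T : A| = k).

(** T :&: U contains A, and by minimality of k it is not larger. *)
Lemma line_cap A T U :
  isline A -> T \in F A -> U \in F A -> T != U -> T :&: U = A.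
Proof.
move=> [_ iA] TA UA ne; have [oT sAT] := Syl_aboveP TA.
have [oU sAU] := Syl_aboveP UA.
apply/eqP; rewrite eq_sym eqEcard subsetI sAT sAU /=.
have := minK oT oU ne; rewrite -indexgI -(iA _ TA) => le.
have e1 := Lagrange sAT; have e2 := Lagrange (subsetIl T U).
rewrite leqNgt; apply/negP=> lt.
have : #|A| * #|T : A| < #|T :&: U| * #|T : T :&: U| by apply: ltn_mull.
by rewrite e1 e2 ltnn.
Qed.

Lemma line_of P Q : P \in Om -> Q \in Om -> 1 < k -> #|P : Q| = k ->
  isline (P :&: Q)%G.
Proof.
move=> oP oQ k1 iPQ; have ne : P != Q.
  by apply/eqP=> e; rewrite e indexgg in iPQ; rewrite -iPQ in k1.
split=> [|T /Syl_aboveP[oT sT]]; last first.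
  rewrite -divgS //= (Syl_card oT oP) -iPQ -indexgI -divgS //; exact: subsetIl.
have PA : P \in F (P :&: Q) by apply/Syl_aboveP; rewrite subsetIl.
have QA : Q \in F (P :&: Q) by apply/Syl_aboveP; rewrite subsetIr.
by rewrite (cardsD1 P) (cardsD1 Q) PA in_setD1 QA eq_sym ne.
Qed.

(** For T on the line, 'N_T(A) is a Sylow 2-subgroup of 'N_G(A): otherwise a
    larger 2-subgroup of 'N_G(A) lies in another point of the line, which
    meets T in A only, whereas A < 'N_T(A) by the normaliser condition in the
    2-group T. The same argument shows that T is determined by 'N_T(A). *)
Lemma line_trans A P T : isline A -> P \in F A -> T \in F A ->
  exists2 x, x \in 'N_G(A) & T = (P :^ x)%G.
Proof.
move=> lA; have sylN U : U \in F A -> 2.-Sylow('N_G(A)) 'N_U(A).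
  move=> UA; have [oU sAU] := Syl_aboveP UA; have sUG := Syl_sub oU.
  have pNU : 2.-group 'N_U(A) by rewrite (pgroupS _ (Syl_pgroup oU)) ?subsetIl.
  have [Y sylY sNY] := Sylow_superset (setSI 'N(A) sUG) pNU.
  have [sYN pY _] := and3P sylY.
  have [V sylV sYV] := Sylow_superset (subset_trans sYN (subsetIl _ _)) pY.
  have oV : V \in Om by apply/SylP.
  have sAN : A \subset 'N_U(A) by rewrite subsetI sAU normG.
  have VA : V \in F A by apply/Syl_aboveP; rewrite oV (subset_trans sAN) ?(subset_trans sNY).
  have [eUV|neUV] := eqVneq U V.
    suff -> : 'N_U(A) = Y by [].
    apply/eqP; rewrite eqEsubset sNY subsetI eUV sYV /=.
    by case/subsetIP: sYN.
  have eA := line_cap lA UA VA neUV.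
  have prA : A \proper U.
    rewrite properE sAU; apply/negP=> sUA.
    by case/negP: neUV; apply/eqP/(Syl_eq oU oV)/(subset_trans sUA); case/Syl_aboveP: VA.
  have := nilpotent_proper_norm (pgroup_nil (Syl_pgroup oU)) prA.
  have sNA : 'N_U(A) \subset U :&: V.
    by rewrite subsetI subsetIl (subset_trans sNY sYV).
  by rewrite eA in sNA; rewrite properE sNA andbF.
move=> PA TA; have [x nx ex] := Sylow_trans (sylN P PA) (sylN T TA).
exists x => //; have PxA : (P :^ x)%G \in F A by rewrite Syl_aboveJ.
apply/eqP; apply: contraT => ne; have [oT sAT] := Syl_aboveP TA.
have eA := line_cap lA TA PxA ne.
have prA : A \proper T.
  have [oPx _] := Syl_aboveP PxA.
  rewrite properE sAT; apply/negP=> sUA.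
  by case/negP: ne; apply/eqP/(Syl_eq oT oPx)/(subset_trans sUA); case/Syl_aboveP: PxA.
have := nilpotent_proper_norm (pgroup_nil (Syl_pgroup oT)) prA.
have sNA : 'N_T(A) \subset T :&: (P :^ x).
  by rewrite subsetI subsetIl ex conjSg subsetIl.
by rewrite eA in sNA; rewrite properE sNA andbF.
Qed.

End MinIndex.

End Lines.

Arguments Syl_aboveP {gT G A Q}.

(** * Groups with few Sylow 2-subgroups *)

Section SmallSyl.

Variables (gT : finGroupType) (G : {group gT}).
Implicit Types (A B H K L M P Q T U : {group gT}) (x y z : gT).

Local Notation Om := 'Syl_2(G).
Local Notation F := (Syl_above G).

Lemma cap_conj P Q x : x \in P -> P :&: Q :^ x = (P :&: Q) :^ x.
Proof. by move=> Px; rewrite conjIg (conjGid Px). Qed.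

(** M is any subgroup of index two above P :&: B: being normal in P, it
    contains the conjugates of this intersection. *)
Lemma pgroup_orbit_cover P B : 2.-group P -> ~~ (P \subset B) ->
  exists M : {group gT}, [/\ M <| P, #|P : M| = 2
     & forall x, x \in P -> P :&: B :^ x \subset M].
Proof.
move=> pP nPB; have [M [sM nM iM]] := pgroup_maximal_above pP nPB.
exists M; split=> // x Px; rewrite cap_conj // -(normsP (normal_norm nM) x Px).
by rewrite conjSg.
Qed.

Lemma Syl_at_orbit P Q k : P \in Om -> #|Syl_at G P k| = k -> Q \in Syl_at G P k ->
  Syl_at G P k = orbit 'JG P Q.
Proof.
move=> oP ck PkQ; have [oQ iPQ] := Syl_atP PkQ; apply/eqP.
rewrite eq_sym eqEcard (card_Syl_orbit oP oQ) ck iPQ leqnn andbT.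
by rewrite acts_sub_orbit // acts_Syl_at.
Qed.

Lemma Syl_at_cover P k : P \in Om -> 1 < k -> #|Syl_at G P k| = k ->
  exists M : {group gT}, [/\ M <| P, #|P : M| = 2
     & forall Q, Q \in Syl_at G P k -> P :&: Q \subset M].
Proof.
move=> oP k1 ck; have /card_gt0P[Q PkQ] : 0 < #|Syl_at G P k| by rewrite ck; lia.
have [oQ iPQ] := Syl_atP PkQ; have nPQ : ~~ (P \subset Q).
  by apply: contraTN k1; rewrite -indexg_eq1 iPQ => /eqP->.
have [M [nM iM sM]] := pgroup_orbit_cover (Syl_pgroup oP) nPQ.
exists M; split=> // T; rewrite (Syl_at_orbit oP ck PkQ) => /orbitP[x Px <-].
exact: sM.
Qed.

Lemma Syl_at_full P k : P \in Om -> 1 < k -> #|Om| = (#|Syl_at G P k|).+1 ->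
  forall T U, T \in Om -> U \in Om -> T != U -> #|T : U| = k.
Proof.
move=> oP k1 cO T U oT oU neTU.
have sT : Syl_at G T k \subset Om by apply/subsetP=> V /Syl_atP[].
have eT : #|Om :\: Syl_at G T k| = 1%N.
  have e := cardsID (Syl_at G T k) Om; rewrite (setIidPr sT) in e.
  apply/eqP; rewrite -(eqn_add2l #|Syl_at G T k|) e cO addn1.
  by rewrite (card_Syl_at k oP oT).
have oTk : T \in Om :\: Syl_at G T k.
  rewrite inE oT andbT; apply/negP=> /Syl_atP[_].
  by rewrite indexgg => e; rewrite -e in k1.
have /cards1P[V eV] : #|Om :\: Syl_at G T k| == 1%N by apply/eqP.
have eTV : T = V by apply/set1P; rewrite -eV.
apply/eqP; apply: contraT => nk; have: U \in Om :\: Syl_at G T k.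
  by rewrite inE oU andbT; apply: contra nk => /Syl_atP[_ ->].
by rewrite eV -eTV inE eq_sym (negPf neTU).
Qed.

(** By [no_triangle] every point contains P :&: Q, which is therefore the
    intersection of all the points. *)
Lemma all_index2_core P Q :
    P \in Om -> Q \in Om -> Q != P -> #|Om| = (#|Syl_at G P 2|).+1 ->
  [/\ P :&: Q <| G, #|P : P :&: Q| = 2
     & forall T, T \in Om -> T != P -> P :&: T = P :&: Q].
Proof.
move=> oP oQ neQ cO; have i2 := Syl_at_full oP (ltnSn 1) cO.
have iPQ : #|P : Q| = 2 by apply: i2; rewrite // eq_sym.
have sS T : T \in Om -> P :&: Q \subset T.
  move=> oT; have [->|neTP] := eqVneq T P; first exact: subsetIl.
  have [->|neTQ] := eqVneq T Q; first exact: subsetIr.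
  by apply: (no_triangle oP oQ oT) => //; apply: i2.
have cI (T U : {group gT}) : T \in Om -> U \in Om -> T != U ->
    (#|T :&: U| * 2)%N = #|P|.
  move=> oT oU ne; rewrite (Syl_card oP oT) -(i2 T U) // -indexgI.
  by rewrite Lagrange ?subsetIl.
split; last 1 first.
- move=> T oT neT; apply/eqP; rewrite eq_sym eqEcard subsetI subsetIl sS //=.
  by rewrite -(leq_pmul2r (isT : 0 < 2)) !cI // eq_sym.
- rewrite /normal subIset ?(Syl_sub oP) //=; apply/subsetP=> x Gx.
  rewrite inE; suff e : P :&: Q = (P :&: Q) :^ x by rewrite -e.
  apply/eqP; rewrite eqEcard cardJg leqnn andbT conjIg subsetI.
  by rewrite (sS (P :^ x)%G) ?(sS (Q :^ x)%G) ?SylJ.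
by rewrite indexgI.
Qed.

Lemma all_index2_cover P : P \in Om -> #|Om| = (#|Syl_at G P 2|).+1 -> 1 < #|Om| ->
  exists M : {group gT}, [/\ M <| P, #|P : M| = 2
     & forall Q, Q \in Om -> Q != P -> P :&: Q \subset M].
Proof.
move=> oP cO gt1; have /card_gt0P[Q /setD1P[neQP oQ]] : 0 < #|Om :\ P|.
  by move: gt1; rewrite (cardsD1 P) oP.
have [_ iM capM] := all_index2_core oP oQ neQP cO.
exists (P :&: Q)%G; split=> //; first by rewrite index2_normal ?subsetIl.
by move=> T oT neT; rewrite capM.
Qed.

(** P and its two neighbours are the points of a line whose subgroup P :&: Q
    is normalised by 'N_G(P), so that each point is on exactly one conjugate
    of this line. *)
Lemma Syl_pair_line P : P \in Om -> #|Syl_at G P 2| = 2 -> 3 %| #|Om|.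
Proof.
move=> oP c2; have /card_gt0P[Q PQ] : 0 < #|Syl_at G P 2| by rewrite c2.
have [oQ iPQ] := Syl_atP PQ; pose S := (P :&: Q)%G.
have iS : #|P : S| = 2 by rewrite indexgI.
have nPS : P \subset 'N(S) by apply: norm_cap_index2.
have capS T : T \in Syl_at G P 2 -> P :&: T = S.
  rewrite (Syl_at_orbit oP c2 PQ) => /orbitP[x Px <-] /=.
  by rewrite cap_conj // (normsP nPS).
have min2 T U : T \in Om -> U \in Om -> T != U -> 2 <= #|T : U|.
  exact: index_Syl_gt1.
have lS : isline G 2 S by apply: line_of.
have PS : P \in F S by apply/Syl_aboveP; rewrite subsetIl.
have nNS : 'N_G(P) \subset 'N(S).
  apply/subsetP=> x /setIP[Gx nPx]; apply/normP.
  have PQx : (Q :^ x)%G \in Syl_at G P 2.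
    by apply/Syl_atP; rewrite SylJ // -(indexJg P Q x) (normP nPx) in iPQ *.
  by rewrite -[RHS](capS _ PQx) /= conjIg (normP nPx).
have eF : F S = P |: Syl_at G P 2.
  apply/setP=> T; rewrite in_setU1; apply/idP/orP=> [TS|[/eqP-> //|PT]].
    have [oT sT] := Syl_aboveP TS.
    have [->|neT] := eqVneq T P; [by left | right].
    apply/Syl_atP; split=> //; rewrite -iS -indexgI; congr #|_ : _|.
  by apply: (line_cap min2 lS PS TS); rewrite eq_sym.
  have [oT _] := Syl_atP PT; apply/Syl_aboveP; split=> //.
  by rewrite -(capS T PT) subsetIr.
have := card_line_orbit PS (fun T => line_trans min2 lS PS).
rewrite -[#|'N_G(P) : _|]indexgI (setIidPl nNS) indexgg muln1 => ->.
have nPP : P \notin Syl_at G P 2 by apply/negP=> /Syl_atP[_]; rewrite indexgg.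
by rewrite eF cardsU1 c2 nPP dvdn_mull.
Qed.

(** The other points are all at distance two from P, or form a single orbit at
    distance four. The only other decomposition, 7 = 1 + 2 + 4, is excluded by
    [Syl_pair_line]. *)
Lemma small_Syl_cover P : P \in Om -> #|Om| \in [:: 3; 5; 7] ->
  exists M : {group gT}, [/\ M <| P, #|P : M| = 2
     & forall Q, Q \in Om -> Q != P -> P :&: Q \subset M].
Proof.
move=> oP nO; have le25 : #|Om| <= 25 by move: nO; rewrite !inE; lia.
have eO := card_Syl_split oP le25.
have d2 := dvdn_Syl_at 2 oP; have d4 := dvdn_Syl_at 4 oP.
have d8 := dvdn_Syl_at 8 oP; have d16 := dvdn_Syl_at 16 oP.
have n3 : #|Syl_at G P 2| = 2 -> 3 %| #|Om| := Syl_pair_line oP.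
have [/eqP c2|c2] := boolP (#|Om| == (#|Syl_at G P 2|).+1).
  by apply: all_index2_cover; rewrite // c2; move: nO; rewrite !inE c2; lia.
have [c4 cO] : #|Syl_at G P 4| = 4 /\ #|Om| = (#|Syl_at G P 4|).+1.
  move: nO n3 c2 d2 d4 d8 d16; rewrite eO !inE.
  by move: #|_| #|_| #|_| #|_| => a b c d; lia.
have [M [nM iM sM]] := Syl_at_cover oP (isT : 1 < 4) c4.
exists M; split=> // Q oQ neQ; apply: sM; apply/Syl_atP; split=> //.
by apply: (Syl_at_full oP (isT : 1 < 4)) => //; rewrite eq_sym.
Qed.

End SmallSyl.

Section OrbitCovers.

Variables (gT : finGroupType) (G : {group gT}).
Implicit Types (M P Q T U V : {group gT}).

Local Notation Om := 'Syl_2(G).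

Lemma Syl_at_cover_le P k : P \in Om -> 1 < k -> #|Syl_at G P k| <= k -> ~~ (P \subset [1]) ->
  exists M : {group gT}, #|P : M| = 2 /\
     (forall Q, Q \in Syl_at G P k -> P :&: Q \subset M).
Proof.
move=> oP k1 le nP1; have := dvdn_Syl_at k oP.
have [e0 _|ne0 dk] := eqVneq #|Syl_at G P k| 0.
  have [M [_ _ iM]] := pgroup_maximal_above (Syl_pgroup oP) nP1.
  by exists M; split=> // Q Qk; rewrite (card0_eq e0) in Qk.
have ck : #|Syl_at G P k| = k.
  by apply/eqP; rewrite eqn_leq le dvdn_leq // lt0n.
by have [M [_ iM sM]] := Syl_at_cover oP k1 ck; exists M.
Qed.

(** Each P-orbit at distance k has k elements. *)
Lemma Syl_at_two_orbits P T k : P \in Om -> 0 < k -> #|Syl_at G P k| = (2 * k)%N ->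
    T \in Syl_at G P k ->
  exists2 U, U \in Syl_at G P k & forall V, V \in Syl_at G P k ->
    V \in orbit 'JG P T \/ V \in orbit 'JG P U.
Proof.
move=> oP k0 ck Tk; have [oT iT] := Syl_atP Tk; have aP := acts_Syl_at k oP.
have sOT : orbit 'JG P T \subset Syl_at G P k by rewrite acts_sub_orbit.
have cR : #|Syl_at G P k :\: orbit 'JG P T| = k.
  by rewrite cardsD (setIidPr sOT) ck (card_Syl_orbit oP oT) iT mul2n -addnn addnK.
have /card_gt0P[U /setDP[Uk nOU]] : 0 < #|Syl_at G P k :\: orbit 'JG P T| by rewrite cR.
have [oU iU] := Syl_atP Uk.
have eR : Syl_at G P k :\: orbit 'JG P T = orbit 'JG P U.
  apply/eqP; rewrite eq_sym eqEcard cR (card_Syl_orbit oP oU) iU leqnn andbT subsetD.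
  rewrite acts_sub_orbit // Uk /=; apply/pred0P=> V /=; apply/negP=> /andP[oV1 oV2].
  by case/negP: nOU; rewrite -(orbit_eqP oV2) orbit_sym.
exists U => // V Vk; case VT: (V \in orbit 'JG P T); [by left|right].
by rewrite -eR inE VT.
Qed.

End OrbitCovers.

(** * Subgroups between the normaliser of a point and the group *)

Lemma mem357_le7 a : a \in [:: 3; 5; 7] -> a <= 7.
Proof. by rewrite !inE => /or3P[] /eqP->. Qed.

(** The possible values of |G : H| and of the number of Sylow 2-subgroups of
    H, for H strictly between the normaliser of a point and G. *)
Lemma odd_factors_357 a b : odd (a * b) -> a * b <= 25 -> 1 < a -> 1 < b ->
  [/\ a \in [:: 3; 5; 7], b \in [:: 3; 5; 7] & a = 7 -> b = 3].
Proof.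
move=> oab le ga gb; suff /and3P[-> -> /implyP h] :
    [&& a \in [:: 3; 5; 7], b \in [:: 3; 5; 7] & (a == 7) ==> (b == 3)].
  by split=> // /eqP/h/eqP.
have chk : all (fun x => all (fun y => odd (x * y) && (x * y <= 25) ==>
    [&& x \in [:: 3; 5; 7], y \in [:: 3; 5; 7] & (x == 7) ==> (y == 3)])
    (iota 2 11)) (iota 2 11) by [].
have la : a \in iota 2 11.
  by rewrite mem_iota ga ltnNge; apply/negP=> h; have := leq_trans (leq_mul h gb) le.
have lb : b \in iota 2 11.
  by rewrite mem_iota gb ltnNge; apply/negP=> h; have := leq_trans (leq_mul ga h) le.
by have /implyP-> := allP (allP chk a la) b lb; rewrite // oab le.
Qed.

(** For a conjugates of H, of which b and c are at distance two and four from
    P. *)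
Lemma block_counts a b c : a \in [:: 3; 5; 7] -> a = (1 + b + c)%N -> 2 %| b -> 4 %| c ->
  [\/ c = 0%N, b = 0%N /\ c = 4 | [/\ a = 7, b = 2 & c = 4]].
Proof.
move=> a7 e /dvdnP[i eb] /dvdnP[j ec]; subst b c a.
have: j < 2 by have := mem357_le7 a7; lia.
case: j a7 => [|[|j]] // a7 _; [by constructor 1 | ].
have: i < 2 by have := mem357_le7 a7; lia.
by case: i a7 => [|[|i]] // a7 _; [constructor 2 | constructor 3].
Qed.

(** For an H-orbit of i conjugates of H, among a conjugates in all. *)
Lemma block_orbit_six i a : 2 %| i -> ~~ (4 %| i) -> i != 2 -> i < a -> a \in [:: 3; 5; 7] ->
  i = 6 /\ a = 7.
Proof.
rewrite !inE => d2 d4 n2 ia /or3P[] /eqP e; subst a.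
- by case: i d2 d4 n2 ia => [|[|[|i]]].
- by case: i d2 d4 n2 ia => [|[|[|[|[|i]]]]].
by case: i d2 d4 n2 ia => [|[|[|[|[|[|[|i]]]]]]].
Qed.

Lemma four_parts_3 b c d e : 3 = (1 + b + c + d + e)%N -> 4 %| c -> 8 %| d -> 16 %| e ->
   3 = b.+1.
Proof. by move=> h /dvdnP[i ei] /dvdnP[j ej] /dvdnP[k ek]; subst; lia. Qed.

Section Blocks.

Variables (gT : finGroupType) (G P H : {group gT}).
Implicit Types (A B K L M Q S T U : {group gT}) (x y z : gT).

Local Notation Om := 'Syl_2(G).

Hypotheses (oP : P \in Om) (sNH : 'N_G(P) \subset H) (sHG : H \subset G).

Let sPH : P \subset H.
Proof. by rewrite (subset_trans _ sNH) // subsetI normG (Syl_sub oP). Qed.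

Lemma block_Syl : P \in 'Syl_2(H).
Proof. by apply/SylP; apply: pHall_subl (SylP oP). Qed.
Let oPH := block_Syl.

Lemma block_SylE Q : (Q \in 'Syl_2(H)) = (Q \in Om) && (Q \subset H).
Proof.
apply/idP/andP=> [oQ|[oQ sQH]]; last by apply/SylP; apply: pHall_subl (SylP oQ).
have [x Hx ->] := Syl_conj oPH oQ.
by rewrite SylJ ?(subsetP sHG) // -(conjGid Hx) conjSg.
Qed.

Lemma card_block : #|Om| = (#|G : H| * #|'Syl_2(H)|)%N.
Proof.
rewrite (card_Syl (SylP oP)) (card_Syl (SylP oPH)).
have -> : 'N_H(P) = 'N_G(P).
  by apply/eqP; rewrite eqEsubset setSI // subsetI sNH subsetIr.
by rewrite Lagrange_index.
Qed.

(** P and P :^ x are Sylow 2-subgroups of H :^ x, hence conjugate by some y in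
    it; then x * y normalises P and lies in H. *)
Lemma block_conj x : x \in G -> P \subset H :^ x -> x \in H.
Proof.
move=> Gx sPx; have sylx : 2.-Sylow(H :^ x) (P :^ x).
  by rewrite pHallJ2; apply/SylP.
have sylP : 2.-Sylow(H :^ x) P.
  by apply: pHall_subl (SylP oP); rewrite // -(conjGid Gx) conjSg.
have [y Hy eP] := Sylow_trans sylx sylP.
have Gy : y \in G by move: Hy; rewrite mem_conjg => /(subsetP sHG); rewrite groupJr ?groupV.
have Hxy : x * y \in H.
  by apply: (subsetP sNH); rewrite inE groupM //; apply/normP; rewrite conjsgM -eP.
suff eH : H :^ x = H by move: Hxy; rewrite groupMr // -eH.
by rewrite -(conjGid Hy) -conjsgM (conjGid Hxy).
Qed.

(** As H contains 'N_G(P), the points below the conjugates of H are the blocks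
    of a system of imprimitivity, and a conjugate of H is the stabiliser of
    its block. Blocks are encoded by their stabilisers. *)
Definition blocks := orbit 'JG G H.

Lemma blocksP K : reflect (exists2 x, x \in G & K = (H :^ x)%G) (K \in blocks).
Proof. by apply: (iffP orbitP) => [[x Gx <-]|[x Gx ->]]; exists x. Qed.

Lemma block_norm K : K \in blocks -> 'N_G(K) = K.
Proof.
case/blocksP=> x Gx -> /=; apply/eqP; rewrite eqEsubset subsetI normG andbT.
rewrite -(conjGid Gx) conjSg sHG andbT; apply/subsetP=> y.
rewrite (conjGid Gx) inE => /andP[Gy nHy]; rewrite mem_conjg.
apply: block_conj; first by rewrite groupJ ?groupV.
rewrite conjgE invgK !conjsgM (normP nHy) conjsgK.
exact: sPH.
Qed.

Lemma card_blocks : #|blocks| = #|G : H|.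
Proof.
rewrite card_orbit astab1JG (block_norm (K := H)) //; exact: orbit_refl.
Qed.

Lemma card_block_orbit L K :
  L \subset G -> K \in blocks -> #|orbit 'JG L K| = #|L : K|.
Proof.
move=> sLG BK; rewrite card_orbit astab1JG -[RHS]indexgI; congr #|_ : _|.
by rewrite -{1}(setIidPl sLG) -setIA (block_norm BK).
Qed.

Lemma block_self K : K \in blocks -> P \subset K -> K = H.
Proof.
case/blocksP=> x Gx -> sPx; apply: group_inj; exact/conjGid/block_conj.
Qed.

Definition blocks_at k := [set K in blocks | #|P : K| == k].

Lemma blocks_atP k K :
  reflect (K \in blocks /\ #|P : K| = k) (K \in blocks_at k).
Proof.
rewrite [X in reflect _ X]in_set.
by apply: (iffP andP) => [[-> /eqP]|[-> ->]].
Qed.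

Lemma acts_blocks L : L \subset G -> [acts L, on blocks | 'JG].
Proof.
move=> sLG; apply/actsP=> x Lx K; have Gx := subsetP sLG x Lx.
apply/idP/idP=> /blocksP[y Gy e]; apply/blocksP.
  exists (y * x^-1); rewrite ?groupM ?groupV //; apply: group_inj => /=.
  by rewrite conjsgM -(congr_group e) /= conjsgK.
by exists (y * x); rewrite ?groupM // e; apply: group_inj; rewrite /= conjsgM.
Qed.

Lemma acts_blocks_at k : [acts P, on blocks_at k | 'JG].
Proof.
have sPG := Syl_sub oP; apply/actsP=> x Px K.
have e := acts_act (acts_blocks sPG) Px K.
have i : #|P : K :^ x| = #|P : K| by rewrite -{1}(conjGid Px) indexJg.
by apply/blocks_atP/blocks_atP; rewrite e /= i.
Qed.

Lemma dvdn_blocks_at k : k %| #|blocks_at k|.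
Proof.
apply: (dvdn_acts (acts_blocks_at k)) => K /blocks_atP[BK <-].
by rewrite card_block_orbit ?(Syl_sub oP).
Qed.

(** The kernel of the action of G on the blocks. *)
Definition block_core := [group of gcore H G].

Lemma block_core_sub : block_core \subset H.
Proof. exact: gcore_sub. Qed.

Lemma block_core_norm : G \subset 'N(block_core).
Proof. exact: gcore_norm. Qed.

Lemma mem_block_core u :
  (forall K, K \in blocks -> K != H -> u \in K) -> u \in H -> u \in block_core.
Proof.
move=> uK uH; apply/bigcapP=> x Gx.
have BK : (H :^ x)%G \in blocks by apply/blocksP; exists x.
by have [e|ne] := eqVneq (H :^ x)%G H; [rewrite -[H :^ x]/(gval (H :^ x)%G) e | apply: (uK _ BK)].
Qed.

(** The 2'-part of every element of V lies in the core, so V is a 2-group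
    modulo the core and the image of P is all of it. *)
Lemma odd_core_Sylow (V : {group gT}) :
    P \subset V -> V \subset H -> block_core \subset V ->
    (forall u, u \in V -> odd #[u] -> u \in block_core) ->
  V \subset block_core * P.
Proof.
move=> sPV sVH sKV oddV; have sVG := subset_trans sVH sHG.
have nKV := subset_trans sVG block_core_norm.
have pVK : 2.-group (V / block_core).
  apply/pgroupP=> q pr_q; case/Cauchy=> // xb /morphimP[x nx Vx ->] ox.
  have Vx' : x.`_2^' \in V by rewrite groupX.
  have ox' : odd #[x.`_2^'].
    have := p_elt_constt 2^' x; rewrite /p_elt -odd_2'nat //.
  have Kx' := oddV _ Vx' ox'.
  have ex : coset block_core x = coset block_core (x.`_2).
    by rewrite -{1}(consttC 2 x) morphM ?groupX // [X in _ * X]coset_id ?mulg1.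
  have : 2.-elt (coset block_core x).
    by rewrite ex morph_p_elt ?groupX // p_elt_constt.
  by rewrite /p_elt ox pnatE.
have sylPV : 2.-Sylow(V) P by apply: pHall_subl (SylP oP).
have nKP := subset_trans sPV nKV.
have sylPK := quotient_pHall nKP sylPV.
by rewrite -quotientSK // (sub_pHall sylPK pVK (quotientS _ sPV) (subxx _)).
Qed.

Lemma core_sub_conj x : x \in G -> block_core \subset H :^ x.
Proof. by move=> Gx; apply: bigcap_inf. Qed.

(** Modulo the core, H is the normaliser of the image of P, so that the Sylow
    2-subgroups of the quotient correspond to the blocks. [small_Syl_cover]
    applies in the quotient, and M is the preimage of the subgroup that it
    provides. *)
Lemma core_normal_cover :
    H \subset 'N(block_core * P) -> #|G : H| \in [:: 3; 5; 7] ->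
  exists2 M : {group gT}, ~~ (P \subset M)
    & forall x, x \in G -> x \notin H -> P :&: H :^ x \subset M.
Proof.
move=> nPK cGH; have nKG := block_core_norm; set K := block_core in nPK nKG *.
have sPG := Syl_sub oP; have nKP := subset_trans sPG nKG.
have nKH := subset_trans sHG nKG.
have ePK : P / K = (K * P) / K by rewrite quotientMidl.
have NPK : 'N_(G / K)(P / K) = H / K.
  apply/eqP; rewrite eqEsubset; apply/andP; split; last first.
    by rewrite subsetI quotientS //= ePK quotient_norms.
  apply/subsetP=> xb /setIP[/morphimP[x nKx Gx ->] /normP nx].
  apply: mem_quotient; apply: (block_conj Gx).
  have : P / K \subset (P :^ x) / K by rewrite quotientJ ?nx.
  rewrite quotientSK // => /subset_trans; apply.
  by rewrite mulG_subG core_sub_conj // conjSg.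
have oPK : (P / K)%G \in 'Syl_2(G / K).
  by apply/SylP; apply: quotient_pHall (SylP oP).
have cSyl : #|'Syl_2(G / K)| = #|G : H|.
  by rewrite (card_Syl (SylP oPK)) /= NPK index_quotient_eq ?subIset ?block_core_sub ?orbT.
have [|Mb [nM iM sM]] := small_Syl_cover oPK; first by rewrite cSyl.
exists (coset K @*^-1 Mb)%G.
  apply/negP=> sPM; have : P / K \subset Mb.
    by rewrite -(cosetpreK Mb) morphimS.
  by rewrite -indexg_eq1 iM.
move=> x Gx nHx; apply/subsetP=> y /setIP[Py Hxy].
have nKy := subsetP nKP y Py; rewrite mem_morphpre //.
have oPx : ((P / K) :^ coset K x)%G \in 'Syl_2(G / K) by rewrite SylJ ?mem_quotient.
have nePx : ((P / K) :^ coset K x)%G != (P / K)%G.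
  apply: contra nHx => /eqP /(congr_group) /= e; apply: (block_conj Gx).
  have : P / K \subset (P :^ x) / K by rewrite quotientJ ?e ?(subsetP nKG).
  rewrite quotientSK // => /subset_trans; apply.
  by rewrite mulG_subG core_sub_conj // conjSg.
apply: (subsetP (sM _ oPx nePx)); rewrite inE mem_quotient //=.
have Hy : y ^ x^-1 \in H by rewrite -mem_conjg.
have sylH : 2.-Sylow(H / K) (P / K).
  by apply: quotient_pHall; rewrite //; apply/SylP/block_Syl.
have nsPH : P / K <| H / K by rewrite /normal quotientS //= ePK quotient_norms.
have : coset K (y ^ x^-1) \in P / K.
  rewrite (mem_normal_Hall sylH nsPH) ?mem_quotient //.
  rewrite morph_p_elt ?(subsetP nKH) // /p_elt orderJ.
  exact: mem_p_elt (Syl_pgroup oP) Py.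
have nKx := subsetP nKG x Gx.
by rewrite morphJ ?groupV // (morphV (coset K)) // -mem_conjg.
Qed.

Lemma odd_core_normal :
    (forall u, u \in H -> odd #[u] -> u \in block_core) ->
  H \subset 'N(block_core * P).
Proof.
move=> oddH; have sHKP := odd_core_Sylow sPH (subxx H) block_core_sub oddH.
suff -> : block_core * P = H by apply: normG.
by apply/eqP; rewrite eqEsubset sHKP mulG_subG block_core_sub sPH.
Qed.

Lemma block_index_gt1 K : K \in blocks -> K != H -> 1 < #|P : K|.
Proof.
move=> BK neK; rewrite ltn_neqAle indexg_gt0 eq_sym andbT indexg_eq1.
by apply: contra neK => /(block_self BK)->.
Qed.

Lemma block_H : H \in blocks.
Proof. exact: orbit_refl. Qed.

(** A P-orbit on the blocks other than H has at most six elements. *)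
Lemma blocks_at_index K : K \in blocks -> K != H -> #|G : H| <= 7 ->
  K \in blocks_at 2 \/ K \in blocks_at 4.
Proof.
move=> BK neK le7; have gt1 := block_index_gt1 BK neK.
have [i ei] := index_Syl_pow K oP.
have nbi : #|blocks_at #|P : K| | < 7.
  apply: leq_trans le7; rewrite -card_blocks [#|blocks|](cardsD1 H) block_H ltnS.
  apply/subset_leq_card/subsetP=> L /blocks_atP[BL iL]; rewrite in_setD1 BL andbT.
  by apply: contraTneq gt1 => eL; rewrite -iL eL -leqNgt leq_eqVlt indexg_eq1 sPH.
have KB : K \in blocks_at #|P : K| by apply/blocks_atP.
have le6 : #|P : K| < 7.
  apply: leq_ltn_trans nbi; apply: dvdn_leq (dvdn_blocks_at _).
  by apply/card_gt0P; exists K.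
have : #|P : K| = 2 \/ #|P : K| = 4.
  move: gt1 le6; rewrite ei; case: i {ei} => [|[|[|i]]] //; [by left|by right|].
  have : 2 ^ 3 <= 2 ^ i.+3 by rewrite leq_exp2l.
  by move=> le8 _ lt7; have := leq_trans le8 (ltnW lt7).
by case=> e; [left | right]; apply/blocks_atP.
Qed.

Lemma blocks_split : #|G : H| \in [:: 3; 5; 7] ->
  #|G : H| = (1 + #|blocks_at 2| + #|blocks_at 4|)%N.
Proof.
move=> c7; have le7 : #|G : H| <= 7 by move: c7; rewrite !inE; lia.
have e : blocks :\ H = blocks_at 2 :|: blocks_at 4.
  apply/setP=> K; rewrite in_setD1 in_setU; apply/andP/orP=> [[neK BK]|].
    exact: blocks_at_index.
  case=> /blocks_atP[BK iK]; split=> //; apply: contra_eqN iK => /eqP->.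
    by rewrite (eqP (_ : #|P : H| == 1%N)) // indexg_eq1.
  by rewrite (eqP (_ : #|P : H| == 1%N)) // indexg_eq1.
rewrite -card_blocks [#|blocks|](cardsD1 H) block_H e cardsU.
have -> : blocks_at 2 :&: blocks_at 4 = set0.
  apply/eqP; rewrite -subset0; apply/subsetP=> K.
  by case/setIP=> /blocks_atP[_ i2] /blocks_atP[_]; rewrite i2.
by rewrite cards0 subn0 addnA.
Qed.

(** P has odd index in H. *)
Lemma block_dvdn4 K : K \in blocks -> 4 %| #|H : K| -> 4 %| #|P : K|.
Proof.
move=> BK; rewrite -(indexgI H) -(indexgI P) => d4.
have sPK : P :&: K \subset H :&: K by rewrite setSI.
have e1 := Lagrange_index sPH (subsetIl P K).
have e2 := Lagrange_index (subsetIl H K) sPK.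
have : 4 %| #|H : P| * #|P : P :&: K| by rewrite e1 -e2 dvdn_mulr.
rewrite Gauss_dvdr // (@coprime_pexpl 2 2) // coprime2n odd_2'nat.
by case/and3P: (SylP oPH).
Qed.

Hypothesis red : redundant G.

Let sPG : P \subset G := Syl_sub oP.
Let pP : 2.-group P := Syl_pgroup oP.

(** A point other than P lies in H or in another block, so M1 and M2 contain
    the intersections of P with all the other points. *)
Lemma blocks_coverF (M1 M2 : {group gT}) :
    ~~ (P \subset M1) -> ~~ (P \subset M2) ->
    (forall Q, Q \in 'Syl_2(H) -> Q != P ->
       (P :&: Q \subset M1) || (P :&: Q \subset M2)) ->
    (forall K, K \in blocks -> K != H ->
       (P :&: K \subset M1) || (P :&: K \subset M2)) ->
  False.
Proof.
move=> n1 n2 sQ sK; have [Q [oQ neQ nQ1 nQ2]] := redundant_index2 red oP n1 n2.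
have [sQH|nQH] := boolP (Q \subset H).
  have := sQ Q; rewrite block_SylE oQ sQH (negPf nQ1) (negPf nQ2).
  by case/(_ isT neQ)/orP.
have [x Gx eQ] := Syl_conj oP oQ.
have sQK : Q \subset H :^ x by rewrite eQ conjSg.
have BK : (H :^ x)%G \in blocks by apply/blocksP; exists x.
have neK : (H :^ x)%G != H by apply: contraNneq nQH => <-.
have sI : P :&: Q \subset P :&: H :^ x by rewrite setIS.
by case/orP: (sK _ BK neK) => /(subset_trans sI); rewrite ?(negPf nQ1) ?(negPf nQ2).
Qed.

Lemma blocks_at_orbit K k : #|blocks_at k| = k -> K \in blocks_at k ->
  blocks_at k = orbit 'JG P K.
Proof.
move=> ck BK; have [bK iK] := blocks_atP _ _ BK; apply/eqP.
rewrite eq_sym eqEcard card_block_orbit // ck iK leqnn andbT.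
by rewrite acts_sub_orbit // acts_blocks_at.
Qed.

Lemma blocks_at_cover k : 1 < k -> #|blocks_at k| = k ->
  exists M : {group gT}, [/\ M <| P, #|P : M| = 2
     & forall K, K \in blocks_at k -> P :&: K \subset M].
Proof.
move=> k1 ck; have /card_gt0P[K BK] : 0 < #|blocks_at k| by rewrite ck; lia.
have [bK iK] := blocks_atP _ _ BK; have nPK : ~~ (P \subset K).
  by apply: contraTN k1; rewrite -indexg_eq1 iK => /eqP->.
have [M [nM iM sM]] := pgroup_orbit_cover pP nPK.
exists M; split=> // T; rewrite (blocks_at_orbit ck BK) => /orbitP[x Px <-].
exact: sM.
Qed.

Lemma index2_not_sub (M : {group gT}) : #|P : M| = 2 -> ~~ (P \subset M).
Proof. by rewrite -indexg_eq1 => ->. Qed.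

(** In H, [small_Syl_cover] provides the second subgroup. *)
Lemma blocks_one_coverF (M : {group gT}) :
    #|'Syl_2(H)| \in [:: 3; 5; 7] -> ~~ (P \subset M) ->
    (forall K, K \in blocks -> K != H -> P :&: K \subset M) -> False.
Proof.
move=> cH nM sK; have [Mh [nMh iMh sMh]] := small_Syl_cover oPH cH.
apply: (blocks_coverF (index2_not_sub iMh) nM) => [Q oQ neQ|K BK neK].
  by rewrite sMh.
by rewrite sK ?orbT.
Qed.

Lemma odd_coreF :
    #|'Syl_2(H)| \in [:: 3; 5; 7] -> #|G : H| \in [:: 3; 5; 7] ->
    H \subset 'N(block_core * P) -> False.
Proof.
move=> cH cG nKP; have [M nM sM] := core_normal_cover nKP cG.
apply: (blocks_one_coverF cH nM) => K /blocksP[x Gx ->] ne.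
apply: sM => //; apply: contra ne => Hx; apply/eqP/group_inj; exact: conjGid.
Qed.

Lemma block_orbit_sub K L : K \in blocks -> K != H -> L \in orbit 'JG H K ->
  L \in blocks /\ L != H.
Proof.
move=> BK neK /orbitP[x Hx <-]; split; first by rewrite (acts_act (acts_blocks sHG)).
apply: contra neK => /eqP/(congr_group) /= e; apply/eqP/group_inj.
by rewrite -(conjGid (groupVr Hx)) -e conjsgK.
Qed.

(** The H-orbit of K is a union of P-orbits, all of size two; and P has odd
    index in H, so that a factor 4 of |H : K| would already divide |P : K|. *)
Lemma even_block_index K : (forall L, L \in blocks -> L != H -> #|P : L| = 2) ->
  K \in blocks -> K != H -> 2 %| #|H : K| /\ ~~ (4 %| #|H : K|).
Proof.
move=> i2 BK neK; split; last first.
  by apply/negP=> /(block_dvdn4 BK); rewrite i2.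
rewrite -card_block_orbit //.
apply: (@dvdn_acts _ _ _ 'JG P).
  by apply: subset_trans sPH (acts_orbit _ _ _); apply: subsetT.
move=> L /(block_orbit_sub BK neK)[BL neL]; rewrite card_block_orbit //.
by rewrite i2.
Qed.

Lemma three_Syl_core : #|'Syl_2(H)| = 3 ->
  exists S : {group gT}, [/\ S <| H, S \subset P, #|P : S| = 2
     & forall Q, Q \in 'Syl_2(H) -> Q != P -> P :&: Q = S].
Proof.
move=> c3; have /card_gt0P[Q /setD1P[neQ oQ]] : 0 < #|'Syl_2(H) :\ P|.
  by move: (c3); rewrite (cardsD1 P) oPH add1n => -[->].
have c2 : #|'Syl_2(H)| = (#|Syl_at H P 2|).+1.
  have e := card_Syl_split oPH; rewrite c3 in e *.
  exact: four_parts_3 (e isT) (dvdn_Syl_at 4 oPH) (dvdn_Syl_at 8 oPH) (dvdn_Syl_at 16 oPH).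
have [nS iS capS] := all_index2_core oPH oQ neQ c2.
by exists (P :&: Q)%G; rewrite subsetIl.
Qed.

Lemma block_index_le K : K \in blocks -> K != H -> #|H : K| < #|G : H|.
Proof.
move=> BK neK; rewrite -card_block_orbit //.
rewrite -card_blocks [#|blocks|](cardsD1 H) block_H ltnS.
apply/subset_leq_card/subsetP=> L /(block_orbit_sub BK neK)[BL neL].
by rewrite in_setD1 neL.
Qed.

Lemma index_normal_conj S K h : S <| H -> h \in H -> #|S : K :^ h| = #|S : K|.
Proof.
move=> /normal_norm/subsetP nS Hh; have := indexJg S K h.
by rewrite (normP (nS h Hh)).
Qed.

(** If all H-orbits on the other blocks have size two, the elements of odd
    order of H fix every block. Otherwise there are seven blocks, H is
    transitive on the six others, and H has three Sylow 2-subgroups, any two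
    of which meet in a normal subgroup S. If S fixes another block L, it fixes
    all, and S = P :&: L for all L. If not, Y L = S * (H :&: L) contains H :&:
    L with index two, and contains P. The intersection V of the subgroups Y L
    is normal in H, and its elements of odd order fix every block; so V is the
    product of the core and P. *)
Lemma all_index2_blocksF :
    #|'Syl_2(H)| \in [:: 3; 5; 7] -> #|G : H| \in [:: 3; 5; 7] ->
    (#|G : H| = 7 -> #|'Syl_2(H)| = 3) ->
    (forall L, L \in blocks -> L != H -> #|P : L| = 2) ->
  False.
Proof.
move=> cH cG b3 i2.
have [all2|] := boolP [forall L in blocks, (L != H) ==> (#|H : L| == 2)].
  apply: odd_coreF => //; apply: odd_core_normal => u Hu odd_u.
  apply: mem_block_core => // L BL neL.
  have /implyP/(_ neL)/eqP iHL := forall_inP all2 L BL.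
  have : u \in H :&: L by apply: odd_index2 Hu odd_u; rewrite ?subsetIl ?indexgI.
  by case/setIP.
rewrite negb_forall_in => /exists_inP[K BK]; rewrite negb_imply => /andP[neK iHK].
have [d2 d4] := even_block_index i2 BK neK.
have [ciHK cG7] : #|H : K| = 6 /\ #|G : H| = 7.
  exact: block_orbit_six d2 d4 iHK (block_index_le BK neK) cG.
have [S [nSH sSP iS capS]] := three_Syl_core (b3 cG7).
have trH L : L \in blocks -> L != H -> exists2 h, h \in H & L = (K :^ h)%G.
  move=> BL neL; have : orbit 'JG H K = blocks :\ H.
    apply/eqP; rewrite eqEcard card_block_orbit // ciHK.
    have := card_blocks; rewrite (cardsD1 H) block_H cG7 add1n => -[->].
    rewrite leqnn andbT; apply/subsetP=> T /(block_orbit_sub BK neK)[BT neT].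
    by rewrite in_setD1 neT.
  move/setP/(_ L); rewrite !inE neL BL => /orbitP[h Hh <-]; by exists h.
have nPS := index2_not_sub iS.
have cSL L : L \in blocks -> L != H -> #|P :&: L| = #|S|.
  move=> BL neL; apply/eqP; rewrite -(eqn_pmul2r (isT : 0 < 2)).
  by rewrite -{1}(i2 L BL neL) -iS -(indexgI P L) !Lagrange ?subsetIl.
have [sSK|nSK] := boolP (S \subset K).
  apply: (blocks_coverF nPS nPS) => [Q oQ neQ|L BL neL]; first by rewrite capS ?subxx.
  suff /eqP -> : S == P :&: L :> {set gT} by rewrite subxx.
  rewrite eqEcard cSL // leqnn andbT subsetI sSP.
  have [h Hh ->] := trH L BL neL.
  by rewrite -(normsP (normal_norm nSH) h Hh) conjSg.
have iSL L : L \in blocks -> L != H -> #|S : L| = 2.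
  move=> BL neL; have [h Hh ->] := trH L BL neL; rewrite index_normal_conj //.
  have : #|S : K| <= #|P : K|.
    rewrite -!card_block_orbit ?(subset_trans sSP) //.
    exact/subset_leq_card/imsetS.
  rewrite i2 // leq_eqVlt => /orP[/eqP //|].
  by rewrite ltnS leqNgt ltn_neqAle indexg_gt0 eq_sym indexg_eq1 (negPf nSK).
pose Y L := (S <*> (H :&: L))%G.
have YE L : Y L = S * (H :&: L) :> {set gT}.
  by rewrite /= norm_joinEr // subIset // (normal_norm nSH).
pose V := (\bigcap_(L in blocks | L != H) Y L)%G.
have sVH : V \subset H.
  apply: (subset_trans (bigcap_inf K _)); first by rewrite BK.
  by rewrite join_subG subsetIl normal_sub.
have sPV : P \subset V.
  apply/bigcapsP=> L /andP[BL neL].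
  have sSY : S \subset P :&: Y L by rewrite subsetI sSP joing_subl.
  case/orP: (index2_between sSY (subsetIl _ _) iS) => [/subsetIP[]// | sYS].
  have sLS : P :&: L \subset S.
    apply: subset_trans sYS; rewrite subsetI subsetIl /=.
    by apply: subset_trans (joing_subr _ _); apply: setSI.
  have eS : P :&: L = S by apply/eqP; rewrite eqEcard sLS cSL /=.
  by have := iSL L BL neL; rewrite -indexgI -eS -setIA setIid indexgg.
have sCV : block_core \subset V.
  apply/bigcapsP=> L /andP[/blocksP[x Gx ->] _].
  apply: subset_trans (joing_subr _ _); rewrite subsetI block_core_sub.
  exact: core_sub_conj.
have oddV u : u \in V -> odd #[u] -> u \in block_core.
  move=> Vu odd_u; apply: mem_block_core; last exact: subsetP sVH u Vu.
  move=> L BL neL; have Yu : u \in Y L by apply: (bigcapP Vu); rewrite BL.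
  have iY : #|Y L : H :&: L| = 2.
    apply/eqP; rewrite -(eqn_pmul2r (cardG_gt0 (H :&: L))) mulnC Lagrange ?joing_subr //.
    rewrite YE -LagrangeMr -(iSL L BL neL); apply/eqP; congr (_ * _)%N.
    by rewrite -indexgI -(indexgI S L) setIA (setIidPl (normal_sub nSH)).
  have : u \in H :&: L by apply: odd_index2 Yu odd_u; rewrite ?joing_subr.
  by case/setIP.
have eV : block_core * P = V.
  apply/eqP; rewrite eqEsubset mulG_subG sCV sPV /=.
  exact: odd_core_Sylow.
apply: odd_coreF => //; rewrite eV; apply/subsetP=> h Hh; rewrite inE.
apply/bigcapsP=> L /andP[BL neL]; rewrite sub_conjg.
have BLh : (L :^ h^-1)%G \in blocks.
  by have := acts_act (acts_blocks sHG) (groupVr Hh) L; rewrite /= BL.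
have neLh : (L :^ h^-1)%G != H.
  apply: contra neL => /eqP/(congr_group) /= e; apply/eqP/group_inj.
  by rewrite -(conjGid Hh) -e conjsgKV.
have s : V \subset Y (L :^ h^-1)%G by apply: bigcap_inf; rewrite BLh.
apply: subset_trans s _.
by rewrite /= conjYg conjIg (normsP (normal_norm nSH)) ?groupV // (conjGid (groupVr Hh)).
Qed.

(** The blocks other than H form two P-orbits, those of H1 of size two and of
    H3 of size four. Let S be the intersection of two Sylow 2-subgroups of H,
    and M a subgroup of index two of P above P :&: H3. If S contains P :&: H1
    or P :&: H3, two of the subgroups S, P :&: H1 and M contain all the
    intersections of P with other points; if M does not contain S :&: H1, the
    three of them do, and still do not cover P by [three_index2]. In the
    remaining case |S : H3| = 4 > |S : H1|, so H preserves both orbits; then E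
    = S :&: H1 is normal in H, and H :&: H3 has index two in E * (H :&: H3),
    itself of index two in H. So the elements of odd order of H fix all the
    blocks. *)
Lemma mixed_blocksF :
    #|'Syl_2(H)| = 3 -> #|G : H| = 7 ->
    #|blocks_at 2| = 2 -> #|blocks_at 4| = 4 -> False.
Proof.
move=> c3 c7 cB2 cB4; have [S [nSH sSP iS capS]] := three_Syl_core c3.
have /card_gt0P[H1 B1] : 0 < #|blocks_at 2| by rewrite cB2.
have /card_gt0P[H3 B3] : 0 < #|blocks_at 4| by rewrite cB4.
have o1 := blocks_at_orbit cB2 B1; have o3 := blocks_at_orbit cB4 B3.
have [b1 i1] := blocks_atP _ _ B1; have [b3 i3] := blocks_atP _ _ B3.
have nPS := index2_not_sub iS; have nSP : S <| P by apply: normalS nSH.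
have i1' : #|P : P :&: H1| = 2 by rewrite indexgI.
have nP1 : ~~ (P \subset P :&: H1) by apply: (index2_not_sub (M := (P :&: H1)%G)).
have sub1 K : K \in blocks_at 2 -> P :&: K \subset P :&: H1.
  rewrite o1 => /orbitP[x Px <-] /=; rewrite cap_conj //.
  by rewrite (normsP _ x Px) // norm_cap_index2.
have splitB K : K \in blocks -> K != H -> K \in blocks_at 2 \/ K \in blocks_at 4.
  by move=> BK neK; apply: blocks_at_index => //; rewrite c7.
have sub3 M : P \subset 'N(M) -> P :&: H3 \subset M ->
    forall K, K \in blocks_at 4 -> P :&: K \subset M.
  move=> nM s3 K; rewrite o3 => /orbitP[x Px <-] /=; rewrite cap_conj //.
  by rewrite -(normsP nM x Px) conjSg.
have capSS Q : Q \in 'Syl_2(H) -> Q != P -> P :&: Q \subset S.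
  by move=> oQ neQ; rewrite capS.
have [s3S|ns3S] := boolP (P :&: H3 \subset S).
  apply: (blocks_coverF nPS nP1) => [Q oQ neQ|K BK neK]; first by rewrite capSS.
  have [/sub1->|B4] := splitB K BK neK; first by rewrite orbT.
  by rewrite (sub3 S (normal_norm nSP)).
have nP3 : ~~ (P \subset H3) by rewrite -indexg_eq1 i3.
have [M [sM nM iM]] := pgroup_maximal_above pP nP3.
have subM := sub3 M (normal_norm nM) sM.
have nPM := index2_not_sub iM.
have [s1S|ns1S] := boolP (P :&: H1 \subset S).
  apply: (blocks_coverF nPS nPM) => [Q oQ neQ|K BK neK]; first by rewrite capSS.
  have [/sub1 s|/subM->] := splitB K BK neK; last by rewrite orbT.
  by rewrite (subset_trans s s1S).
have [sEM|nEM] := boolP (P :&: (S :&: (P :&: H1)) \subset M); last first.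
  have [x Px [nSx n1x nMx]] := three_index2 nPS nP1 (normal_sub nM) iM nEM.
  have [Q [oQ neQ Qx]] := red oP Px.
  have [sQH|nQH] := boolP (Q \subset H).
    case/negP: nSx; apply: (subsetP (capSS Q _ neQ)); last by rewrite inE Px.
    by rewrite block_SylE oQ.
  have [y Gy eQ] := Syl_conj oP oQ.
  have sQK : Q \subset H :^ y by rewrite eQ conjSg.
  have BK : (H :^ y)%G \in blocks by apply/blocksP; exists y.
  have neK : (H :^ y)%G != H by apply: contraNneq nQH => <-.
  have PKx : x \in P :&: H :^ y by rewrite inE Px (subsetP sQK).
  have [/sub1 s|/subM s] := splitB _ BK neK.
    by case/negP: n1x; apply: (subsetP s).
  by case/negP: nMx; apply: (subsetP s).
have neH K k : K \in blocks_at k -> 1 < k -> K != H.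
  move=> /blocks_atP[_ iK] k1; apply: contraTneq k1 => eK.
  by rewrite -iK eK -leqNgt leq_eqVlt indexg_eq1 sPH.
have iSH K : K \in orbit 'JG H H1 -> #|S : K| = #|S : H1|.
  by case/orbitP=> h Hh <-; rewrite index_normal_conj.
have iSH3 K : K \in orbit 'JG H H3 -> #|S : K| = #|S : H3|.
  by case/orbitP=> h Hh <-; rewrite index_normal_conj.
have leq_index (K L L' : {group gT}) : K \in blocks -> L \subset L' -> L' \subset G ->
    #|L : K| <= #|L' : K|.
  move=> BK sLL' sL'G; rewrite -!card_block_orbit ?(subset_trans sLL') //.
  exact/subset_leq_card/imsetS.
have iS3 : #|S : H3| = 4.
  have e1 := Lagrange_index sSP (subsetIl S H3).
  have e2 := Lagrange_index (subsetIl P H3) (setSI H3 sSP).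
  have := index2_meet nSP iS (subsetIl P H3) ns3S; rewrite -indexgI setIAC (setIidPr sSP) => i2.
  move: e1; rewrite -e2 iS indexgI indexgI i3 i2 => e1.
  by apply/eqP; rewrite -(eqn_pmul2l (isT : 0 < 2)) e1.
have iS1 : #|S : H1| < 4 by rewrite (leq_ltn_trans (leq_index _ _ _ b1 sSP sPG)) ?i1.
have iSP h K : h \in P -> #|S : K :^ h| = #|S : K|.
  by move=> Ph; apply: index_normal_conj => //; apply: subsetP Ph.
have orb1 K : K \in orbit 'JG H H1 -> K \in blocks_at 2.
  move=> oK; have [BK neK] := block_orbit_sub b1 (neH _ _ B1 isT) oK.
  have [//|] := splitB K BK neK; rewrite o3 => /orbitP[x Px eK].
  by move: iS1; rewrite -(iSH K oK) -eK /= iSP // iS3.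
have orb3 K : K \in orbit 'JG H H3 -> K \in blocks_at 4.
  move=> oK; have [BK neK] := block_orbit_sub b3 (neH _ _ B3 isT) oK.
  have [|//] := splitB K BK neK; rewrite o1 => /orbitP[x Px eK].
  by have := iSH3 K oK; rewrite -eK /= iSP // iS3 => e; rewrite e in iS1.
have iH1 : #|H : H1| = 2.
  apply/eqP; rewrite eqn_leq -{2}i1 leq_index // andbT -cB2.
  by rewrite -card_block_orbit //; apply/subset_leq_card/subsetP.
have iH3 : #|H : H3| = 4.
  apply/eqP; rewrite eqn_leq -{2}i3 leq_index // andbT -cB4.
  by rewrite -card_block_orbit //; apply/subset_leq_card/subsetP.
pose E := (S :&: H1)%G.
have nEH : E <| H.
  have -> : E = (S :&: (H :&: H1))%G.
    by apply: group_inj; rewrite /= setIA (setIidPl (normal_sub nSH)).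
  by apply: normalI => //; apply: index2_normal; rewrite ?subsetIl // indexgI.
have sEP : E \subset M.
  by apply: subset_trans sEM; rewrite !subsetI subsetIl subsetIr !subIset ?sSP.
have iE3 : #|E : H3| = 2.
  have sMP := normal_sub nM; have sMG := subset_trans sMP sPG.
  have iM3 : #|M : H3| = 2.
    have eI : M :&: H3 = P :&: H3.
      by apply/eqP; rewrite eqEsubset setSI //= subsetI sM subsetIr.
    have := Lagrange_index sMP (subsetIl M H3).
    rewrite /= iM indexgI eI indexgI i3 => e.
    by apply/eqP; rewrite -(eqn_pmul2l (isT : 0 < 2)) e.
  apply/eqP; rewrite eqn_leq -{1}iM3 leq_index //= ltn_neqAle indexg_gt0 andbT.
  rewrite eq_sym indexg_eq1; apply: contraTN iS1 => sE3; rewrite -leqNgt -iS3.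
  rewrite -[#|S : H1|]indexgI -[#|S : H3|]indexgI; apply: dvdn_leq => //.
  by apply: indexgS; rewrite subsetI subsetIl.
pose Y := (E <*> (H :&: H3))%G.
have sY : H :&: H3 \subset Y by apply: joing_subr.
have sYH : Y \subset H by rewrite join_subG normal_sub // subsetIl.
have iY : #|Y : H :&: H3| = 2.
  have YE : Y = E * (H :&: H3) :> {set gT}.
    by rewrite /= norm_joinEr // subIset // (normal_norm nEH).
  apply/eqP; rewrite -(eqn_pmul2r (cardG_gt0 (H :&: H3))) mulnC Lagrange //.
  rewrite YE -LagrangeMr -iE3; apply/eqP; congr (_ * _)%N.
  by rewrite -indexgI -(indexgI E H3) setIA (setIidPl (normal_sub nEH)).
have iHY : #|H : Y| = 2.
  have := Lagrange_index sYH sY; rewrite iY indexgI iH3 => e.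
  by apply/eqP; rewrite -(eqn_pmul2r (isT : 0 < 2)) e.
have odd3 u : u \in H -> odd #[u] -> u \in H3.
  move=> Hu odd_u; have Yu := odd_index2 sYH iHY Hu odd_u.
  by have /setIP[_ ->] := odd_index2 sY iY Yu odd_u.
apply: odd_coreF; rewrite ?c3 ?c7 //.
apply: odd_core_normal => u Hu odd_u.
apply: mem_block_core => // K BK neK; have Hc x : x \in P -> u ^ x^-1 \in H.
  by move=> Px; rewrite groupJ // groupV (subsetP sPH).
have [|] := splitB K BK neK; rewrite ?o1 ?o3 => /orbitP[x Px <-] /=; rewrite mem_conjg.
  have /setIP[//] : u ^ x^-1 \in H :&: H1.
  by apply: odd_index2 (Hc x Px) _; rewrite ?subsetIl ?indexgI // orderJ.
by apply: odd3; rewrite ?Hc // orderJ.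
Qed.

Lemma no_intermediate : #|Om| <= 25 -> H != G :> {set gT} ->
  H != 'N_G(P) :> {set gT} -> False.
Proof.
move=> le25 neHG neHN.
have cO := card_block.
have oddO : #|Om| %% 2 = 1%N by apply: card_Syl_mod.
have gta : 1 < #|G : H|.
  rewrite ltn_neqAle indexg_gt0 eq_sym indexg_eq1 andbT.
  by apply: contra neHG => sGH; rewrite eqEsubset sHG.
have gtb : 1 < #|'Syl_2(H)|.
  rewrite (card_Syl (SylP oPH)) ltn_neqAle indexg_gt0 eq_sym indexg_eq1 andbT.
  apply: contra neHN => sHN; rewrite eqEsubset sNH subsetI sHG andbT.
  by apply: subset_trans sHN (subsetIr _ _).
have [a7 b7 ab] : [/\ #|G : H| \in [:: 3; 5; 7], #|'Syl_2(H)| \in [:: 3; 5; 7]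
    & #|G : H| = 7 -> #|'Syl_2(H)| = 3].
  apply: odd_factors_357; rewrite -?cO //.
  by rewrite -[odd _]eqb1 -modn2 oddO.
have sB := blocks_split a7.
have d2 := dvdn_blocks_at 2; have d4 := dvdn_blocks_at 4.
have le7 := mem357_le7 a7.
case: (block_counts a7 sB d2 d4) => [c4|[c2 c4]|[c7 c2 c4]].
- apply: (all_index2_blocksF b7 a7 ab) => L BL neL.
  have [|] := blocks_at_index BL neL le7; first by case/blocks_atP.
  by rewrite (cards0_eq c4) inE.
- have [M [nM iM sM]] := blocks_at_cover (isT : 1 < 4) c4.
  apply: (blocks_one_coverF b7 (index2_not_sub iM)) => K BK neK.
  have [|] := blocks_at_index BK neK le7; last exact: sM.
  by rewrite (cards0_eq c2) inE.
exact: mixed_blocksF (ab c7) c7 c2 c4.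
Qed.

End Blocks.

(** * The geometry of the shortest lines *)

Definition Syl_primitive (gT : finGroupType) (G : {group gT}) :=
  forall P H : {group gT}, P \in 'Syl_2(G) -> 'N_G(P) \subset H -> H \subset G ->
  H = G :> {set gT} \/ H = 'N_G(P) :> {set gT}.

Section LineGeometry.

Variables (gT : finGroupType) (G : {group gT}) (k : nat).
Implicit Types (A B C H K L M P Q S T U W : {group gT}) (x y z : gT).

Local Notation Om := 'Syl_2(G).
Local Notation F := (Syl_above G).
Local Notation isline := (isline G k).

Hypotheses (red : redundant G) (prim : Syl_primitive G) (k_gt1 : 1 < k).
Hypothesis minK : forall T U, T \in Om -> U \in Om -> T != U -> k <= #|T : U|.

Lemma line_Syl A P : P \in F A -> P \in Om.
Proof. by case/Syl_aboveP. Qed.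

Lemma line_sub A P : P \in F A -> A \subset P.
Proof. by case/Syl_aboveP. Qed.

Lemma line_nsub A P : isline A -> P \in F A -> ~~ (P \subset A).
Proof. by case=> _ iA PA; rewrite -indexg_eq1 iA // neq_ltn k_gt1 orbT. Qed.

Lemma isline_conj A x : x \in G -> isline A -> isline (A :^ x)%G.
Proof.
move=> Gx [gt1 iA].
have FJ T : ((T :^ x)%G \in F (A :^ x)) = (T \in F A).
  by apply/Syl_aboveP/Syl_aboveP; rewrite SylJ //= conjSg.
have eF : F (A :^ x) = (fun T : {group gT} => (T :^ x)%G) @: F A.
  apply/setP=> T; apply/idP/imsetP=> [TA|[U UA ->]]; last by rewrite FJ.
  have eT : T = ((T :^ x^-1) :^ x)%G by apply: group_inj; rewrite /= conjsgKV.
  by exists (T :^ x^-1)%G; rewrite // -FJ -eT.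
split=> [|T]; first by rewrite /= eF (card_imset _ (act_inj 'JG x)).
by rewrite /= eF => /imsetP[U UA ->]; rewrite /= indexJg iA.
Qed.

Lemma card_line_conj A x : x \in G -> #|F (A :^ x)| = #|F A|.
Proof.
move=> Gx; rewrite -(card_imset (mem (F A)) (act_inj 'JG x)); apply: eq_card => T.
apply/idP/imsetP=> [/Syl_aboveP[oT sAT]|[U /Syl_aboveP[oU sAU] ->]]; last first.
  by apply/Syl_aboveP; rewrite SylJ //= conjSg.
exists (T :^ x^-1)%G; last by apply: group_inj; rewrite /= conjsgKV.
by apply/Syl_aboveP; rewrite SylJ ?groupV //= -sub_conjg.
Qed.

(** Otherwise primitivity makes 'N_G(A) equal to 'N_G(P), which fixes P and so
    is not transitive on the line, or to G; and then all points are on the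
    line, so that P meets them all in A, contrary to redundancy. *)
Lemma line_not_fixed A P : isline A -> P \in F A -> ~~ ('N_G(P) \subset 'N(A)).
Proof.
move=> lA PA; apply/negP=> sNA; have oP := line_Syl PA.
have sNN : 'N_G(P) \subset 'N_G(A) by rewrite subsetI subsetIl.
case: (prim oP sNN (subsetIl _ _)) => /= eN; last first.
  have /card_gt0P[T /setD1P[neT TA]] : 0 < #|F A :\ P|.
    by case: lA => gt1 _; move: gt1; rewrite (cardsD1 P) PA.
  have [x nx eT] := line_trans minK lA PA TA.
  case/eqP: neT; rewrite eT; apply: group_inj => /=.
  by move: nx; rewrite eN => /setIP[_ /normP].
have allA T : T \in Om -> T \in F A.
  move=> oT; have [x Gx ->] := Syl_conj oP oT.
  by rewrite Syl_aboveJ // eN.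
have nPA := line_nsub lA PA.
have [Q [oQ neQ nQA _]] := redundant_index2 red oP nPA nPA.
by rewrite (line_cap minK lA PA (allA Q oQ)) ?subxx // eq_sym in nQA.
Qed.

Lemma line_norm_gt1 A P : isline A -> P \in F A -> 1 < #|'N_P(A) : A|.
Proof.
move=> lA PA; rewrite ltn_neqAle indexg_gt0 eq_sym indexg_eq1 andbT.
have prA : A \proper P by rewrite properE line_sub // line_nsub.
have := nilpotent_proper_norm (pgroup_nil (Syl_pgroup (line_Syl PA))) prA.
by case/andP.
Qed.

Lemma line_norm_index A P : isline A -> P \in F A ->
  (#|P : 'N_P(A)| * #|'N_P(A) : A|)%N = k.
Proof.
move=> lA PA; rewrite Lagrange_index ?subsetIl //; last first.
  by rewrite subsetI normG line_sub.
by case: lA => _ ->.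
Qed.

(** An element of 'N_P(A) that fixes another point of the line lies in this
    point and in P, hence in A. *)
Lemma line_semiregular A P : isline A -> P \in F A -> #|'N_P(A) : A| %| #|F A|.-1.
Proof.
move=> lA PA; have oP := line_Syl PA.
have -> : #|F A|.-1 = #|F A :\ P| by rewrite (cardsD1 P) PA.
apply: (@dvdn_acts _ _ _ 'JG ('N_P(A))).
  apply/actsP=> x /setIP[Px nAx] T; rewrite !in_setD1 /=.
  rewrite Syl_aboveJ ?in_setI ?nAx ?(subsetP (Syl_sub oP)) //.
  have eP : (P :^ x)%G = P by apply: group_inj; apply: conjGid.
  by rewrite -{1}eP (inj_eq (act_inj 'JG x)).
move=> T /setD1P[neT TA]; rewrite card_orbit astab1JG.
suff -> : 'N_('N_P(A))(T) = A by [].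
apply/eqP; rewrite eqEsubset; apply/andP; split; last first.
  by rewrite !subsetI line_sub // normG (subset_trans (line_sub TA) (normG T)).
suff : 'N_('N_P(A))(T) \subset T :&: P by rewrite (line_cap minK lA TA PA neT).
apply/subsetP=> x /setIP[/setIP[Px _] nTx]; rewrite inE Px andbT.
exact: (norm_Syl oP (line_Syl TA) Px nTx).
Qed.

(* the number of conjugates of A under 'N_G(P), by line_count_orbit *)
Local Notation w A P := #|'N_G(P) : 'N(gval A)|.

Lemma line_count_orbit A P : w A P = #|orbit 'JG 'N_G(P) A|.
Proof. by rewrite card_orbit astab1JG indexgI. Qed.

Lemma line_count A P : isline A -> P \in F A ->
  (#|Om| * w A P = #|G : 'N_G(A)| * #|F A|)%N.
Proof.
by move=> lA PA; apply: card_line_orbit => // T; apply: (line_trans minK lA PA).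
Qed.

Lemma line_count_gt1 A P : isline A -> P \in F A -> 1 < w A P.
Proof.
move=> lA PA; rewrite ltn_neqAle indexg_gt0 eq_sym indexg_eq1 andbT.
exact: line_not_fixed lA PA.
Qed.

Lemma odd_norm_index A P : isline A -> P \in F A -> P \subset 'N(A) -> odd (w A P).
Proof.
move=> lA PA nPA; have oP := line_Syl PA.
have sPN : P \subset 'N_G(P) by rewrite subsetI normG (Syl_sub oP).
have sylP : 2.-Sylow('N_G(P)) P by apply: pHall_subl (SylP oP); rewrite ?subsetIl.
rewrite -indexgI; apply: dvdn_odd (indexgS _ _) _; last first.
  by rewrite odd_2'nat; case/and3P: sylP => _ _; apply.
by rewrite subsetI sPN.
Qed.

(** P is normal in 'N_G(P), so its orbits on the conjugates of A under 'N_G(P)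
    all have the same length. *)
Lemma dvdn_norm_index A P : isline A -> P \in F A -> #|P : 'N_P(A)| %| w A P.
Proof.
move=> lA PA; have oP := line_Syl PA.
have sPN : P \subset 'N_G(P) by rewrite subsetI normG (Syl_sub oP).
rewrite line_count_orbit.
apply: (@dvdn_acts _ _ _ 'JG P).
  by apply: subset_trans sPN (acts_orbit _ _ _); apply: subsetT.
move=> _ /orbitP[x /setIP[Gx nPx] <-]; rewrite card_orbit astab1JG /=.
have := indexJg P 'N_P(A) x; rewrite /= conjIg -normJ (normP nPx) => ->.
exact: dvdnn.
Qed.

(** These classes partition the points at distance k from P, according to the
    'N_G(P)-class of the line that joins them to P. *)
Definition line_class P A :=
  [set Q in Syl_at G P k | (P :&: Q)%G \in orbit 'JG 'N_G(P) A].

Lemma line_Syl_at A P Q : isline A -> P \in F A -> Q \in F A -> Q != P ->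
  Q \in Syl_at G P k.
Proof.
move=> lA PA QA ne; apply/Syl_atP; split; first exact: line_Syl QA.
by rewrite -indexgI (line_cap minK lA PA QA) 1?eq_sym //; case: lA => _ ->.
Qed.

Lemma line_classP A P Q : isline A -> P \in F A ->
  reflect (exists B, [/\ B \in orbit 'JG 'N_G(P) A, Q \in F B & Q != P])
          (Q \in line_class P A).
Proof.
move=> lA PA; rewrite [X in reflect _ X]in_set; apply: (iffP andP) => [[]|].
  move=> /Syl_atP[oQ iQ] oI; exists (P :&: Q)%G; split=> //.
    by apply/Syl_aboveP; rewrite subsetIr.
  by apply: contraTneq k_gt1 => e; rewrite -iQ e indexgg.
case=> B [oB QB neQ]; have lB : isline B.
  by case/orbitP: oB => x /setIP[Gx _] <-; apply: isline_conj.
have PB : P \in F B.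
  case/orbitP: oB => x /setIP[Gx nPx] <-; apply/Syl_aboveP.
  by rewrite (line_Syl PA) /= -(normP nPx) conjSg line_sub.
split; first exact: line_Syl_at lB PB QB neQ.
by rewrite (group_inj (line_cap minK lB PB QB _)) // eq_sym.
Qed.

Arguments line_classP {A P Q}.

Lemma card_line_class A P : isline A -> P \in F A ->
  #|line_class P A| = (#|F A|.-1 * w A P)%N.
Proof.
move=> lA PA; have oP := line_Syl PA.
rewrite -sum1_card (partition_big (fun Q => (P :&: Q)%G) (mem (orbit 'JG 'N_G(P) A))) /=; last first.
  by move=> Q; rewrite inE => /andP[].
rewrite line_count_orbit mulnC -sum_nat_const.
apply: eq_bigr => B oB; have lB : isline B.
  by case/orbitP: oB => x /setIP[Gx _] <-; apply: isline_conj.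
have PB : P \in F B.
  case/orbitP: oB => x /setIP[Gx nPx] <-; apply/Syl_aboveP.
  by rewrite oP /= -(normP nPx) conjSg line_sub.
have -> : #|F A| = #|F B|.
  by case/orbitP: oB => x /setIP[Gx _] <-; rewrite card_line_conj.
rewrite [#|F B|](cardsD1 P) PB -sum1_card; apply: eq_bigl => Q.
apply/andP/setD1P=> [[/(line_classP lA PA)[C [oC QC neQ]] /eqP eB]|[neQ QB]].
  by split=> //; apply/Syl_aboveP; rewrite -eB subsetIr (line_Syl QC).
split; first by apply/(line_classP lA PA); exists B.
by apply/eqP/group_inj; rewrite /= (line_cap minK lB PB QB) // eq_sym.
Qed.

Lemma line_join P Q : P \in Om -> Q \in Syl_at G P k ->
  [/\ isline (P :&: Q)%G, P \in F (P :&: Q)%G, Q \in F (P :&: Q)%G & Q != P].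
Proof.
move=> oP /Syl_atP[oQ iPQ]; split; first exact: line_of.
- by apply/Syl_aboveP; rewrite subsetIl.
- by apply/Syl_aboveP; rewrite subsetIr.
by apply: contraTneq k_gt1 => e; rewrite -iPQ e indexgg.
Qed.

Definition lines_through P := [set (P :&: gval Q)%G | Q in Syl_at G P k].

Lemma lines_throughP P B :
  P \in Om -> reflect (isline B /\ P \in F B) (B \in lines_through P).
Proof.
move=> oP; apply: (iffP imsetP) => [[Q /Syl_atP[oQ iQ] ->]|[lB PB]].
  by split; [apply: line_of|apply/Syl_aboveP; rewrite subsetIl].
have /card_gt0P[Q /setD1P[neQ QB]] : 0 < #|F B :\ P|.
  by case: lB => gt1 _; move: gt1; rewrite (cardsD1 P) PB.
exists Q; first exact: line_Syl_at lB PB QB neQ.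
by apply: group_inj; rewrite /= (line_cap minK lB PB QB) // eq_sym.
Qed.

Lemma lines_throughJ P B x : P \in Om -> x \in 'N_G(P) ->
  B \in lines_through P -> (B :^ x)%G \in lines_through P.
Proof.
move=> oP /setIP[Gx nPx] /(lines_throughP B oP)[lB PB].
apply/lines_throughP => //; split; first exact: isline_conj.
by apply/Syl_aboveP; rewrite oP /= -(normP nPx) conjSg (line_sub PB).
Qed.

Lemma card_lines_through P l : P \in Om ->
    (forall B, isline B -> P \in F B -> #|F B| = l.+1) ->
  #|Syl_at G P k| = (#|lines_through P| * l)%N.
Proof.
move=> oP cF; rewrite -sum_nat_const -[LHS]sum1_card.
rewrite (partition_big (fun Q => (P :&: gval Q)%G) (mem (lines_through P))) /=; last first.
  by move=> Q PQ; apply: imset_f.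
apply: eq_bigr => B /(lines_throughP B oP)[lB PB].
have -> : l = #|F B :\ P| by have := cF B lB PB; rewrite (cardsD1 P) PB add1n => -[].
rewrite -sum1_card; apply: eq_bigl => Q.
apply/andP/setD1P=> [[PQ /eqP <-]|[neQ QB]].
  have [oQ iQ] := Syl_atP PQ; split; last by apply/Syl_aboveP; rewrite subsetIr.
  by apply: contraTneq k_gt1 => e; rewrite -iQ e indexgg.
split; first exact: line_Syl_at lB PB QB neQ.
by apply/eqP/group_inj; rewrite /= (line_cap minK lB PB QB) // eq_sym.
Qed.

Definition nbrs P := [set Q in Syl_at G P k | P \subset 'N(P :&: Q)].

Lemma nbrsP P Q :
  reflect [/\ Q \in Om, #|P : Q| = k & P \subset 'N(P :&: Q)] (Q \in nbrs P).
Proof.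
rewrite [X in reflect _ X]in_set; apply: (iffP andP) => [[/Syl_atP[]]|[oQ iQ nQ]] //.
by split=> //; apply/Syl_atP.
Qed.

Lemma card_nbrs P T : P \in Om -> T \in Om -> #|nbrs P| = #|nbrs T|.
Proof.
move=> oP oT; have [x Gx ->] := Syl_conj oP oT.
rewrite -(card_imset (mem (nbrs P)) (act_inj 'JG x)); apply: eq_card => Q.
have nJ U V y : (V :^ y \subset 'N(V :^ y :&: U :^ y)) = (V \subset 'N(V :&: U)).
  by rewrite -conjIg normJ conjSg.
apply/imsetP/idP=> [[U /nbrsP[oU iU nU] ->]|/nbrsP[oQ iQ nQ]].
  by apply/nbrsP; rewrite SylJ //= indexJg nJ.
have eQ : Q = ((Q :^ x^-1) :^ x)%G by apply: group_inj; rewrite /= conjsgKV.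
exists (Q :^ x^-1)%G => //; rewrite eQ /= in iQ nQ.
by apply/nbrsP; rewrite SylJ ?groupV // -(indexJg _ _ x) -(nJ _ _ x) /=.
Qed.

(** An element of A outside W moves W to a second common point of the lines B
    and C, and two points determine a line. *)
Lemma line_norm_fix A B C W : isline B -> isline C ->
    A \subset G -> 2.-group A -> A \subset 'N(B) -> A \subset 'N(C) ->
    W \in F B -> W \in F C -> (A \subset W) || (B == C).
Proof.
move=> lB lC sAG pA nAB nAC WB WC; have oW := line_Syl WB.
have [//|nAW] := boolP (A \subset W).
have : ~~ (A \subset 'N(W)) by apply: contra nAW => nAW; apply: Syl_norm oW _ _ _.
case/subsetPn=> a Aa nWa; have Ga := subsetP sAG a Aa.
have WaB : (W :^ a)%G \in F B by rewrite Syl_aboveJ // inE Ga (subsetP nAB).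
have WaC : (W :^ a)%G \in F C by rewrite Syl_aboveJ // inE Ga (subsetP nAC).
have neW : W != (W :^ a)%G.
  by apply: contra nWa => /eqP/(congr_group) /= e; apply/normP.
apply/orP; right; apply/eqP/group_inj.
by rewrite -(line_cap minK lB WB WaB neW) -(line_cap minK lC WC WaC neW).
Qed.

(** Let W be a common neighbour of two points T and U of the line. A lies in T
    and U, so it normalises T :&: W and U :&: W; then A is contained in W by
    [line_norm_fix], unless T, U and W are on one line; in both cases W is on
    F A. Hence distinct points of F A have disjoint sets of neighbours outside
    F A. *)
Lemma normal_line_bound A P : isline A -> P \in F A -> P \subset 'N(A) ->
  #|F A| + #|F A| * (#|nbrs P| - #|F A|.-1) <= #|Om|.
Proof.
move=> lA PA nPA; have oP := line_Syl PA.
have pA : 2.-group A := pgroupS (line_sub PA) (Syl_pgroup oP).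
have sAG : A \subset G := subset_trans (line_sub PA) (Syl_sub oP).
have nTA T : T \in F A -> T \subset 'N(A).
  move=> TA; have [x /setIP[Gx nAx] ->] := line_trans minK lA PA TA.
  by rewrite /= -(normP nAx) normJ conjSg.
have sFO : F A \subset Om by apply/subsetP=> T /line_Syl.
rewrite -(cardsID (F A) Om) (setIidPr sFO) leq_add2l.
have cB T : T \in F A -> (#|nbrs P| - #|F A|.-1 <= #|nbrs T :\: F A|)%N.
  move=> TA; rewrite (card_nbrs oP (line_Syl TA)) leq_subLR -(cardsID (F A) (nbrs T)).
  rewrite leq_add2r [#|F A|](cardsD1 T) TA /=; apply: subset_leq_card.
  apply/subsetP=> U /setIP[/nbrsP[oU iU _] UA]; rewrite in_setD1 UA andbT.
  by apply: contraTneq k_gt1 => e; rewrite -iU e indexgg.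
rewrite -sum_nat_const; apply: leq_trans (leq_sum _ cB) _ => //.
apply: sum_disjoint_le => [T TA|T U W TA UA].
  by apply: setSD; apply/subsetP=> U /nbrsP[].
case/setDP=> /nbrsP[oW iTW nTW] nWA /setDP[/nbrsP[_ iUW nUW] _].
apply/eqP; apply: contraT => neTU; case/negP: nWA; apply/Syl_aboveP; split=> //.
have lT := line_of (line_Syl TA) oW k_gt1 iTW.
have lU := line_of (line_Syl UA) oW k_gt1 iUW.
have WT : W \in F (T :&: W)%G by apply/Syl_aboveP; rewrite subsetIr.
have WU : W \in F (U :&: W)%G by apply/Syl_aboveP; rewrite subsetIr.
have nT := subset_trans (line_sub TA) nTW; have nU := subset_trans (line_sub UA) nUW.
case/orP: (line_norm_fix lT lU sAG pA nT nU WT WU) => // /eqP/(congr_group) /= eI.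
have TT : T \in F (T :&: W)%G by apply/Syl_aboveP; rewrite subsetIl (line_Syl TA).
have UT : U \in F (T :&: W)%G by apply/Syl_aboveP; rewrite /= eI subsetIl (line_Syl UA).
have := line_cap minK lT TT UT neTU; rewrite (line_cap minK lA TA UA neTU) => ->.
exact: subsetIr.
Qed.

(** A has an odd number of conjugates under 'N_G(P), and more than one; three
    lines give enough neighbours of P for [normal_line_bound]. *)
Lemma normal_line_small A P : isline A -> P \in F A -> P \subset 'N(A) ->
  #|F A| + #|F A| * (2 * #|F A|.-1) <= #|Om|.
Proof.
move=> lA PA nPA; apply: leq_trans (normal_line_bound lA PA nPA).
rewrite leq_add2l leq_mul2l; apply/orP; right.
have := odd_norm_index lA PA nPA; have := line_count_gt1 lA PA.
have : #|line_class P A| <= #|nbrs P|.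
  apply/subset_leq_card/subsetP=> Q; rewrite !in_set => /andP[-> /orbitP[x]] /=.
  case/setIP=> Gx nPx /(congr_group) /= <-.
  by rewrite -{1}(normP nPx) normJ conjSg.
rewrite card_line_class //.
move: (w A P) #|nbrs P| #|F A|.-1 => w v l le w1 ow.
have w3 : 2 < w by case: w ow w1 {le} => [|[|[|w]]].
rewrite -(leq_add2r l) subnK; last by apply: leq_trans le; apply: leq_pmulr; apply: ltnW.
by apply: leq_trans le; rewrite addnC -mulSn mulnC leq_mul2l w3 orbT.
Qed.

(** The other conjugate of A under T, when there are two. *)
Definition partner A T := odflt A [pick B in orbit 'JG T A | B != A].

Lemma partnerP A T : #|T : 'N_T(A)| = 2 ->
  [/\ partner A T \in orbit 'JG T A, partner A T != A
    & forall B, B \in orbit 'JG T A -> B != A -> B = partner A T].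
Proof.
move=> i2; have c2 : #|orbit 'JG T A| = 2 by rewrite card_orbit astab1JG.
have cD : #|orbit 'JG T A :\ A| == 1%N.
  by move: c2; rewrite (cardsD1 A) orbit_refl add1n => -[->].
have /cards1P[B eB] := cD.
have oB : B \in orbit 'JG T A :\ A by rewrite eB set11.
have ueB C : C \in orbit 'JG T A -> C != A -> C = B.
  by move=> oC neC; apply/set1P; rewrite -eB in_setD1 neC.
rewrite /partner; case: pickP => [C /andP[oC neC]|/(_ B)] /=.
  by split=> // D oD neD; rewrite (ueB C) // (ueB D).
by case/setD1P: oB => neB oB; rewrite /= oB neB.
Qed.

Lemma partner_norm A T : A \subset T -> #|T : 'N_T(A)| = 2 ->
  A \subset 'N(partner A T).
Proof.
move=> sAT i2; have [/orbitP[x Tx <-] _ _] := partnerP i2.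
have nM : 'N_T(A) <| T by apply: index2_normal; rewrite ?subsetIl.
have sA : A \subset 'N_T(A) :^ x.
  by rewrite (normsP (normal_norm nM)) // subsetI sAT normG.
by rewrite conjIg -normJ in sA; apply: subset_trans sA (subsetIr _ _).
Qed.

Lemma partner_conj A T x : x \in 'N(A) -> #|T : 'N_T(A)| = 2 ->
  (partner A T :^ x)%G = partner A (T :^ x)%G.
Proof.
move=> nAx i2; have eA : (A :^ x)%G = A by apply/group_inj/normP.
have i2x : #|T :^ x : 'N_(T :^ x)(A)| = 2.
  by rewrite -{1}eA /= normJ -conjIg indexJg.
have [/orbitP[y Ty eB] neB _] := partnerP i2.
have [_ _ ueB] := partnerP i2x; apply: ueB.
  apply/orbitP; exists (y ^ x); first by rewrite memJ_conjg.
  apply: group_inj => /=; rewrite -eB /= -{1}(normP nAx) -!conjsgM.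
  by rewrite conjgE !mulgA mulgV mul1g.
by rewrite -(inj_eq (act_inj 'JG x)) /= eA in neB.
Qed.

Section PartnerLines.

Variables (A P : {group gT}).
Hypotheses (lA : isline A) (PA : P \in F A) (i2 : #|P : 'N_P(A)| = 2).

Lemma line_norm_index2 T : T \in F A -> #|T : 'N_T(A)| = 2.
Proof.
move=> TA; have [x /setIP[_ nAx] ->] := line_trans minK lA PA TA.
by rewrite -{1}(normP nAx) normJ -conjIg indexJg.
Qed.

Lemma partner_line T : T \in F A ->
  [/\ isline (partner A T), T \in F (partner A T), partner A T != A,
      A \subset 'N(partner A T) & #|F (partner A T)| = #|F A|].
Proof.
move=> TA; have iT := line_norm_index2 TA; have sTG := Syl_sub (line_Syl TA).
have nA := partner_norm (line_sub TA) iT.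
have [/orbitP[x Tx eB] neB _] := partnerP iT; have Gx := subsetP sTG x Tx.
split=> //; rewrite -eB; first exact: isline_conj.
  apply/Syl_aboveP; split; first exact: line_Syl TA.
  by rewrite /= -(conjGid Tx) conjSg line_sub.
exact: card_line_conj.
Qed.

Lemma partner_meet T U : T \in F A -> U \in F (partner A T) -> U \in F A -> U = T.
Proof.
move=> TA UB UA; have [lB TB /eqP neB _ _] := partner_line TA.
apply/eqP; apply: contraT => neUT; case: neB; apply/group_inj.
by rewrite -(line_cap minK lA UA TA neUT) -(line_cap minK lB UB TB neUT).
Qed.

(** A normalises the partners of A in T and in U. A common point W of the
    corresponding lines lies on F A by [line_norm_fix], but the partner line
    of T meets F A in T only. *)
Lemma partner_disjoint T U W : T \in F A -> U \in F A ->
  W \in F (partner A T) -> W \in F (partner A U) -> T = U.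
Proof.
move=> TA UA WT WU; have oP := line_Syl PA.
have pA : 2.-group A := pgroupS (line_sub PA) (Syl_pgroup oP).
have sAG : A \subset G := subset_trans (line_sub PA) (Syl_sub oP).
have [lT TT _ nT _] := partner_line TA; have [lU UU _ nU _] := partner_line UA.
case/orP: (line_norm_fix lT lU sAG pA nT nU WT WU) => [sAW|/eqP eTU].
  have WA : W \in F A by apply/Syl_aboveP; rewrite sAW (line_Syl WT).
  by rewrite -(partner_meet TA WT WA) -(partner_meet UA WU WA).
by apply: (partner_meet UA) => //; rewrite -eTU.
Qed.

Lemma partner_bound : #|F A| * #|F A| <= #|Om|.
Proof.
rewrite -sum_nat_const.
rewrite (eq_bigr (fun T => #|F (partner A T)|)) => [|T TA]; last first.
  by have [_ _ _ _ ->] := partner_line TA.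
apply: sum_disjoint_le => [T _|]; first by apply/subsetP=> U /line_Syl.
by move=> T U W TA UA; apply: partner_disjoint.
Qed.

(** Otherwise the partner lines of the points of F A partition the points. An
    element x of 'N_P(A) fixes a second point W, hence the partner line
    through W, hence the point T of F A to which this line belongs. So x lies
    in A if T is not P, and in the partner of A in P if T = P. But 'N_P(A) is
    not the union of these two subgroups. *)
Lemma partner_cover_contra : (#|F A| * #|F A|)%N <> #|Om|.
Proof.
move=> eO; have oP := line_Syl PA.
have cover W : W \in Om -> exists2 T, T \in F A & W \in F (partner A T).
  move=> oW; apply/exists_inP; apply: contraT.
  rewrite negb_exists_in => /forall_inP noW.
  have : \sum_(T in F A) #|F (partner A T)| <= #|Om :\ W|.
    apply: sum_disjoint_le => [T TA|]; last first.
      by move=> T U V TA UA; apply: partner_disjoint.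
    apply/subsetP=> U UT; rewrite in_setD1 (line_Syl UT) andbT.
    by apply: contraNneq (noW T TA) => <-.
  rewrite (eq_bigr (fun _ => #|F A|)) => [|T TA]; last first.
    by have [_ _ _ _ ->] := partner_line TA.
  by rewrite sum_nat_const eO [#|Om|](cardsD1 W) oW ltnn.
have [lB PB neB _ _] := partner_line PA; have sAP := line_sub PA.
have /subsetPn[x] : ~~ ('N_P(A) \subset A :|: partner A P).
  apply/negP=> /sub_union_group/orP[sNA|sNB].
    by have := line_norm_gt1 lA PA; rewrite ltnNge leq_eqVlt indexg_eq1 sNA.
  have sAB : A \subset partner A P by apply: subset_trans sNB; rewrite subsetI sAP normG.
  case/negP: neB; apply/eqP/group_inj/esym/eqP.
  rewrite eqEcard sAB /=; have [/orbitP[y _ <-] _ _] := partnerP i2.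
  by rewrite cardJg.
case/setIP=> Px nAx; rewrite inE => /norP[nAx' nBx].
have [W [oW neW Wx]] := red oP Px; have [T TA WT] := cover W oW.
have Gx := subsetP (Syl_sub oP) x Px.
have TxA : (T :^ x)%G \in F A by rewrite Syl_aboveJ // inE Gx.
have eT : T = (T :^ x)%G.
  apply: (partner_disjoint TA TxA WT); rewrite -partner_conj ?line_norm_index2 //.
  have eW : (W :^ x)%G = W by apply: group_inj; apply: conjGid.
  by rewrite -eW; apply/Syl_aboveP; rewrite eW oW -{1}eW /= conjSg line_sub.
have Tx : x \in T.
  by apply: (norm_Syl oP (line_Syl TA) Px); apply/normP; rewrite [in RHS]eT.
have ePT : T = P.
  apply/eqP; apply: contraT => neTP; case/negP: nAx'.
  by rewrite -(line_cap minK lA TA PA neTP) inE Tx.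
rewrite ePT in WT; case/negP: nBx.
by rewrite -(line_cap minK lB WT PB neW) inE Wx.
Qed.

End PartnerLines.

End LineGeometry.

(** * Coverings of a 2-group by three pairs of subgroups of index four *)

Section ThreeD8.

Variable gT : finGroupType.
Implicit Types (A B C D M P : {group gT}) (x y z : gT).

(** The product of x in M1 and M2 with an element outside M1 and M2, which
    lies in M3, is again outside M1 and M2, hence in M3. *)
Lemma cover3_meet P (M1 M2 M3 : {group gT}) :
    P \subset M1 :|: M2 :|: M3 -> ~~ (P \subset M1) -> ~~ (P \subset M2) ->
  P :&: (M1 :&: M2) \subset M3.
Proof.
move=> sP n1 n2; apply/subsetP=> x /setIP[Px /setIP[M1x M2x]].
have /subsetPn[y Py] : ~~ (P \subset M1 :|: M2).
  by apply/negP=> /sub_union_group; rewrite (negPf n1) (negPf n2).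
rewrite inE => /norP[M1y M2y].
have in3 z : z \in P -> z \notin M1 -> z \notin M2 -> z \in M3.
  by move=> Pz z1 z2; move/subsetP/(_ z Pz): sP; rewrite !inE (negPf z1) (negPf z2).
have M3y := in3 y Py M1y M2y.
by rewrite -(groupMr _ M3y) in3 ?(groupMl _ M1x) ?(groupMl _ M2x) // groupM.
Qed.

End ThreeD8.

Lemma card2_normal_cent (gT : finGroupType) (P D : {group gT}) :
  D <| P -> #|D| = 2 -> D \subset 'C(P).
Proof.
move=> /andP[_ nDP] cD; have /cards1P[d eD] : #|D :\ 1| == 1%N.
  by have := cardsD1 1 D; rewrite group1 cD add1n => -[<-].
apply/subsetP=> z Dz; apply/centP=> p Pp; apply/commgP/conjg_fixP.
have [->|nz1] := eqVneq z 1; first by rewrite conj1g.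
have in_d u : u \in D -> u != 1 -> u = d.
  by move=> Du nu; apply/set1P; rewrite -eD in_setD1 nu.
rewrite [RHS](in_d z) //; apply: in_d; last by rewrite conjg_eq1.
by rewrite memJ_norm // (subsetP nDP).
Qed.

(** In P / C the image of D is central, because it is normal of order two, and
    the images of x and y commute. *)
Lemma der1_sub_of_commg (gT : finGroupType) (P C D : {group gT}) (x y : gT) :
    C <| P -> D <| P -> C \subset D -> #|D : C| = 2 -> x \in P -> y \in P ->
    [~ x, y] \in C -> P \subset <[x]> <*> <[y]> <*> D ->
  P^`(1) \subset C.
Proof.
move=> nCP nDP sCD iDC Px Py Cxy sP; have [sCP nP] := andP nCP.
have nPx := subsetP nP x Px; have nPy := subsetP nP y Py.
have nDC := subset_trans (normal_sub nDP) nP.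
have cDC : #|D / C| = 2 by rewrite card_quotient.
have cDP := card2_normal_cent (quotient_normal C nDP) cDC.
have cxy : commute (coset C x) (coset C y).
  by apply/commgP; rewrite -morphR //; apply/eqP/coset_id.
apply: der1_min nP _; apply: abelianS (quotientS C sP) _.
rewrite !quotientY ?cycle_subG ?join_subG ?cycle_subG ?nPx //.
rewrite !quotient_cycle // abelianY abelianY !cycle_abelian cents_cycle //=.
rewrite (cyclic_abelian (prime_cyclic _)) ?cDC //=.
by apply: subset_trans cDP _; apply: centS; rewrite join_subG !cycle_subG !mem_quotient.
Qed.

Section ThreeD8Cover.

Variables (gT : finGroupType) (P : {group gT}).
Variables M A B C : 'I_3 -> {group gT}.
Implicit Types (i j l : 'I_3) (x y z : gT).

(* In the application B i is the other conjugate of A i in P and C i is their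
   intersection, so that P / C i is dihedral of order eight. *)
Hypotheses (nM : forall i, M i <| P) (iM : forall i, #|P : M i| = 2).
Hypotheses (sAM : forall i, A i \subset M i) (iA : forall i, #|M i : A i| = 2).
Hypotheses (sBM : forall i, B i \subset M i) (iB : forall i, #|M i : B i| = 2).
Hypotheses (sCA : forall i, C i \subset A i) (iCA : forall i, #|A i : C i| = 2).
Hypotheses (sCB : forall i, C i \subset B i) (iCB : forall i, #|B i : C i| = 2).
Hypotheses (nC : forall i, C i <| P).
Hypotheses (nA : forall i, ~~ (P \subset 'N(A i))) (nB : forall i, ~~ (P \subset 'N(B i))).
Hypothesis cover : forall x, x \in P -> exists i, x \in A i :|: B i.

Let sMP i : M i \subset P. Proof. exact: normal_sub. Qed.
Let nPM i : ~~ (P \subset M i). Proof. by rewrite -indexg_eq1 iM. Qed.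

Lemma three_D8_M x : x \in P -> exists i, x \in M i.
Proof.
case/cover=> i /setUP[] h; exists i; [exact: subsetP (sAM i) x h|exact: subsetP (sBM i) x h].
Qed.

Definition enum3 i j l := forall m, [|| m == i, m == j | m == l].

Lemma enum3_rot i j l : enum3 i j l -> enum3 j l i.
Proof. by move=> e m; rewrite orbA orbC; apply: e. Qed.

Lemma enum3_swap i j l : enum3 i j l -> enum3 i l j.
Proof. by move=> e m; have := e m; rewrite [(m == j) || _]orbC. Qed.

Lemma three_D8_meet i j l x : enum3 i j l -> x \in M i -> x \in M j -> x \in M l.
Proof.
move=> all3 Mx My; have sP : P \subset M i :|: M j :|: M l.
  apply/subsetP=> z /three_D8_M[m]; rewrite !inE.
  by case/or3P: (all3 m) => /eqP-> ->; rewrite ?orbT.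
apply: (subsetP (cover3_meet sP (nPM i) (nPM j))).
by rewrite !inE Mx My (subsetP (sMP i)).
Qed.

(** By [three_D8_meet] x is not in M l either, so only A i and B i can contain
    it. *)
Lemma three_D8_private i j l x : enum3 i j l ->
  x \in M i -> x \notin M j -> x \in A i :|: B i.
Proof.
move=> all3 Mx nMx; have nLx : x \notin M l.
  by apply: contra nMx; apply: three_D8_meet (enum3_swap all3) Mx.
have [m] := cover (subsetP (sMP i) x Mx).
case/or3P: (all3 m) => /eqP-> // /setUP[] h.
- by rewrite (subsetP (sAM j) x h) in nMx.
- by rewrite (subsetP (sBM j) x h) in nMx.
- by rewrite (subsetP (sAM l) x h) in nLx.
by rewrite (subsetP (sBM l) x h) in nLx.
Qed.

(** Elements of M i outside A i and B i lie in M j, and multiplying such an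
    element by one of C i gives another one. *)
Lemma three_D8_core i j l : enum3 i j l -> C i \subset M j.
Proof.
move=> all3; have /subsetPn[w Mw] : ~~ (M i \subset A i :|: B i).
  by apply/negP=> /sub_union_group; rewrite -!indexg_eq1 iA iB.
rewrite inE => /norP[nAw nBw].
have in_j x : x \in M i -> x \notin A i -> x \notin B i -> x \in M j.
  move=> Mx nAx nBx; apply: contraT => /(three_D8_private all3 Mx).
  by rewrite inE (negPf nAx) (negPf nBx).
apply/subsetP=> c Cc; have Ac := subsetP (sCA i) c Cc; have Bc := subsetP (sCB i) c Cc.
rewrite -(groupMl _ (in_j w Mw nAw nBw)) in_j //.
- by rewrite groupM // (subsetP (sAM i)).
- by rewrite groupMr.
by rewrite groupMr.
Qed.

Lemma three_D8_index i j l : enum3 i j l -> #|M i : M j| = 2.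
Proof.
move=> all3; apply: (index2_meet (nM j) (iM j) (sMP i)); apply/negP=> sMM.
have : P \subset M j :|: M l.
  apply/subsetP=> z /three_D8_M[m]; rewrite !inE.
  case/or3P: (all3 m) => /eqP-> => [/(subsetP sMM)||] ->; rewrite ?orbT //.
by move/sub_union_group; rewrite (negPf (nPM j)) (negPf (nPM l)).
Qed.

Lemma card_three_D8_meet i j l : enum3 i j l -> (#|M i :&: M j| * 4)%N = #|P|.
Proof.
move=> all3; have := Lagrange_index (sMP i) (subsetIl (M i) (M j)).
rewrite indexgI iM (three_D8_index all3) => e4.
by rewrite -[4]/(2 * 2)%N e4 Lagrange // subIset ?sMP.
Qed.

(** Otherwise X is M i :&: M j, which is normal in P. *)
Lemma three_D8_part (X : {group gT}) i j l : enum3 i j l -> ~~ (P \subset 'N(X)) ->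
    X \subset M i -> #|M i : X| = 2 -> C i \subset X -> #|X : C i| = 2 ->
  X :&: M j \subset C i.
Proof.
move=> all3 nX sX iX sC iC.
have sCI : C i \subset X :&: M j by rewrite subsetI sC (three_D8_core all3).
case/orP: (index2_between sCI (subsetIl _ _) iC) => // /subsetIP[_ sXM].
case/negP: nX; suff -> : X = M i :&: M j :> {set gT} by apply: normsI; apply: normal_norm.
apply/eqP; rewrite eqEcard subsetI sX sXM /= -(leq_pmul2r (isT : 0 < 4)).
rewrite (card_three_D8_meet all3) -(Lagrange (sMP i)) -(Lagrange sX) iM iX -mulnA.
exact: leqnn.
Qed.

Lemma three_D8_cores i j l x : enum3 i j l -> x \in M i -> x \in M j ->
  [|| x \in C i, x \in C j | x \in C l].
Proof.
move=> all3 Mx My; have Mz := three_D8_meet all3 Mx My.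
have inC i' j' l' : enum3 i' j' l' -> x \in A i' :|: B i' -> x \in M j' -> x \in C i'.
  move=> e' /setUP[] h Mj.
    by apply: (subsetP (three_D8_part e' (nA i') (sAM i') (iA i') (sCA i') (iCA i'))); rewrite inE h.
  by apply: (subsetP (three_D8_part e' (nB i') (sBM i') (iB i') (sCB i') (iCB i'))); rewrite inE h.
have [m] := cover (subsetP (sMP i) x Mx).
case/or3P: (all3 m) => /eqP-> h; apply/or3P.
- by constructor 1; apply: inC all3 h My.
- by constructor 2; apply: (inC _ _ _ (enum3_rot all3) h Mz).
by constructor 3; apply: (inC _ _ _ (enum3_rot (enum3_rot all3)) h Mx).
Qed.

Lemma three_D8_core_index i j l : enum3 i j l ->
  C i \subset M i :&: M j /\ #|M i :&: M j : C i| = 2.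
Proof.
move=> all3; have sC : C i \subset M i :&: M j.
  by rewrite subsetI (three_D8_core all3) (subset_trans (sCA i) (sAM i)).
split=> //; apply/eqP; rewrite -(eqn_pmul2l (cardG_gt0 (C i))) Lagrange //.
rewrite -(eqn_pmul2r (isT : 0 < 4)) (card_three_D8_meet all3) -(Lagrange (sMP i)) iM.
by rewrite -(Lagrange (sAM i)) iA -(Lagrange (sCA i)) iCA -!mulnA.
Qed.

(** The subgroups M i share a normal subgroup D of index four, which is the
    union of the subgroups C i, all of index two in D. So for x in M i and y
    in M j, both outside D, the commutator of x and y lies in some C m. Then
    the derived subgroup of P is contained in C m by [der1_sub_of_commg],
    hence in A m, which is therefore normal in P. *)
Lemma three_D8_contra : False.
Proof.
pose i : 'I_3 := inord 0; pose j : 'I_3 := inord 1; pose l : 'I_3 := inord 2.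
have e_ijl : enum3 i j l.
  by case=> [[|[|[|m]]] //= hm]; rewrite -!val_eqE /= !inordK.
have e_jil := enum3_swap (enum3_rot e_ijl); have e_lij := enum3_rot (enum3_rot e_ijl).
have pickM i' j' l' : enum3 i' j' l' -> exists2 x, x \in M i' & x \notin M j'.
  by move=> e; apply/subsetPn; rewrite -indexg_eq1 (three_D8_index e).
have [x Mx nMx] := pickM _ _ _ e_ijl; have [y My nMy] := pickM _ _ _ e_jil.
have Px := subsetP (sMP i) x Mx; have Py := subsetP (sMP j) y My.
pose D := (M i :&: M j)%G; have nDP : D <| P by apply: normalI.
have Dz : [~ x, y] \in M i.
  by rewrite commgEl groupM ?groupV // memJ_norm // (subsetP (normal_norm (nM i))).
have Dz' : [~ x, y] \in M j.
  by rewrite commgEr groupM // memJ_norm ?groupV // (subsetP (normal_norm (nM j))).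
have sP : P \subset <[x]> <*> <[y]> <*> D.
  set L := <[x]> <*> <[y]> <*> D.
  have Lx : x \in L by rewrite -cycle_subG (subset_trans (joing_subl _ <[y]>)) // joing_subl.
  have Ly : y \in L by rewrite -cycle_subG (subset_trans (joing_subr <[x]> _)) // joing_subl.
  have sDL : D \subset L by apply: joing_subr.
  have sL : L \subset P by rewrite !join_subG !cycle_subG Px Py normal_sub.
  have sML : M i \subset L.
    have iD : #|M i : D| = 2 by rewrite indexgI (three_D8_index e_ijl).
    have sDM : D \subset M i :&: L by rewrite subsetI subsetIl.
    case/orP: (index2_between sDM (subsetIl _ _) iD) => [/subsetIP[] //|/subsetP/(_ x)].
    by rewrite !inE Mx Lx (negPf nMx) => /(_ isT).
  case/orP: (index2_between sML sL (iM i)) => // /subsetP/(_ y Ly).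
  by rewrite (negPf nMy).
have eD : D = (M l :&: M i)%G.
  apply: group_inj; apply/setP=> z; rewrite !in_setI.
  apply/andP/andP=> -[h h']; split=> //; first exact: three_D8_meet e_ijl h h'.
  exact: three_D8_meet e_lij h h'.
have bad m : [~ x, y] \in C m -> C m \subset D -> #|D : C m| = 2 -> False.
  move=> Cz sCD iCD; case/negP: (nA m).
  apply: sub_der1_norm; last exact: subset_trans (sAM m) (sMP m).
  by apply: subset_trans (sCA m); apply: der1_sub_of_commg iCD Px Py Cz sP.
case/or3P: (three_D8_cores e_ijl Dz Dz') => Cz; apply: (bad _ Cz).
- by case: (three_D8_core_index e_ijl).
- by case: (three_D8_core_index e_ijl).
- by rewrite /= setIC; case: (three_D8_core_index e_jil).
- by rewrite /= setIC; case: (three_D8_core_index e_jil).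
- by rewrite eD; case: (three_D8_core_index e_lij).
by rewrite eD; case: (three_D8_core_index e_lij).
Qed.

End ThreeD8Cover.

(** * Least distance four *)

(** Here n is the number of points, E a subgroup normal in f of them, with m
    conjugates in G and w conjugates under the normaliser of one of these
    points. *)
Lemma core_count_contra n w m f : odd n -> odd f -> n <= 25 -> 9 <= f -> f < n -> 0 < w ->
  w * f.-1 < n -> (n * w = m * f)%N -> False.
Proof.
move=> on of_ n25 f9 fn w0 wf e.
have [a ea] : exists a, n = (2 * a + 1)%N by exists n./2; rewrite mul2n addn1 -[LHS]odd_double_half on.
have [b eb] : exists b, f = (2 * b + 1)%N by exists f./2; rewrite mul2n addn1 -[LHS]odd_double_half of_.
clear on of_; have w3 : w < 4 by nia.
case: w w0 w3 wf e => [|[|[|[|w]]]] // _ _ wf e; last first.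
- have f9' : f = 9 by lia.
  by rewrite f9' in e wf; lia.
- case: m e => [|[|[|[|[|m]]]]] e; try lia; case: m e => [|m] e; try lia; nia.
case: m e => [|[|[|m]]] e; try lia; nia.
Qed.

Section PartnerCore.

Variable gT : finGroupType.
Implicit Types (A B T : {group gT}) (x y : gT).

Lemma partner_core_norm A T :
  #|T : 'N_T(A)| = 2 -> T \subset 'N(A :&: partner A T).
Proof.
move=> i2; have [oB neB ueB] := partnerP i2; set B := partner A T in oB neB ueB *.
have oJ C x : x \in T -> C \in orbit 'JG T A -> (C :^ x)%G \in orbit 'JG T A.
  move=> Tx /orbitP[y Ty <-]; apply/orbitP; exists (y * x); first exact: groupM.
  exact: actM.
have oA : A \in orbit 'JG T A by apply: orbit_refl.
have neJ C D x : C != D -> (C :^ x)%G != (D :^ x)%G.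
  by rewrite (inj_eq (act_inj 'JG x)).
apply/subsetP=> x Tx; apply/normP; rewrite conjIg.
have [eA|neA] := eqVneq (A :^ x)%G A.
  have eB : (B :^ x)%G = B by apply: ueB; rewrite ?oJ // -[X in _ != X]eA neJ.
  by rewrite -[A :^ x]/(gval (A :^ x)%G) -[B :^ x]/(gval (B :^ x)%G) eA eB.
have eA : (A :^ x)%G = B by apply: ueB; rewrite ?oJ.
have eB : (B :^ x)%G = A.
  apply/eqP; apply: contraT => /(ueB _ (oJ B x Tx oB)) eB.
  by have := neJ B A x neB; rewrite eA eB eqxx.
by rewrite -[A :^ x]/(gval (A :^ x)%G) -[B :^ x]/(gval (B :^ x)%G) eA eB setIC.
Qed.

Lemma partner_core_index A T :
    A \subset T -> #|T : 'N_T(A)| = 2 -> #|'N_T(A) : A| = 2 ->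
  #|A : A :&: partner A T| = 2.
Proof.
move=> sAT i2 iN; have [/orbitP[x Tx eB] neB _] := partnerP i2.
have nM : 'N_T(A) <| T by apply: index2_normal; rewrite ?subsetIl.
have eM := normsP (normal_norm nM) x Tx.
have sAN : A \subset 'N_T(A) by rewrite subsetI sAT normG.
have sBN : partner A T \subset 'N_T(A) by rewrite -eB /= -eM conjSg.
have iB : #|'N_T(A) : partner A T| = 2 by rewrite -eB /= -{1}eM indexJg.
have nB : partner A T <| 'N_T(A) by apply: index2_normal.
rewrite indexgI; apply: (index2_meet nB iB sAN).
apply: contra neB => sAB; rewrite eq_sym -val_eqE eqEcard sAB /=.
by rewrite -eB cardJg.
Qed.

End PartnerCore.

Section DistanceFour.

Variables (gT : finGroupType) (G : {group gT}).
Implicit Types (A B C E H K L M P Q S T U V W : {group gT}) (x y z : gT).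

Local Notation Om := 'Syl_2(G).
Local Notation F := (Syl_above G).
Local Notation isline := (isline G 4).

Hypotheses (red : redundant G) (prim : Syl_primitive G) (le25 : #|Om| <= 25).
Hypothesis min4 : forall T U, T \in Om -> U \in Om -> T != U -> 4 <= #|T : U|.

Let k_gt1 : 1 < 4 := isT.

(** If A is normal in P, lines have at least five points, which contradicts
    [normal_line_small]. Otherwise it has two conjugates in P, and by
    [partner_bound] lines have three points or five; but five is the case
    excluded by [partner_cover_contra]. *)
Lemma line4_shape A P : isline A -> P \in F A ->
  [/\ #|P : 'N_P(A)| = 2, #|'N_P(A) : A| = 2 & #|F A| = 3].
Proof.
move=> lA PA; have e4 := line_norm_index lA PA.
have gt1 := line_norm_gt1 k_gt1 lA PA.
have dF := line_semiregular min4 lA PA.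
have F2 : 1 < #|F A| by case: lA.
have [iN|iN] := eqVneq #|P : 'N_P(A)| 1%N.
  have nPA : P \subset 'N(A).
    by move/eqP: iN; rewrite indexg_eq1 => /subsetIP[].
  have := leq_trans (normal_line_small red prim k_gt1 min4 lA PA nPA) le25.
  rewrite iN mul1n in e4; rewrite e4 in dF; clear -dF F2.
  by move: #|F A| dF F2 => f; do 3 case: f => [|f] //; case/dvdnP=> q /= ->; nia.
have [i2 iA] : #|P : 'N_P(A)| = 2 /\ #|'N_P(A) : A| = 2.
  move: e4 gt1 iN; clear; move: #|_ : _| #|_ : _| => a b.
  by case: a => [|[|[|a]]] //; case: b => [|[|[|b]]] //; nia.
split=> //; rewrite iA in dF.
have := partner_bound min4 lA PA i2.
have := partner_cover_contra red k_gt1 min4 lA PA i2.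
move: dF F2 le25; clear; move: #|F A| #|Om| => f n.
case/dvdnP=> q; case: f => [|f] //= ->; case: q => [|[|[|q]]] //=; last by nia.
by move=> _ le n25 ge; case: n25; apply/eqP; rewrite eqn_leq ge le.
Qed.

Section SecondStep.

Variables (A P Q T : {group gT}).
Hypotheses (lA : isline A) (PA : P \in F A) (QA : Q \in F A) (nePQ : P != Q).
Hypotheses (TB : T \in F (partner A Q)) (neTQ : T != Q).

Let i2P : #|P : 'N_P(A)| = 2. Proof. by case: (line4_shape lA PA). Qed.
Let i2Q : #|Q : 'N_Q(A)| = 2. Proof. by case: (line4_shape lA QA). Qed.

Lemma second_cap : A :&: T = A :&: partner A Q.
Proof.
have [lB QB _ _ _] := partner_line min4 lA PA i2P QA.
have <- := line_cap min4 lB TB QB neTQ; apply/setP=> x; rewrite !in_setI.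
by case Ax: (x \in A); rewrite //= (subsetP (line_sub QA)) // andbT.
Qed.

(** An element of P :&: T normalising A moves Q to a point of F A whose
    partner line contains T too; so it fixes Q by [partner_disjoint]. *)
Lemma second_norm_cap : (P :&: T) :&: 'N(A) = A :&: T.
Proof.
apply/eqP; rewrite eqEsubset; apply/andP; split; last first.
  apply/subsetP=> x /setIP[Ax Tx].
  by rewrite !in_setI Tx (subsetP (line_sub PA)) // (subsetP (normG A)).
apply/subsetP=> x /setIP[/setIP[Px Tx] nAx]; rewrite inE Tx andbT.
have oP := line_Syl PA; have Gx := subsetP (Syl_sub oP) x Px.
have QxA : (Q :^ x)%G \in F A by rewrite Syl_aboveJ // inE Gx.
have eT : (T :^ x)%G = T by apply: group_inj; apply: conjGid.
have TBx : T \in F (partner A (Q :^ x)%G).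
  rewrite -partner_conj // -eT; apply/Syl_aboveP.
  by rewrite SylJ //= conjSg (line_sub TB) (line_Syl TB).
have eQ := partner_disjoint min4 lA PA i2P QA QxA TB TBx.
have Qx : x \in Q.
  by apply: (norm_Syl oP (line_Syl QA) Px); apply/normP; rewrite [in RHS]eQ.
by rewrite -(line_cap min4 lA PA QA nePQ) inE Px.
Qed.

(** The point T is reached from P in two steps: along A to Q, then along the
    partner of A in Q. Suppose that y in P :&: T does not normalise A, and let
    E be the intersection of A with its partner in P. As A normalises the line
    of the second step, so does E; and E = E :^ y normalises the image of this
    line under y. These two lines contain T, and differ by [partner_disjoint];
    hence E is contained in T by [line_norm_fix]. *)
Lemma second_step :
  (#|P : T| = 8 /\ P :&: T \subset Q) \/
  [/\ #|P : T| = 4, A :&: partner A P = A :&: partner A Q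
    & ~~ (P :&: T \subset 'N(A))].
Proof.
have oP := line_Syl PA; have oT := line_Syl TB.
have [_ iA _] := line4_shape lA PA; have [_ iAQ _] := line4_shape lA QA.
have [lB QB neB nAB _] := partner_line min4 lA PA i2P QA.
have sAP := line_sub PA; have sAQ := line_sub QA.
have i8 : #|P : A :&: T| = 8.
  rewrite second_cap -(Lagrange_index sAP) ?subsetIl //.
  rewrite [X in (_ * X)%N]indexgI -[X in (_ * X)%N]indexgI partner_core_index //.
  by case: lA => _ ->.
have nM : 'N_P(A) <| P by apply: index2_normal; rewrite ?subsetIl.
have [sTN|nTN] := boolP (P :&: T \subset 'N(A)).
  have eI : P :&: T = A :&: T by rewrite -second_norm_cap (setIidPl sTN).
  left; split; first by rewrite -indexgI eI.
  by rewrite eI (subset_trans (subsetIl _ _)).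
right; have i2 : #|P :&: T : (P :&: T) :&: 'N(A)| = 2.
  have -> : (P :&: T) :&: 'N(A) = (P :&: T) :&: 'N_P(A).
    by rewrite setIA [(P :&: T) :&: P]setIAC setIid.
  rewrite indexgI [X in #|_ : X|]/= ; apply: (index2_meet nM i2P (subsetIl P T)).
  by apply: contra nTN => /subsetIP[].
have i4 : #|P : T| = 4.
  have sI : (A :&: T)%G \subset P :&: T by rewrite setSI.
  rewrite second_norm_cap in i2; have := Lagrange_index (subsetIl P T) sI.
  rewrite /= i8 i2 indexgI; clear; lia.
split=> //.
have /subsetPn[y /setIP[Py Ty] nAy] := nTN.
have Gy := subsetP (Syl_sub oP) y Py.
set E := A :&: partner A P.
have sEA : E \subset A by apply: subsetIl.
have nPE : P \subset 'N(E) by apply: partner_core_norm.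
have [_ nePA ueP] := partnerP i2P.
have eAy : (A :^ y)%G = partner A P.
  apply: ueP; first by apply/orbitP; exists y.
  by apply: contra nAy => /eqP/(congr_group) /= e; apply/normP.
set B := partner A Q in lB QB neB nAB *.
have lBy := isline_conj Gy lB.
have eT : (T :^ y)%G = T by apply: group_inj; apply: conjGid.
have TBy : T \in F (B :^ y)%G.
  rewrite -{1}eT; apply/Syl_aboveP.
  by rewrite SylJ //= conjSg (line_sub TB) (line_Syl TB).
have pE : 2.-group (A :&: partner A P)%G := pgroupS (subset_trans sEA sAP) (Syl_pgroup oP).
have sEG : (A :&: partner A P)%G \subset G := subset_trans sEA (subset_trans sAP (Syl_sub oP)).
have nEB : (A :&: partner A P)%G \subset 'N(B) := subset_trans sEA nAB.
have nEBy : (A :&: partner A P)%G \subset 'N((B :^ y)%G).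
  by have := normsP nPE y Py; rewrite /= /E normJ => <-; rewrite conjSg.
case/orP: (line_norm_fix min4 lB lBy sEG pE nEB nEBy TB TBy) => [sET|/eqP eB].
  apply/eqP; rewrite -/B -second_cap eqEcard subsetI sEA sET /=.
  have iE : #|A : E| = 2 by apply: partner_core_index.
  have iT : #|A : A :&: T| = 2 by rewrite second_cap; apply: partner_core_index.
  by rewrite -(leq_pmul2r (isT : 0 < 2)) -{1}iT -iE !Lagrange ?subsetIl.
case/eqP: nePQ; apply: (@partner_disjoint _ _ _ min4 _ _ lA PA i2P P Q (Q :^ y)%G) => //.
  rewrite -eAy; apply/Syl_aboveP.
  by rewrite SylJ //= conjSg sAQ (line_Syl QA).
rewrite -/B eB; apply/Syl_aboveP.
by rewrite SylJ //= conjSg (line_sub QB) (line_Syl QA).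
Qed.

End SecondStep.

(** The partner being the only other conjugate of A in P, this is the core of
    A in P. *)
Definition core A P := (A :&: partner A P)%G.

Lemma core_index A P : isline A -> P \in F A -> #|P : core A P| = 8.
Proof.
move=> lA PA; have [i2 iA _] := line4_shape lA PA.
rewrite -(Lagrange_index (line_sub PA)) ?subsetIl // partner_core_index ?(line_sub PA) //.
by case: lA => _ ->.
Qed.

Lemma core_norm A P : isline A -> P \in F A -> P \subset 'N(core A P).
Proof.
move=> lA PA; have [i2 _ _] := line4_shape lA PA.
exact: partner_core_norm.
Qed.

Lemma core_uniq A P E : isline A -> P \in F A ->
  E \subset A -> P \subset 'N(E) -> #|P : E| = 8 -> E = core A P.
Proof.
move=> lA PA sEA nPE iE; have [i2 _ _] := line4_shape lA PA.
have iC := core_index lA PA; apply/eqP; rewrite -val_eqE eqEcard /= subsetI sEA /=.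
have sEP := subset_trans sEA (line_sub PA).
have [/orbitP[y Py eB] _ _] := partnerP i2; apply/andP; split.
  by rewrite -eB /= -(normsP nPE y Py) conjSg.
have sCP : core A P \subset P by rewrite (subset_trans _ (line_sub PA)) ?subsetIl.
have := Lagrange sEP; rewrite -(Lagrange sCP) iE iC => /eqP.
by rewrite eqn_pmul2r // => /eqP->.
Qed.

Lemma core_sub A P : core A P \subset A.
Proof. by rewrite /core /= subsetIl. Qed.

Section EightCores.

Hypothesis step4 : forall P Q T, P \in Om -> Q \in Syl_at G P 4 ->
  T \in F (partner (P :&: Q)%G Q) -> T != Q -> #|P : T| = 4.

Lemma core_eq A P Q T : isline A -> P \in F A -> Q \in F A -> P != Q ->
    T \in F (partner A Q) -> T != Q ->
  [/\ #|P : T| = 4, core A P = core A Q & ~~ (P :&: T \subset 'N(A))].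
Proof.
move=> lA PA QA nePQ TB neTQ; have eA := group_inj (line_cap min4 lA PA QA nePQ).
have oP := line_Syl PA.
have i4 : #|P : T| = 4.
  apply: (@step4 P Q T) => //; last by rewrite eA.
  by apply: line_Syl_at PA QA _; rewrite // eq_sym.
case: (second_step lA PA QA nePQ TB neTQ) => [[]|[_ eI nPT]].
  by rewrite i4.
by split=> //; apply: group_inj.
Qed.

(** By [second_step], the core of A computed in P is also the intersection of
    A with its partner in any other point Q of the line. *)
Lemma core_line A P Q : isline A -> P \in F A -> Q \in F A -> core A P = core A Q.
Proof.
move=> lA PA QA; have [->//|nePQ] := eqVneq P Q.
have [i2 _ F3] := line4_shape lA PA.
have [_ QB _ _ cB] := partner_line min4 lA PA i2 QA.
have /card_gt0P[T /setD1P[neT TB]] : 0 < #|F (partner A Q) :\ Q|.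
  by move: cB; rewrite (cardsD1 Q) QB F3 add1n => -[->].
by have [] := core_eq lA PA QA nePQ TB neT.
Qed.

Lemma core_step P E T : P \in Om -> E \subset P -> P \subset 'N(E) -> #|P : E| = 8 ->
  #|P : T| = 4 -> T \in F E -> T \subset 'N(E) /\ E = core (P :&: T)%G P.
Proof.
move=> oP sEP nPE iE iPT /Syl_aboveP[oT sET].
have [lA PA TA _] := line_join k_gt1 oP (introT Syl_atP (conj oT iPT)).
have eE : E = core (P :&: T)%G P by apply: core_uniq; rewrite // subsetI sEP.
by split=> //; rewrite eE (core_line lA PA TA) core_norm.
Qed.

Lemma cap_eight P U E : P \in Om -> U \in Om -> P != U ->
    E \subset P -> E \subset U -> #|P : E| = 8 ->
  (#|P : U| = 4 /\ #|P :&: U : E| = 2) \/ E = (P :&: U)%G.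
Proof.
move=> oP oU ne sEP sEU iE; have sI : E \subset (P :&: U)%G by rewrite subsetI sEP.
have := Lagrange_index (subsetIl P U) sI; rewrite iE indexgI => e.
have le4 := min4 oP oU ne.
have [e1|ne1] := eqVneq #|P :&: U : E| 1%N.
  right; apply/eqP; rewrite -val_eqE eqEsubset sI /=.
  by rewrite -indexg_eq1 e1.
left; move: e ne1 le4; clear; move: #|_ : _| #|_ : _| => b a e b1 a4.
have b2 : b = 2.
  by case: b e b1 => [|[|[|b]]] //; nia.
have ea : a = 4 by nia.
by rewrite ea in e; split=> //; lia.
Qed.

(** Let E be the core of a line through P, and Z E the set of the f points
    that normalise E. It contains P and at least two P-orbits of size four, so
    f >= 9. It does not contain all points: otherwise redundancy gives x ^+ 2
    in E for all x in P, and then A is normal in P. A point other than P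
    normalising E meets P in E or in a line with core E; so for distinct
    conjugates E and E' of E under 'N_G(P), Z E and Z E' have only P in
    common. These facts contradict [core_count_contra]. *)
Lemma step4_contra P Q : P \in Om -> Q \in Syl_at G P 4 -> False.
Proof.
move=> oP Q4; have [lA PA QA neQP] := line_join k_gt1 oP Q4; set A := (P :&: Q)%G in lA PA QA.
have [oQ iPQ] := Syl_atP Q4.
have [i2 iA F3] := line4_shape lA PA.
pose E := core A P.
have sEA : E \subset A := core_sub A P.
have sEP : E \subset P := subset_trans sEA (line_sub PA).
have nPE : P \subset 'N(E) := core_norm lA PA.
have iE : #|P : E| = 8 := core_index lA PA.
have pE : 2.-group E := pgroupS sEP (Syl_pgroup oP).
have sEG : E \subset G := subset_trans sEP (Syl_sub oP).
pose Z B := [set T in Om | gval T \subset 'N(gval B)].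
have ZP B T : reflect (T \in Om /\ T \subset 'N(B)) (T \in Z B).
  by rewrite [X in reflect _ X]in_set; apply: andP.
have eZ : 'Syl_2('N_G(E)) = Z E by apply: Syl_normaliserE oP nPE.
(* T is a second point at distance four in Z E, and is not in the P-orbit of Q
   because P :&: T does not normalise A *)
have [_ QB _ _ cB] := partner_line min4 lA PA i2 QA.
have /card_gt0P[T /setD1P[neT TB]] : 0 < #|F (partner A Q) :\ Q|.
  by move: cB; rewrite (cardsD1 Q) QB F3 add1n => -[->].
have nePQ : P != Q by rewrite eq_sym.
have [i4 eE nPT] := core_eq lA PA QA nePQ TB neT; have oT := line_Syl TB.
have TZ : T \in Z E.
  apply/ZP; split=> //; have sET : E \subset T.
    rewrite /E eE; apply: subset_trans (subsetIr _ _) (line_sub TB).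
  by case: (core_step oP sEP nPE iE i4); first by apply/Syl_aboveP.
have QZ : Q \in Z E by apply/ZP; rewrite /E (core_line lA PA QA) core_norm.
have aZ : [acts P, on Z E | 'JG].
  apply/actsP=> x Px U; apply/ZP/ZP; rewrite /= SylJ ?(subsetP (Syl_sub oP)) //.
    by rewrite -{1}(normsP nPE x Px) normJ conjSg.
  by case=> oU nU; rewrite -{1}(normsP nPE x Px) normJ conjSg.
have orb U : U \in Z E -> orbit 'JG P U \subset Z E by move=> UZ; rewrite acts_sub_orbit.
have f9 : 9 <= #|Z E|.
  have sU : [set P] :|: (orbit 'JG P Q :|: orbit 'JG P T) \subset Z E.
    by rewrite !subUset !orb // sub1set; apply/andP; split=> //; apply/ZP.
  apply: leq_trans (subset_leq_card sU).
  have nP U : U != P -> P \notin orbit 'JG P U.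
    move=> ne; apply: contra ne => /orbitP[x Px] /(congr_group) /= e.
    apply/eqP/group_inj; rewrite -[RHS](conjGid (groupVr Px)) -[in RHS]e.
    by rewrite /= conjsgK.
  have neTP : T != P by apply/eqP=> e; rewrite e indexgg in i4.
  rewrite cardsU1 in_setU negb_or !nP //= cardsU.
  rewrite (card_Syl_orbit oP oQ) (card_Syl_orbit oP oT) i4 iPQ (_ : _ :&: _ = set0) ?cards0 //.
  apply/setP=> U; rewrite in_setI in_set0; apply/negP=> /andP[oU1 oU2].
  have : T \in orbit 'JG P Q.
    by rewrite -(orbit_eqP oU1) orbit_sym.
  case/orbitP=> x Px /(congr_group) /= eT; case/negP: nPT.
  have nM : 'N_P(A) <| P by apply: index2_normal; rewrite ?subsetIl.
  apply: subset_trans (subsetIr P 'N(A)); rewrite -(normsP (normal_norm nM) x Px).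
  by rewrite -eT -{1}(conjGid Px) -conjIg conjSg subsetI (line_sub PA) normG.
have fn : #|Z E| < #|Om|.
  rewrite ltnNge; apply/negP=> le; have {le}eZO : Z E = Om.
    apply/eqP; rewrite eqEcard le andbT; apply/subsetP=> U; by case/ZP.
  have sqr x : x \in P -> x ^+ 2 \in E.
    move=> Px; have [U [oU neU Ux]] := red oP Px.
    have /ZP[_ nUE] : U \in Z E by rewrite eZO.
    have sEU : E \subset U := norm_sub_Syl oU pE sEG nUE.
    rewrite eq_sym in neU.
    case: (cap_eight oP oU neU sEP sEU iE) => [[_ i2E]|eI]; last first.
      by rewrite groupX // eI inE Px.
    apply: (index2_sqr _ i2E); last by rewrite inE Px.
    by rewrite subsetI sEP.
  have /negP[] : ~~ (P \subset 'N(A)).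
    by apply/negP=> nPA; rewrite (setIidPl nPA) indexgg in i2.
  apply/subsetP=> x Px; rewrite inE; apply/subsetP=> _ /imsetP[a Aa ->].
  have Pa := subsetP (line_sub PA) a Aa.
  have -> : a ^ x = x ^- 2 * (x * a) ^+ 2 * a^-1.
    by rewrite conjgE !expgS expg0 !mulg1 invMg !mulgA mulgKV mulgK.
  rewrite groupMr ?groupV //; apply: (subsetP sEA).
  by rewrite groupM ?groupV ?sqr // groupM.
have odE : odd #|Z E| by rewrite -eZ odd_card_Syl.
have eC := card_Syl_normaliser oP nPE; rewrite eZ in eC.
apply: (core_count_contra (odd_card_Syl G) odE le25 f9 fn (indexg_gt0 'N_G(P) 'N(E)) _ eC).
clearbody E.
have eW : #|'N_G(P) : 'N(E)| = #|orbit 'JG 'N_G(P) E|.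
  by rewrite card_orbit astab1JG indexgI.
have orbE B : B \in orbit 'JG 'N_G(P) E ->
    [/\ B \subset P, P \subset 'N(B), #|P : B| = 8 & #|Z B| = #|Z E|].
  case/orbitP=> x /setIP[Gx nPx] <-; split.
  - by rewrite /= -(normP nPx) conjSg.
  - by rewrite /= -{1}(normP nPx) normJ conjSg.
  - by rewrite /= -{1}(normP nPx) indexJg.
  rewrite -(card_imset (mem (Z E)) (act_inj 'JG x)); apply: eq_card => U.
  apply/idP/imsetP=> [/ZP[oU nU]|[V /ZP[oV nV] ->]]; last first.
    by apply/ZP; rewrite SylJ //= normJ conjSg.
  exists (U :^ x^-1)%G; last by apply: group_inj; rewrite /= conjsgKV.
  by apply/ZP; rewrite SylJ ?groupV //= sub_conjgV -normJ.
rewrite eW -sum_nat_const (eq_bigr (fun B => #|Z B :\ P|)); last first.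
  move=> B oB; have [_ nB _ <-] := orbE B oB.
  by rewrite [#|Z B|](cardsD1 P) (introT (ZP B P)).
rewrite [#|Om|](cardsD1 P) oP add1n ltnS.
apply: sum_disjoint_le => [B oB|B C U oB oC].
  by apply: setSD; apply/subsetP=> U /ZP[].
have [sB nB iB _] := orbE B oB; have [sC nC iC _] := orbE C oC.
case/setD1P=> neU /ZP[oU nUB] /setD1P[_ /ZP[_ nUC]]; rewrite eq_sym in neU.
have sub (D : {group gT}) : D \subset P -> U \subset 'N(D) -> D \subset U.
  by move=> sD; apply: (norm_sub_Syl oU (pgroupS sD (Syl_pgroup oP)) (subset_trans sD (Syl_sub oP))).
have sBU := sub B sB nUB; have sCU := sub C sC nUC.
case: (cap_eight oP oU neU sB sBU iB) => [[i4U _]|eB].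
  have [_ ->] : U \subset 'N(B) /\ B = core (P :&: U)%G P.
    by apply: core_step => //; apply/Syl_aboveP.
  have [_ ->] : U \subset 'N(C) /\ C = core (P :&: U)%G P.
    by apply: core_step => //; apply/Syl_aboveP.
  by [].
case: (cap_eight oP oU neU sC sCU iC) => [[i4U _]|->] //.
by rewrite eB /= indexgI i4U in iB.
Qed.

End EightCores.

(** By [line_count], if 3 does not divide the number of points, it divides the
    number of 'N_G(P)-conjugates of each line, and this number divides the
    size of the 'N_G(P)-orbit of each point of the line other than P. *)
Lemma card_Syl_at4_three P : P \in Om -> ~~ (3 %| #|Om|) -> 3 %| #|Syl_at G P 4|.
Proof.
move=> oP n3; apply: (@dvdn_acts _ _ _ 'JG 'N_G(P)).
  apply/actsP=> x /setIP[Gx nPx] Q; apply/Syl_atP/Syl_atP; rewrite /= SylJ //.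
    by rewrite -{1}(normP nPx) indexJg.
  by rewrite -{2}(normP nPx) indexJg.
move=> Q Q4; have [lA PA QA neQP] := line_join k_gt1 oP Q4; set A := (P :&: Q)%G in lA PA QA.
have [i2 iA F3] := line4_shape lA PA.
apply: (@dvdn_trans #|'N_G(P) : 'N(A)|).
  have := line_count min4 lA PA; rewrite F3 => e.
  have : 3 %| #|Om| * #|'N_G(P) : 'N(A)| by rewrite e dvdn_mull.
  by rewrite Euclid_dvdM // (negPf n3).
rewrite card_orbit astab1JG -(indexgI 'N_G(P) 'N(A)).
apply: indexgS; rewrite subsetI subsetIl /=.
apply/subsetP=> x /setIP[/setIP[_ nPx] nQx].
by rewrite inE conjIg (normP nPx) (normP nQx).
Qed.

Section Configuration.

Variables (P Q T : {group gT}).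
Hypotheses (oP : P \in Om) (Q4 : Q \in Syl_at G P 4) (T8 : T \in Syl_at G P 8).
Hypothesis sTQ : P :&: T \subset Q.

(** By [card_Syl_at4_three], 3 divides the number of points or the number of
    points at distance four; in both cases there are 21 points. *)
Lemma eight_counts :
    #|Syl_at G P 4| = 4 /\ #|Syl_at G P 8| = 16 \/
  #|Syl_at G P 4| = 12 /\ #|Syl_at G P 8| = 8.
Proof.
have N2 : #|Syl_at G P 2| = 0.
  apply: eq_card0 => U; apply/negP=> /Syl_atP[oU iU].
  by have := min4 oP oU; rewrite iU; case: eqP => [e|_ /(_ isT)//]; rewrite -e indexgg in iU.
have := card_Syl_at4_three oP; have := card_Syl_split oP le25.
have := le25; have := dvdn_Syl_at 4 oP; have := dvdn_Syl_at 8 oP; have := dvdn_Syl_at 16 oP.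
have : 0 < #|Syl_at G P 4| by apply/card_gt0P; exists Q.
have : 0 < #|Syl_at G P 8| by apply/card_gt0P; exists T.
rewrite N2; clear; move: #|Om| #|Syl_at G P 4| #|Syl_at G P 8| #|Syl_at G P 16| => n a b c.
move=> b0 a0 /dvdnP[c' ->] /dvdnP[b' eb] /dvdnP[a' ea] n25 en n3.
have ec : c' = 0 by lia.
have [a3|na3] := boolP (3 %| a').
  by right; lia.
have : 3 %| n by apply: contraR na3 => /n3; lia.
left; lia.
Qed.

Lemma index_four_eight U : U \in Om -> U != P -> U \in Syl_at G P 4 \/ U \in Syl_at G P 8.
Proof.
move=> oU neU; case: (index_Syl_cases oP oU neU le25) => iU.
- by have := min4 oP oU; rewrite iU eq_sym neU => /(_ isT).
- by left; apply/Syl_atP.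
- by right; apply/Syl_atP.
have c16 : 16 <= #|Syl_at G P 16|.
  apply: dvdn_leq (dvdn_Syl_at 16 oP); apply/card_gt0P; exists U; exact/Syl_atP.
by have := card_Syl_split oP le25; have := le25; case: eight_counts c16 => -[-> ->]; lia.
Qed.

Let A := (P :&: Q)%G.

(** The normaliser of P :&: Q in P has index two and contains the
    intersections of P with the points of the orbits of Q and T. There remains
    one orbit at distance eight, and so [redundant_index2] applies. *)
Lemma eight_sixteen : ~ (#|Syl_at G P 4| = 4 /\ #|Syl_at G P 8| = 16).
Proof.
case=> c4 c8; have [lA PA QA neQP] := line_join k_gt1 oP Q4; have [i2 iA F3] := line4_shape lA PA.
have nM : 'N_P(A) <| P by apply: index2_normal; rewrite ?subsetIl.
have sAM : A \subset 'N_P(A) by rewrite subsetI (line_sub PA) normG.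
have inM U V : P :&: U \subset 'N_P(A) -> V \in orbit 'JG P U -> P :&: V \subset 'N_P(A).
  move=> sU /orbitP[x Px <-]; rewrite /= cap_conj // -(normsP (normal_norm nM) x Px).
  by rewrite conjSg.
have sTM : P :&: T \subset 'N_P(A).
  by apply: subset_trans sAM; rewrite /= subsetI subsetIl.
have [U U8 TU] := Syl_at_two_orbits oP (isT : 0 < 8) c8 T8.
have [oU iU] := Syl_atP U8.
have nPU : ~~ (P \subset U) by rewrite -indexg_eq1 iU.
have [M [_ iM sM]] := pgroup_orbit_cover (Syl_pgroup oP) nPU.
have nPM : ~~ (P \subset M) by rewrite -indexg_eq1 iM.
have nPN : ~~ (P \subset 'N_P(A)%G) by rewrite -indexg_eq1 i2.
have [V [oV neV nV1 nV2]] := redundant_index2 red oP nPN nPM.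
case: (index_four_eight oV neV) => [V4|V8].
  case/negP: nV1; apply: inM (_ : V \in orbit 'JG P Q) => //.
  by rewrite -(Syl_at_orbit oP c4 Q4).
case: (TU V V8) => [VT|/orbitP[x Px eV]]; first by case/negP: nV1; apply: inM VT.
by case/negP: nV2; rewrite -eV; apply: sM.
Qed.

(** The points at distance four are on six lines through P, forming three
    P-orbits of size two. As P :&: T is contained in Q, the points at distance
    eight do not contribute to the covering of P by its intersections with
    other points, and [three_D8_contra] applies to the six lines. *)
Lemma twelve_eight : ~ (#|Syl_at G P 4| = 12 /\ #|Syl_at G P 8| = 8).
Proof.
case=> c4 c8; have [oT iT] := Syl_atP T8.
pose Lns := lines_through G 4 P.
have LnsP B : B \in Lns -> isline B /\ P \in F B.
  by move/(lines_throughP (isT : 1 < 4) min4 B oP).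
have cL : #|Lns| = 6.
  have e : #|Syl_at G P 4| = (#|Lns| * 2)%N.
    by apply: card_lines_through => // B lB PB; case: (line4_shape lB PB).
  by move: e; rewrite c4; clear; lia.
have sPN : P \subset 'N_G(P) by rewrite subsetI (Syl_sub oP) normG.
have aL : [acts P, on Lns | 'JG].
  have aL x B : x \in P -> B \in Lns -> (B :^ x)%G \in Lns.
    by move=> Px; apply: lines_throughJ => //; apply: subsetP Px.
  apply/actsP=> x Px B /=; apply/idP/idP=> [LB|]; last exact: aL.
  by rewrite -[B](actK 'JG x) /= aL // groupV.
have cO B : B \in Lns -> #|orbit 'JG P B| = 2.
  move=> LB; have [lB PB] := LnsP B LB; have [i2 _ _] := line4_shape lB PB.
  by rewrite card_orbit astab1JG.
have c3 : #|orbit 'JG P @: Lns| = 3.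
  have /(_ _ _)/eqP := card_uniform_partition _ (orbit_partition aL).
  move/(_ 2); rewrite cL => e; apply/eqP; rewrite -(eqn_pmul2r (isT : 0 < 2)) eq_sym.
  by apply: e => _ /imsetP[B LB ->]; apply: cO.
have [a aP] : exists a : 'I_3 -> {group gT}, forall i,
    a i \in Lns /\ enum_val (cast_ord (esym c3) i) = orbit 'JG P (a i).
  apply: (@fin_all_exists _ (fun=> {group gT})
    (fun i B => B \in Lns /\ enum_val (cast_ord (esym c3) i) = orbit 'JG P B)) => i.
  have := enum_valP (cast_ord (esym c3) i).
  by case/imsetP=> B LB eB; exists B.
have aL' i : isline (a i) /\ P \in F (a i) by case: (aP i) => /LnsP.
have sh i : [/\ #|P : 'N_P(a i)| = 2, #|'N_P(a i) : a i| = 2 & #|F (a i)| = 3].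
  by case: (aL' i) => la Pa; apply: line4_shape.
have allL B : B \in Lns -> exists i, B \in orbit 'JG P (a i).
  move=> LB; have oB : orbit 'JG P B \in orbit 'JG P @: Lns by apply: imset_f.
  exists (cast_ord c3 (enum_rank_in oB (orbit 'JG P B))).
  have [_ <-] := aP (cast_ord c3 (enum_rank_in oB (orbit 'JG P B))).
  by rewrite cast_ordK enum_rankK_in // orbit_refl.
pose b i := partner (a i) P.
have bP i : b i \in orbit 'JG P (a i) by case: (sh i) => /partnerP[].
have ab i B : B \in orbit 'JG P (a i) -> B = a i \/ B = b i.
  have [i2 _ _] := sh i; have [_ _ u] := partnerP i2.
  by move=> oB; have [->|ne] := eqVneq B (a i); [left|right; apply: u].
have nM i : 'N_P(a i)%G <| P by apply: index2_normal; rewrite ?subsetIl //; case: (sh i).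
have nC i : core (a i) P <| P.
  case: (aL' i) => la Pa; rewrite /normal (core_norm la Pa) andbT.
  by rewrite (subset_trans (core_sub _ _)) // (line_sub Pa).
have iC i : #|a i : core (a i) P| = 2.
  case: (aL' i) => la Pa; case: (sh i) => i2 iA _.
  by apply: partner_core_index => //; apply: line_sub Pa.
apply: (@three_D8_contra _ P (fun i => 'N_P(a i)%G) a b (fun i => core (a i) P)) => //.
- by move=> i; case: (sh i).
- by move=> i; case: (aL' i) => _ /line_sub sa; rewrite subsetI sa normG.
- by move=> i; case: (sh i).
- move=> i; case: (aL' i) => _ /line_sub sa; case/orbitP: (bP i) => x Px <- /=.
  by rewrite -(normsP (normal_norm (nM i)) x Px) conjSg subsetI sa normG.
- move=> i; case/orbitP: (bP i) => x Px <- /=.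
  rewrite -{1}(normsP (normal_norm (nM i)) x Px) indexJg; by case: (sh i).
- by move=> i; apply: core_sub.
- by move=> i; apply: subsetIr.
- move=> i; case/orbitP: (bP i) => x Px eb; rewrite -{1}eb.
  by rewrite /= -(normsP (normal_norm (nC i)) x Px) indexJg.
- by move=> i; apply/negP=> nP; case: (sh i); rewrite (setIidPl nP) indexgg.
- move=> i; case/orbitP: (bP i) => x Px <- /=; apply/negP=> nP.
  case: (sh i) => i2 _ _; move: nP; rewrite normJ -{1}(conjGid Px) conjSg => nP.
  by rewrite (setIidPl nP) indexgg in i2.
move=> x Px; have [V [oV neV Vx]] := red oP Px.
have main U y : U \in Syl_at G P 4 -> y \in P :&: U -> exists i, y \in a i :|: b i.
  move=> U4 Uy; have /allL[i /ab oi] : (P :&: U)%G \in Lns by apply: imset_f.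
  exists i; rewrite inE.
  by case: oi => /(congr_group) /= <-; rewrite Uy ?orbT.
case: (index_four_eight oV neV) => [V4|V8]; first by apply: main V4 _; rewrite inE Px.
have : V \in orbit 'JG P T by rewrite -(Syl_at_orbit oP c8 T8).
case/orbitP=> y Py eV; apply: (main (Q :^ y)%G).
  by rewrite (actsP (acts_Syl_at 4 oP)).
rewrite /= inE Px; have : x \in P :&: V by rewrite inE Px.
by rewrite -eV /= cap_conj //; apply: subsetP; rewrite conjSg.
Qed.

End Configuration.

Lemma distance4_contra P Q : P \in Om -> Q \in Syl_at G P 4 -> False.
Proof.
move=> oP Q4; apply: (step4_contra _ oP Q4).
move=> {oP Q4} P' Q' T oP Q4 TB neT.
have [lA PA QA neQP] := line_join k_gt1 oP Q4; rewrite eq_sym in neQP.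
case: (second_step lA PA QA neQP TB neT) => [[iT sT]|[] //].
have T8 : T \in Syl_at G P' 8 by apply/Syl_atP; rewrite (line_Syl TB).
case: (eight_counts oP Q4 T8) => [e|e].
  by case: (eight_sixteen oP Q4 T8 sT).
by case: (twelve_eight oP Q4 T8 sT).
Qed.

End DistanceFour.

(** * Least distance eight *)

Section DistanceEight.

Variables (gT : finGroupType) (G : {group gT}).
Implicit Types (A B C E H K L M P Q S T U V W : {group gT}) (x y z : gT).

Local Notation Om := 'Syl_2(G).
Local Notation F := (Syl_above G).
Local Notation isline := (isline G 8).

Hypotheses (red : redundant G) (prim : Syl_primitive G) (le25 : #|Om| <= 25).
Hypothesis min8 : forall T U, T \in Om -> U \in Om -> T != U -> 8 <= #|T : U|.

(** In all other distributions of the distances, P has at most two orbits on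
    the other points. *)
Lemma distance8_count P : P \in Om -> #|Syl_at G P 8| = 24 /\ #|Om| = 25.
Proof.
move=> oP; have N2 k : 0 < k -> k < 8 -> k != 1%N -> #|Syl_at G P k| = 0.
  move=> k0 k8 k1; apply: eq_card0 => U; apply/negP=> /Syl_atP[oU iU].
  have [e|ne] := eqVneq P U; first by rewrite -iU -e indexgg in k1.
  by have := min8 oP oU ne; rewrite iU leqNgt k8.
have split := card_Syl_split oP le25; rewrite (N2 2) // (N2 4) // in split.
have [U [oU neU _]] := red oP (group1 P).
have nP1 : ~~ (P \subset [1]).
  by apply: contra neU => sP; rewrite eq_sym; apply/eqP/(Syl_eq oP oU)/(subset_trans sP)/sub1G.
have others V : V \in Om -> V != P -> V \in Syl_at G P 8 \/ V \in Syl_at G P 16.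
  move=> oV neV; have := min8 oP oV; rewrite eq_sym neV => /(_ isT).
  by case: (index_Syl_cases oP oV neV le25) => iV; rewrite iV // => _;
     [left|right]; apply/Syl_atP.
have d8 := dvdn_Syl_at 8 oP; have d16 := dvdn_Syl_at 16 oP.
have le16 : #|Syl_at G P 16| <= 16.
  by move: split le25 d8 d16; clear; move: #|Syl_at G P 8| #|Syl_at G P 16| #|Om| => a b c; lia.
have [M [iM sM]] := Syl_at_cover_le oP (isT : 1 < 16) le16 nP1.
have nPM : ~~ (P \subset M) by rewrite -indexg_eq1 iM.
have n8 : ~~ (#|Syl_at G P 8| <= 8).
  apply/negP=> le8; have [L [iL sL]] := Syl_at_cover_le oP (isT : 1 < 8) le8 nP1.
  have nPL : ~~ (P \subset L) by rewrite -indexg_eq1 iL.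
  have [V [oV neV nV1 nV2]] := redundant_index2 red oP nPM nPL.
  case: (others V oV neV) => VP; first by rewrite sL in nV2.
  by rewrite sM in nV1.
have n16 : #|Syl_at G P 8| <> 16.
  move=> c8; have /card_gt0P[T T8] : 0 < #|Syl_at G P 8| by rewrite c8.
  have [W W8 TW] := Syl_at_two_orbits oP (isT : 0 < 8) c8 T8.
  have ix R : R \in Syl_at G P 8 -> ~~ (P \subset R).
    by case/Syl_atP=> _ iR; rewrite -indexg_eq1 iR.
  have [L1 [_ iL1 sL1]] := pgroup_orbit_cover (Syl_pgroup oP) (ix T T8).
  have [L2 [_ iL2 sL2]] := pgroup_orbit_cover (Syl_pgroup oP) (ix W W8).
  have nL1 : ~~ (P \subset L1) by rewrite -indexg_eq1 iL1.
  have nL2 : ~~ (P \subset L2) by rewrite -indexg_eq1 iL2.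
  have [V [oV neV nV1 nV2]] := redundant_index2 red oP nL1 nL2.
  case: (others V oV neV) => VP; last first.
    have := subset_leq_card (subsetIl Om (Syl_at G P 16)).
    have : 0 < #|Syl_at G P 16| by apply/card_gt0P; exists V.
    by move: split le25 d16; rewrite c8; clear; lia.
  case: (TW V VP) => /orbitP[x Px eV].
    by rewrite -eV sL1 in nV1.
  by rewrite -eV sL2 in nV2.
by move: split le25 d8 d16 n8 n16; clear; lia.
Qed.

Lemma distance8_index P Q : P \in Om -> Q \in Om -> P != Q -> #|P : Q| = 8.
Proof.
move=> oP oQ ne; have [c8 c25] := distance8_count oP.
have sU : P |: Syl_at G P 8 \subset Om.
  by rewrite subUset sub1set oP; apply/subsetP=> U /Syl_atP[].
have eO : P |: Syl_at G P 8 = Om.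
  apply/eqP; rewrite eqEcard sU c25 cardsU1 c8.
  by case: Syl_atP => // -[_]; rewrite indexgg.
have : Q \in P |: Syl_at G P 8 by rewrite eO.
by case/setU1P=> [e|/Syl_atP[]//]; rewrite e eqxx in ne.
Qed.

Lemma isline8 P Q : P \in Om -> Q \in Om -> P != Q ->
  [/\ isline (P :&: Q)%G, P \in F (P :&: Q)%G & Q \in F (P :&: Q)%G].
Proof.
move=> oP oQ ne; have Q8 : Q \in Syl_at G P 8 by apply/Syl_atP; rewrite distance8_index.
by have [] := line_join (isT : 1 < 8) oP Q8.
Qed.

(** Line normalisers of index one or two in P are excluded by the bounds that
    serve for [line4_shape]. *)
Lemma line8_index A P : isline A -> P \in F A ->
  #|P : 'N_P(A)| = 4 /\ #|'N_P(A) : A| = 2.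
Proof.
move=> lA PA; have e8 := line_norm_index lA PA.
have gt1 := line_norm_gt1 (isT : 1 < 8) lA PA.
have dF := line_semiregular min8 lA PA.
have F2 : 1 < #|F A| by case: lA.
have [iN|iN] := eqVneq #|P : 'N_P(A)| 1%N.
  have nPA : P \subset 'N(A).
    by move/eqP: iN; rewrite indexg_eq1 => /subsetIP[].
  have := leq_trans (normal_line_small red prim (isT : 1 < 8) min8 lA PA nPA) le25.
  rewrite iN mul1n in e8; rewrite e8 in dF; clear -dF F2.
  by move: #|F A| dF F2 => f; do 3 case: f => [|f] //; case/dvdnP=> q /= ->; nia.
have [i2|i2] := eqVneq #|P : 'N_P(A)| 2.
  have := partner_bound min8 lA PA i2.
  have := partner_cover_contra red (isT : 1 < 8) min8 lA PA i2.
  have i4 : #|'N_P(A) : A| = 4 by move: e8; rewrite i2; clear; lia.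
  move: dF F2 le25; rewrite i4; clear; move: #|F A| #|Om| => f n.
  case/dvdnP=> q; case: f => [|f] //= ->; case: q => [|[|q]] //=; last by nia.
  by move=> _ le n25 ge; case: n25; apply/eqP; rewrite eqn_leq ge le.
move: e8 gt1 iN i2; clear; move: #|_ : _| #|_ : _| => a b e a1 i1 i2.
have : b < 5 by nia.
by case: b e i1 i2 => [|[|[|[|[|b]]]]] //; lia.
Qed.

(** Let w be the number of conjugates of A under 'N_G(P) and f the number of
    points of the line. Then f is odd, 4 divides w, f divides 25 w and (f - 1)
    w <= 24; so (f, w) is (3, 12) or (5, 4). *)
Lemma line8_shape A P : isline A -> P \in F A ->
  (#|F A| = 3 /\ #|line_class G 8 P A| = 24) \/ (#|F A| = 5 /\ #|line_class G 8 P A| = 16).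
Proof.
move=> lA PA; have [iP iA] := line8_index lA PA; have oP := line_Syl PA.
have := line_count min8 lA PA; have := card_line_class (isT : 1 < 8) min8 lA PA.
have := dvdn_norm_index lA PA; have := line_semiregular min8 lA PA.
have : #|line_class G 8 P A| <= 24.
  have [<- _] := distance8_count oP.
  by apply/subset_leq_card/subsetP=> Q; rewrite inE => /andP[].
have := line_count_gt1 red prim (isT : 1 < 8) min8 lA PA.
have F2 : 1 < #|F A| by case: lA.
have [_ ->] := distance8_count oP; rewrite iP iA; move: F2; clear.
move: #|'N_G(P) : 'N(A)| #|G : 'N_G(A)| #|line_class G 8 P A| #|F A| => w m c f.
move=> f2 w1 c24 /dvdnP[q ef] /dvdnP[v ew] ec e.
have [a ea] : exists a, f = (2 * a + 1)%N by exists q; lia.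
have {ef} ec' : c = (8 * (a * v))%N by rewrite ec ew ea addn1 /=; nia.
have v0 : 0 < v by lia.
have a0 : 0 < a by lia.
have le3 : a * v <= 3 by lia.
(* the line has 2 * a + 1 points, and 4 * v conjugates under 'N_G(P) *)
clear ec; case: a a0 ea ec' le3 => [|[|[|[|a]]]] // _ ea ec' le3; last by nia.
- case: v v0 ew ec' le3 => [|[|[|[|v]]]] // _ ew ec' le3; try lia.
- have ev : v = 1%N by lia.
  by subst; lia.
have ev : v = 1%N by lia.
by subst; lia.
Qed.

Lemma line_class_others A P : isline A -> P \in F A -> line_class G 8 P A \subset Om :\ P.
Proof.
move=> lA PA; apply/subsetP=> Q /(line_classP (isT : 1 < 8) min8 Q lA PA)[B [_ QB neQ]].
by rewrite in_setD1 neQ (line_Syl QB).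
Qed.

(** With lines of five points there would be two disjoint classes of sixteen
    points among 24. *)
Lemma line8_three A P : isline A -> P \in F A ->
  #|F A| = 3 /\ line_class G 8 P A = Om :\ P.
Proof.
move=> lA PA; have oP := line_Syl PA; have [_ c25] := distance8_count oP.
have cO : #|Om :\ P| = 24.
  by move: c25; rewrite (cardsD1 P) oP add1n => -[->].
have sA := line_class_others lA PA.
case: (line8_shape lA PA) => -[cF cA].
  by split=> //; apply/eqP; rewrite eqEcard sA cA cO.
have /card_gt0P[Q /setDP[/setD1P[neQ oQ] nQA]] : 0 < #|(Om :\ P) :\: line_class G 8 P A|.
  by rewrite cardsD (setIidPr sA) cA cO.
rewrite eq_sym in neQ; have [lB PB QB] := isline8 oP oQ neQ; set B := (P :&: Q)%G in lB PB QB.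
have sB := line_class_others lB PB.
have : line_class G 8 P A :|: line_class G 8 P B \subset Om :\ P by rewrite subUset sA.
move/subset_leq_card; rewrite cO cardsU cA (_ : _ :&: _ = set0).
  by rewrite cards0; case: (line8_shape lB PB) => -[_ ->].
apply/setP=> U; rewrite in_set0; apply/negP; rewrite in_setI !in_set.
case/andP=> /andP[_ UA] /andP[_ UB]; case/negP: nQA; rewrite in_set.
apply/andP; split; first by apply/Syl_atP; rewrite oQ (distance8_index oP oQ neQ).
by rewrite -(orbit_eqP UA) orbit_sym.
Qed.

Lemma line8_conj A B P : isline A -> P \in F A -> isline B -> P \in F B ->
  B \in orbit 'JG 'N_G(P) A.
Proof.
move=> lA PA lB PB.
have /card_gt0P[Q /setD1P[neQ QB]] : 0 < #|F B :\ P|.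
  by case: lB => gt1 _; move: gt1; rewrite (cardsD1 P) PB.
have [_ eA] := line8_three lA PA.
have : Q \in line_class G 8 P A by rewrite eA in_setD1 neQ (line_Syl QB).
rewrite in_set => /andP[_]; suff -> : (P :&: Q)%G = B by [].
by apply: group_inj; rewrite /= (line_cap min8 lB PB QB) // eq_sym.
Qed.

(** Joining W in F Y but not in F X to the points of F X gives lines of three
    points contained in F Y that meet only in W: a point common to two of
    them, and different from W, would put W on a line of F X. *)
Lemma subspace_double (X Y : {group gT}) : Y \subset X -> 1 < #|F X| -> F X != F Y ->
  2 * #|F X| < #|F Y|.
Proof.
move=> sYX X2 neXY; have sXY : F X \subset F Y.
  by apply/subsetP=> T /Syl_aboveP[oT sX]; apply/Syl_aboveP; rewrite (subset_trans sYX).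
have /subsetPn[W WY nWX] : ~~ (F Y \subset F X).
  by apply: contra neXY => s; rewrite eqEsubset sXY.
have neW T : T \in F X -> T != W by move=> TX; apply: contraNneq nWX => <-.
have oW := line_Syl WY.
rewrite mulnC -sum_nat_const.
rewrite (eq_bigr (fun T : {group gT} => #|F (T :&: W) :\ W|)); last first.
  move=> T TX; have [lB TB WB] := isline8 (line_Syl TX) oW (neW T TX).
  have [c3 _] := line8_three lB TB.
  by move: c3; rewrite (cardsD1 W) WB add1n => -[->].
rewrite [#|F Y|](cardsD1 W) WY add1n ltnS.
apply: sum_disjoint_le => [T TX|T U V TX UX].
  apply: setSD; apply/subsetP=> U /Syl_aboveP[oU sU]; apply/Syl_aboveP; split=> //.
  by apply: subset_trans sU; rewrite subsetI (line_sub (subsetP sXY T TX)) (line_sub WY).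
case/setD1P=> neV VT /setD1P[_ VU].
have [lT TT WT] := isline8 (line_Syl TX) oW (neW T TX).
have [lU UU WU] := isline8 (line_Syl UX) oW (neW U UX).
have eT := line_cap min8 lT VT WT neV; have eU := line_cap min8 lU VU WU neV.
apply/eqP; apply: contraT => neTU; case/negP: nWX; apply/Syl_aboveP; split=> //.
have UT : U \in F (T :&: W)%G by apply/Syl_aboveP; rewrite /= -eT eU (line_Syl UX) subsetIl.
apply: (@subset_trans _ _ (mem (T :&: U))).
  by rewrite subsetI (line_sub TX) (line_sub UX).
by rewrite (line_cap min8 lT TT UT neTU) subsetIr.
Qed.

Lemma acts_Syl_above A H : H \subset 'N_G(A) -> [acts H, on F A | 'JG].
Proof.
move=> sHN; apply/actsP=> x Hx T; exact: Syl_aboveJ (subsetP sHN x Hx).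
Qed.

Lemma Syl_above_self P : P \in Om -> F P = [set P].
Proof.
move=> oP; apply/setP=> T; apply/Syl_aboveP/set1P=> [[oT /(Syl_eq oP oT)]|->] //.
Qed.

(** The core C fixes P and the eight points of the P-orbit of a point of the
    line, and by [subspace_double] at most 12 points. As P has orbits of size
    eight on the points other than P, C fixes exactly nine. For U one of the
    six of them outside F A, the subgroup A :&: U fixes more points than A,
    hence all nine by [subspace_double], and so is equal to C. Thus the orbits
    of A on these six points all have size |A : C|. *)
Lemma core8_index A P : isline A -> P \in F A -> F (gcore A P) != Om ->
  #|A : gcore A P| <= 2.
Proof.
move=> lA PA neC; have oP := line_Syl PA; pose C := [group of gcore A P].
have sCA : C \subset A := gcore_sub A P; have nPC : P \subset 'N(C) := gcore_norm A P.
have sAP := line_sub PA; have [F3 _] := line8_three lA PA.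
have [_ c25] := distance8_count oP.
have /card_gt0P[Q /setD1P[neQ QA]] : 0 < #|F A :\ P|.
  by move: F3; rewrite (cardsD1 P) PA add1n => -[->].
have oQ := line_Syl QA; rewrite eq_sym in neQ.
have QC y : y \in P -> (Q :^ y)%G \in F C.
  move=> Py; apply/Syl_aboveP; rewrite SylJ ?(subsetP (Syl_sub oP)) //=.
  by rewrite -(normsP nPC y Py) conjSg (subset_trans sCA (line_sub QA)).
have PC : P \in F C by apply/Syl_aboveP; rewrite oP (subset_trans sCA sAP).
have f9 : 9 <= #|F C|.
  have sU : P |: orbit 'JG P Q \subset F C.
    by rewrite subUset sub1set PC; apply/subsetP=> _ /orbitP[y Py <-]; apply: QC.
  apply: leq_trans (subset_leq_card sU); rewrite cardsU1 (card_Syl_orbit oP oQ).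
  rewrite (distance8_index oP oQ neQ); case: orbitP => // -[y Py eP]; case/eqP: neQ.
  apply: group_inj; rewrite -[LHS](conjGid (groupVr Py)) -{1}eP.
  exact: conjsgK.
have d8 : 8 %| #|F C :\ P|.
  have -> : F C :\ P = F C :\: F P by rewrite (Syl_above_self oP).
  apply: (@dvdn_acts _ _ _ 'JG P).
    by apply: actsD; apply: acts_Syl_above; rewrite subsetI (Syl_sub oP) ?normG.
  move=> U /setDP[UC nUP]; rewrite (card_Syl_orbit oP (line_Syl UC)).
  rewrite (distance8_index oP (line_Syl UC)) //.
  by apply: contraNneq nUP => <-; apply/Syl_aboveP.
have f12 : 2 * #|F C| < 25.
  have e1 : F [1] = Om.
    by apply/setP=> U; apply/Syl_aboveP/idP=> [[]//|oU]; rewrite sub1G.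
  rewrite -c25 -e1; apply: (subspace_double (X := C) (Y := 1%G)); rewrite ?sub1G //.
    exact: leq_trans f9.
  by rewrite /= e1.
have f9e : #|F C| = 9.
  by move: f9 d8 f12; rewrite [#|F C|](cardsD1 P) PC add1n; clear; move: #|_ :\ _| => f; lia.
have fix8 U : U \in F C :\: F A -> A :&: U = C.
  case/setDP=> UC nUA; have sCU := line_sub UC; pose D := (A :&: U)%G.
  have sCD : C \subset D by rewrite subsetI sCA.
  have UD : U \in F D by apply/Syl_aboveP; rewrite subsetIr (line_Syl UC).
  have FD7 : 2 * 3 < #|F D|.
    rewrite -F3; apply: (subspace_double (X := A) (Y := D)); rewrite ?subsetIl ?F3 //.
    by apply: contraNneq nUA => ->.
  have eFD : F D = F C.
    apply/eqP; apply: contraT => ne.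
    have := subspace_double sCD _ ne; rewrite f9e; move: FD7; clear; move: #|_| => f.
    lia.
  apply/eqP; rewrite eqEsubset sCD andbT; apply/bigcapsP=> y Py.
  have eAy : A :^ y = P :&: Q :^ y by rewrite cap_conj // (line_cap min8 lA PA QA neQ).
  rewrite eAy subsetI (subset_trans (subsetIl _ _) sAP) /=.
  by have := QC y Py; rewrite -eFD => /line_sub.
have d6 : #|A : C| %| 6.
  have sFA : F A \subset F C.
    by apply/subsetP=> U /Syl_aboveP[oU sU]; apply/Syl_aboveP; rewrite (subset_trans sCA).
  have <- : #|F C :\: F A| = 6 by rewrite cardsD (setIidPr sFA) f9e F3.
  have sAG := subset_trans sAP (Syl_sub oP).
  apply: (@dvdn_acts _ _ _ 'JG A).
    by apply: actsD; apply: acts_Syl_above; rewrite subsetI sAG ?normG ?(subset_trans sAP).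
  move=> U UCA; rewrite card_orbit astab1JG -(fix8 U UCA).
  have oU : U \in Om by case/setDP: UCA => /line_Syl.
  suff -> : 'N_A(U) = A :&: U by [].
  apply/setP=> x; rewrite !in_setI; case Ax: (x \in A) => //=.
  apply/idP/idP=> [|/(subsetP (normG U))] //.
  exact: norm_Syl oP oU (subsetP sAP x Ax).
have /p_natP[i ei] : 2.-nat #|A : C|.
  exact: pnat_dvd (dvdn_indexg _ _) (pgroupS sAP (Syl_pgroup oP)).
move: d6; rewrite /= ei; case: i {ei} => [|[|i]] //; rewrite !expnS mulnA => /dvdnP[q]; lia.
Qed.

Hypothesis faithful : forall x, x \in G -> (forall T, T \in Om -> x \in 'N(T)) -> x = 1.

(** A non-trivial central element of P belongs to some line through P by
    redundancy, and then to the core of this line. *)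
Lemma core8_ex P : P \in Om ->
  exists2 A, isline A /\ P \in F A & #|A : gcore A P| <= 2.
Proof.
move=> oP; have ntP : P :!=: 1.
  have [U [oU neU _]] := red oP (group1 P); apply: contraNneq neU => eP.
  by rewrite eq_sym; apply/eqP/(Syl_eq oP oU); rewrite eP sub1G.
have /trivgPn[z Zz ntz] : 'Z(P) != 1.
  by rewrite (center_nil_eq1 (pgroup_nil (Syl_pgroup oP))).
have [Pz cPz] := setIP Zz; have [Q [oQ neQ Qz]] := red oP Pz.
rewrite eq_sym in neQ; have [lA PA QA] := isline8 oP oQ neQ.
exists (P :&: Q)%G => //; apply: core8_index => //.
apply: contra ntz => /eqP eF; apply/eqP/faithful; first exact: (subsetP (Syl_sub oP)).
move=> T; rewrite -eF => /Syl_aboveP[_ sCT]; apply: (subsetP (normG T)).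
apply: (subsetP sCT); rewrite -cycle_subG; apply: gcore_max.
  by rewrite cycle_subG inE Pz.
by apply: cents_norm; rewrite centsC cycle_subG.
Qed.

Lemma core8_all A P : isline A -> P \in F A -> #|A : gcore A P| <= 2.
Proof.
move=> lA PA; have [B [lB PB] le2] := core8_ex (line_Syl PA).
case/orbitP: (line8_conj lB PB lA PA) => x /setIP[Gx nPx] <- /=.
apply: leq_trans le2; rewrite -(indexJg B _ x); apply: dvdn_leq => //.
apply: indexgS; apply: gcore_max; first by rewrite conjSg gcore_sub.
by rewrite -{1}(normP nPx) normJ conjSg gcore_norm.
Qed.

(** By redundancy every x in P lies on one of the twelve lines B through P,
    and if it lies in the core of B it lies in the core of the four
    P-conjugates of B. So weights 4 for x in B outside the core, and 1 for x
    in the core, add up to at least 4 |P|. But each line contributes 4 |B| - 3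
    |C|, which by [core8_all] is at most 5/2 |B| = 5/16 |P|. *)
Lemma distance8_contra P : P \in Om -> False.
Proof.
move=> oP; have [c8 _] := distance8_count oP.
pose Lns := lines_through G 8 P.
have LnsP B : B \in Lns -> isline B /\ P \in F B.
  by move/(lines_throughP (isT : 1 < 8) min8 B oP).
have cL : #|Lns| = 12.
  have e : #|Syl_at G P 8| = (#|Lns| * 2)%N.
    by apply: card_lines_through => // B lB PB; case: (line8_three lB PB).
  by move: e; rewrite c8; clear; lia.
have sPN : P \subset 'N_G(P) by rewrite subsetI (Syl_sub oP) normG.
have aL x B : x \in P -> B \in Lns -> (B :^ x)%G \in Lns.
  by move=> Px; apply: lines_throughJ => //; apply: subsetP Px.
pose wt B x := (4 * (x \in B :\: gcore B P) + (x \in gcore B P))%N.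
have low : 4 * #|P| <= \sum_(x in P) \sum_(B in Lns) wt B x.
  rewrite mulnC -sum_nat_const; apply: leq_sum => x Px.
  have [U [oU neU Ux]] := red oP Px; set B := (P :&: U)%G.
  have LB : B \in Lns by apply: imset_f; apply/Syl_atP; rewrite distance8_index // eq_sym.
  have Bx : x \in B by rewrite inE Px.
  have [Cx|nCx] := boolP (x \in gcore B P); last first.
    by rewrite (bigD1 B) //= /wt inE nCx Bx.
  have [lB PB] := LnsP B LB; have [i4 _] := line8_index lB PB.
  have sO : orbit 'JG P B \subset Lns by apply/subsetP=> _ /orbitP[y Py <-]; apply: aL.
  have -> : 4 = \sum_(C in orbit 'JG P B) 1.
    by rewrite sum1_card card_orbit astab1JG.
  rewrite [X in _ <= X](big_setID (orbit 'JG P B)) /= (setIidPr sO).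
  apply: leq_trans (leq_addr _ _); apply: leq_sum => _ /orbitP[y Py <-].
  suff Cyx : x \in gcore (B :^ y) P by rewrite /wt /= Cyx addn1.
  apply: (subsetP _ x Cx); apply: gcore_max (gcore_norm B P).
  by rewrite -(normsP (gcore_norm B P) y Py) conjSg gcore_sub.
have up B : B \in Lns -> 3 * \sum_(x in P) wt B x < #|P|.
  move=> LB; have [lB PB] := LnsP B LB; have sCB := gcore_sub B P.
  have sum_in (X : {set gT}) : X \subset P -> \sum_(x in P) (x \in X) = #|X|.
    move=> sX; rewrite -sum1_card [RHS]big_mkcond [LHS]big_mkcond /=.
    apply: eq_bigr => x _; case Xx: (x \in X); first by rewrite (subsetP sX).
    by case: ifP.
  rewrite big_split /= -big_distrr /= !sum_in.
  - rewrite cardsD (setIidPr sCB).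
    have e := Lagrange sCB; have le2 := core8_all lB PB; have c0 := cardG_gt0 [group of gcore B P].
    have i0 := indexg_gt0 B (gcore B P).
    have eP : (#|B| * 8)%N = #|P| by case: lB => _ /(_ P PB) <-; rewrite Lagrange // (line_sub PB).
    move: e le2 i0 c0 eP; rewrite /=; clear; move: #|B : _| #|gcore _ _| #|B| #|P| => i c b p.
    move=> <-; case: i => [|[|[|i]]] //; lia.
  - by rewrite (subset_trans sCB) // (line_sub PB).
  by rewrite (subset_trans (subsetDl _ _)) // (line_sub PB).
have : 3 * \sum_(B in Lns) \sum_(x in P) wt B x < 12 * #|P|.
  have le : \sum_(B in Lns) (3 * (\sum_(x in P) wt B x) + 1) <= \sum_(B in Lns) #|P|.
    by apply: leq_sum => B LB; rewrite addn1; apply: up.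
  rewrite big_split /= -big_distrr /= !sum_nat_const cL in le.
  by apply: leq_trans le; rewrite -addn1 leq_add2l.
rewrite exchange_big /=; move: low; clear; move: (\sum_(_ in P) _) #|P| => s p; lia.
Qed.

End DistanceEight.

(** * Least distance two *)

Section DistanceTwo.

Variables (gT : finGroupType) (G : {group gT}).
Implicit Types (A B C E H K L M P Q R S T U V W X Y : {group gT}) (x y z : gT).

Local Notation Om := 'Syl_2(G).
Local Notation F := (Syl_above G).
Local Notation isline := (isline G 2).
Local Notation nb P := (Syl_at G P 2).
Local Notation lines P := (lines_through G 2 P).

Hypotheses (red : redundant G) (prim : Syl_primitive G) (le25 : #|Om| <= 25).
Hypothesis faithful : forall x, x \in G -> (forall T, T \in Om -> x \in 'N(T)) -> x = 1.

Let min2 : forall T U, T \in Om -> U \in Om -> T != U -> 2 <= #|T : U|.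
Proof. by move=> T U oT oU ne; apply: index_Syl_gt1 oT oU ne. Qed.

Let k2 : 1 < 2 := isT.

Lemma nb_sym P Q : P \in Om -> Q \in nb P -> P \in nb Q.
Proof.
move=> oP /Syl_atP[oQ iPQ]; apply/Syl_atP; split=> //.
by rewrite -(index_Syl_sym oP oQ).
Qed.

Lemma nb_Syl P Q : Q \in nb P -> Q \in Om.
Proof. by case/Syl_atP. Qed.

Lemma line2_normal A P : isline A -> P \in F A -> P \subset 'N(A).
Proof.
move=> lA PA; apply: normal_norm; apply: index2_normal; first exact: line_sub PA.
by case: lA => _ ->.
Qed.

Lemma line2_card A P : isline A -> P \in F A -> #|F A| = 3.
Proof.
move=> lA PA; have nPA := line2_normal lA PA.
have := leq_trans (normal_line_small red prim k2 min2 lA PA nPA) le25.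
have := line_semiregular min2 lA PA; rewrite (setIidPl nPA).
have -> : #|P : A| = 2 by case: lA => _ ->.
have : 1 < #|F A| by case: lA.
clear; move: #|F A| => f; case: f => [|f] // f1 /dvdnP[q ef] le.
rewrite /= in ef le; subst f; case: q f1 le => [|[|q]] //; nia.
Qed.

(** By [normal_line_bound] P has at most nine neighbours, while each
    'N_G(P)-class of lines through P accounts for at least six, because it has
    an odd number of lines, and more than one. *)
Lemma nb_class P Q : P \in Om -> Q \in nb P ->
  [/\ #|nb P| = 6, line_class G 2 P (P :&: Q)%G = nb P & 15 <= #|Om|].
Proof.
move=> oP nQ; have [lA PA QA neQ] := line_join k2 oP nQ; set A := (P :&: Q)%G in lA PA QA *.
have en : nbrs G 2 P = nb P.
  apply/setP=> U; apply/nbrsP/Syl_atP=> [[oU iU _]|[oU iU]] //.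
  by split=> //; apply: norm_cap_index2.
have bound := normal_line_bound k2 min2 lA PA (line2_normal lA PA).
rewrite en (line2_card lA PA) in bound.
have cls B : isline B -> P \in F B ->
    line_class G 2 P B \subset nb P /\ 6 <= #|line_class G 2 P B|.
  move=> lB PB; split; first by apply/subsetP=> U; rewrite in_set => /andP[].
  rewrite card_line_class // (line2_card lB PB).
  have := odd_norm_index lB PB (line2_normal lB PB).
  have := line_count_gt1 red prim k2 min2 lB PB.
  by clear; move: #|_ : _| => w; case: w => [|[|[|w]]] //= _ _; lia.
have [sA cA] := cls A lA PA.
have v9 : #|nb P| <= 9 by move: bound le25; clear; lia.
have eC : line_class G 2 P A = nb P.
  apply/eqP; rewrite eqEsubset sA; apply/subsetP=> U nU; apply: contraT => nUA.
  have [lB PB UB neU] := line_join k2 oP nU; set B := (P :&: U)%G in lB PB UB.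
  have [sB cB] := cls B lB PB.
  have : #|line_class G 2 P A :|: line_class G 2 P B| <= #|nb P|.
    by apply: subset_leq_card; rewrite subUset sA.
  rewrite cardsU (_ : _ :&: _ = set0); first by rewrite cards0; move: v9 cA cB; clear; lia.
  apply/setP=> V; rewrite in_set0; apply/negP; rewrite in_setI !in_set.
  case/andP=> /andP[_ VA] /andP[_ VB]; case/negP: nUA; rewrite in_set.
  by apply/andP; split; rewrite // -(orbit_eqP VA) orbit_sym.
have ow := odd_norm_index lA PA (line2_normal lA PA).
have := card_line_class k2 min2 lA PA; rewrite eC (line2_card lA PA) /= => cC.
rewrite eC in cA; have c6 : #|nb P| = 6.
  move: cA v9 cC ow; clear; move: #|_ : _| #|_| => w v; case: w => [|[|[|[|[|w]]]]] //; lia.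
by split=> //; move: bound; rewrite c6.
Qed.

(** 'N_G(P) permutes the lines through P transitively, and P exchanges the two
    other points of each of them. *)
Lemma nb_trans P Q U : P \in Om -> Q \in nb P -> U \in nb P ->
  exists2 x, x \in 'N_G(P) & U = (Q :^ x)%G.
Proof.
move=> oP nQ nU; have [_ eC _] := nb_class oP nQ.
have [lA PA QA neQ] := line_join k2 oP nQ; have oQ := nb_Syl nQ.
move: nU; rewrite -eC in_set => /andP[nU /orbitP[x nx eA]].
have /setIP[Gx nPx] := nx; have [lB PB UB neU] := line_join k2 oP nU.
have eP : (P :^ x)%G = P by apply/group_inj/normP.
have neQx : (Q :^ x)%G != P.
  by rewrite -eP (inj_eq (act_inj 'JG x)).
have QxB : (Q :^ x)%G \in F (P :&: U)%G.
  by rewrite -eA; apply/Syl_aboveP; rewrite SylJ //= conjSg (line_sub QA).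
have sPN : P \subset 'N_G(P) by rewrite subsetI (Syl_sub oP) normG.
have sO : orbit 'JG P (Q :^ x)%G \subset F (P :&: U) :\ P.
  apply/subsetP=> _ /orbitP[y Py <-]; have Gy := subsetP (Syl_sub oP) y Py.
  rewrite in_setD1 Syl_aboveJ ?QxB ?andbT; last first.
    by rewrite inE Gy (subsetP (line2_normal lB PB)).
  apply: contra neQx => /eqP e; have := congr1 (fun R : {group gT} => (R :^ y^-1)%G) e => /= e'.
  apply/eqP/group_inj; move/(congr_group): e' => /=; rewrite conjsgK => ->.
  by rewrite conjGid ?groupV.
have : U \in orbit 'JG P (Q :^ x)%G.
  have -> : orbit 'JG P (Q :^ x)%G = F (P :&: U) :\ P.
    apply/eqP; rewrite eqEcard sO /=.
    have oQx : (Q :^ x)%G \in Om by rewrite SylJ.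
    rewrite (card_Syl_orbit oP oQx).
    have -> : #|P : (Q :^ x)%G| = 2.
      by rewrite -{1}eP /= indexJg; case/Syl_atP: nQ.
    by have := line2_card lB PB; rewrite (cardsD1 P) PB add1n => -[->].
  by rewrite in_setD1 neU.
case/orbitP=> y Py <-; exists (x * y).
  by rewrite groupM // (subsetP sPN).
by apply: group_inj; rewrite /= conjsgM.
Qed.

Lemma nb_triangle P Q U : P \in Om -> Q \in nb P -> U \in nb P -> U \in nb Q ->
  U \in F (P :&: Q)%G.
Proof.
move=> oP nQ nU nUQ; have [oQ iQ] := Syl_atP nQ; have [oU iU] := Syl_atP nU.
apply/Syl_aboveP; split=> //; apply: (no_triangle oP oQ oU iQ).
  by rewrite (index_Syl_sym oU oP).
by have [_ <-] := Syl_atP nUQ; rewrite (index_Syl_sym oU oQ).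
Qed.

(** The subgroup of P fixing all the neighbours of P. *)
Definition nb_core P := (\bigcap_(Q in nb P) (P :&: Q))%G.

Lemma nb_core_sub P Q : Q \in nb P -> nb_core P \subset P :&: Q.
Proof. by move=> nQ; apply: bigcap_inf nQ. Qed.

Lemma nbJ P Q x : x \in 'N_G(P) -> ((Q :^ x)%G \in nb P) = (Q \in nb P).
Proof.
case/setIP=> Gx nPx; apply/Syl_atP/Syl_atP; rewrite SylJ //=.
  by rewrite -{1}(normP nPx) indexJg.
by rewrite -{2}(normP nPx) indexJg.
Qed.

Lemma nb_core_norm P : 'N_G(P) \subset 'N(nb_core P).
Proof.
apply/subsetP=> x nx; rewrite inE; apply/bigcapsP=> Q nQ.
have nV : x^-1 \in 'N_G(P) by rewrite groupV.
have nQ' : (Q :^ x^-1)%G \in nb P by rewrite nbJ.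
rewrite sub_conjg; apply: subset_trans (nb_core_sub nQ') _.
by case/setIP: nV => _ /normP eP; rewrite conjIg /= eP.
Qed.

Lemma nb_card P Q : P \in Om -> Q \in nb P -> #|nb P| = 6.
Proof. by move=> oP nQ; case: (nb_class oP nQ). Qed.

(** By [nb_triangle] these points are not neighbours of P. *)
Definition far P Q := nb Q :\: F (P :&: Q).

Definition far_moved P Q := [set U in far P Q | ~~ (nb_core P \subset gval U)].

Lemma far_movedP P Q U :
  reflect (U \in far P Q /\ ~~ (nb_core P \subset U)) (U \in far_moved P Q).
Proof. by rewrite [X in reflect _ X]in_set; apply: andP. Qed.

Section Far.

Variables (P Q : {group gT}).
Hypotheses (oP : P \in Om) (nQ : Q \in nb P).

Let oQ : Q \in Om := nb_Syl nQ.
Let lPQ : isline (P :&: Q)%G. Proof. by case: (line_join k2 oP nQ). Qed.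
Let PPQ : P \in F (P :&: Q)%G. Proof. by case: (line_join k2 oP nQ). Qed.
Let QPQ : Q \in F (P :&: Q)%G. Proof. by case: (line_join k2 oP nQ). Qed.
Let neQP : Q != P. Proof. by case: (line_join k2 oP nQ). Qed.
Let nP : P \in nb Q := nb_sym oP nQ.

Lemma line_pts_nb A : isline A -> Q \in F A -> F A :\ Q \subset nb Q.
Proof.
move=> lA QA; apply/subsetP=> U /setD1P[neU UA].
exact: (line_Syl_at min2 lA QA UA neU).
Qed.

Lemma card_line_pts A : isline A -> Q \in F A -> #|F A :\ Q| = 2.
Proof.
by move=> lA QA; have := line2_card lA QA; rewrite (cardsD1 Q) QA add1n => -[->].
Qed.

Lemma card_far : #|far P Q| = 4.
Proof.
rewrite cardsD (nb_card oQ nP).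
suff -> : nb Q :&: F (P :&: Q) = F (P :&: Q) :\ Q by rewrite (card_line_pts lPQ QPQ).
apply/setP=> U; rewrite in_setI in_setD1 andbC; case UA: (U \in F (P :&: Q)); rewrite ?andbF //= andbT.
apply/idP/idP=> [/Syl_atP[_]|neU]; first by apply: contra_eqN => /eqP->; rewrite indexgg.
by apply: (subsetP (line_pts_nb lPQ QPQ)); rewrite in_setD1 neU.
Qed.

Lemma far_off U : U \in far P Q -> U \in Om :\: (P |: nb P).
Proof.
case/setDP=> nU nUA; rewrite in_setD (nb_Syl nU) andbT; apply/negP=> /setU1P[eU|nUP].
  by rewrite eU PPQ in nUA.
by case/negP: nUA; apply: nb_triangle oP nQ nUP nU.
Qed.

Lemma far_line U : U \in far P Q -> F (Q :&: U) :\ Q \subset far P Q.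
Proof.
case/setDP=> nU nUA; have [lB QB UB neU] := line_join k2 oQ nU.
apply/subsetP=> V VB; have nV := subsetP (line_pts_nb lB QB) V VB.
rewrite in_setD nV andbT; apply: contra nUA => VA.
case/setD1P: VB => neV VB; rewrite eq_sym in neV.
by rewrite -(line_cap min2 lPQ QPQ VA neV) (line_cap min2 lB QB VB neV).
Qed.

(** Otherwise Q, Q' and U are on one line, and since P, Q and Q' are pairwise
    neighbours, this line contains P. *)
Lemma far_common Q' U : Q' \in nb P -> Q' != Q -> U \in far P Q -> U \in nb Q' ->
  Q :&: U != Q' :&: U.
Proof.
move=> nQ' ne /setDP[nU nUA] nU'; apply/eqP=> eI.
have [lB QB UB neU] := line_join k2 oQ nU.
have Q'B : Q' \in F (Q :&: U)%G.
  by apply/Syl_aboveP; rewrite /= eI subsetIl (nb_Syl nQ').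
have nQQ' : Q' \in nb Q by apply: (subsetP (line_pts_nb lB QB)); rewrite in_setD1 ne.
have Q'A := nb_triangle oP nQ nQ' nQQ'.
rewrite eq_sym in ne; case/negP: nUA.
by rewrite -(line_cap min2 lPQ QPQ Q'A ne) (line_cap min2 lB QB Q'B ne).
Qed.

Lemma nb_core_sub_nb : nb_core P \subset Q.
Proof. by apply: subset_trans (nb_core_sub nQ) (subsetIr _ _). Qed.

Lemma nb_core_norm_line A : isline A -> Q \in F A -> nb_core P \subset 'N(A).
Proof. by move=> lA QA; apply: subset_trans nb_core_sub_nb (line2_normal lA QA). Qed.

Lemma nb_core_pgroup : 2.-group (nb_core P).
Proof. exact: pgroupS nb_core_sub_nb (Syl_pgroup oQ). Qed.

Lemma nb_core_subG : nb_core P \subset G.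
Proof. exact: subset_trans nb_core_sub_nb (Syl_sub oQ). Qed.

End Far.

(** If U had a second neighbour Q' in common with P, [nb_core P] would
    normalise the distinct lines Q :&: U and Q' :&: U, and fix their common
    point U. *)
Lemma far_moved_uniq P Q Q' U : P \in Om -> Q \in nb P -> Q' \in nb P ->
  U \in far_moved P Q -> U \in nb Q' -> Q' = Q.
Proof.
move=> oP nQ nQ' /far_movedP[UQ nU] nUQ'; apply/eqP; apply: contraT => ne.
have /setDP[nUQ _] := UQ.
have [lB QB UB _] := line_join k2 (nb_Syl nQ) nUQ.
have [lB' QB' UB' _] := line_join k2 (nb_Syl nQ') nUQ'.
have nB := nb_core_norm_line nQ lB QB; have nB' := nb_core_norm_line nQ' lB' QB'.
have := line_norm_fix min2 lB lB' (nb_core_subG nQ) (nb_core_pgroup nQ) nB nB' UB UB'.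
rewrite (negPf nU) /= => /eqP/(congr_group) /= eI.
by case/eqP: (far_common oP nQ nQ' ne UQ nUQ').
Qed.

Lemma card_far_moved_even P Q : P \in Om -> Q \in nb P -> 2 %| #|far_moved P Q|.
Proof.
move=> oP nQ; have oQ := nb_Syl nQ.
have [_ PA _ _] := line_join k2 oP nQ.
have sDQ := nb_core_sub_nb nQ; have sDP := subset_trans (nb_core_sub nQ) (subsetIl P Q).
have nDPQ x : x \in nb_core P -> (P :^ x)%G = P /\ (Q :^ x)%G = Q.
  move=> Dx; split; apply: group_inj; apply: conjGid.
    exact: subsetP sDP x Dx.
  exact: subsetP sDQ x Dx.
apply: (@dvdn_acts _ _ _ 'JG (nb_core P)).
  suff aB x U : x \in nb_core P -> U \in far_moved P Q -> (U :^ x)%G \in far_moved P Q.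
    apply/actsP=> x Dx U /=; apply/idP/idP=> [UB|]; last exact: aB.
    by rewrite -[U](actK 'JG x) /= aB // groupV.
  move=> Dx /far_movedP[/setDP[nU nUA] nDU]; have [eP eQ] := nDPQ x Dx.
  have NQx : x \in 'N_G(Q).
    by rewrite inE (subsetP (nb_core_subG nQ)) //= (subsetP (normG Q)) // (subsetP sDQ).
  have NAx : x \in 'N_G(P :&: Q).
    rewrite inE (subsetP (nb_core_subG nQ)) //=.
    by apply: (subsetP (normG (P :&: Q)%G)); apply: (subsetP (nb_core_sub nQ)).
  apply/far_movedP; split; first by rewrite in_setD nbJ // nU andbT Syl_aboveJ.
  apply: contra nDU => s; rewrite -(conjSg _ _ x); apply: subset_trans s.
  by rewrite /= conjGid.
move=> U /far_movedP[/setDP[nU nUA] nDU]; have oU := nb_Syl nU.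
rewrite card_orbit astab1JG.
have pD := nb_core_pgroup nQ.
have /p_natP[[|i] e] : 2.-nat #|nb_core P : 'N_(nb_core P)(U)|.
- exact: pnat_dvd (dvdn_indexg _ _) pD.
- case/negP: nDU; move/eqP: e; rewrite indexg_eq1 => /subsetIP[_ nDU].
  exact: Syl_norm oU pD (nb_core_subG nQ) nDU.
by rewrite e expnS dvdn_mulr.
Qed.

(** Lines have three points. *)
Lemma line3_fix A T U W x : isline A -> T \in F A -> U \in F A -> T != U -> W \in F A ->
  x \in 'N_G(A) -> x \in 'N(T) -> x \in 'N(U) -> x \in 'N(W).
Proof.
move=> lA TA UA neTU WA nAx /normP eT /normP eU.
have [->|neWT] := eqVneq W T; first exact/normP.
have [->|neWU] := eqVneq W U; first exact/normP.
have WxA : (W :^ x)%G \in F A by rewrite Syl_aboveJ.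
have eF : F A = W |: [set T; U].
  apply/eqP; rewrite eq_sym eqEcard (line2_card lA TA) cardsU1 cards2 neTU.
  rewrite in_set2 negb_or neWT neWU /= andbT !subUset !sub1set.
  by apply/and3P.
have cJ V : V :^ x = V -> W != V -> (W :^ x)%G != V.
  move=> eV; apply: contra => /eqP/(congr_group) /= e; apply/eqP/group_inj.
  by apply: (@conjsg_inj _ x); rewrite e eV.
move: WxA; rewrite eF in_setU1 in_set2 (negPf (cJ T eT neWT)) (negPf (cJ U eU neWU)) orbF.
by rewrite orbF => /eqP/(congr_group) /= e; apply/normP.
Qed.

Lemma card_far_moved P Q Q' : P \in Om -> Q \in nb P -> Q' \in nb P ->
  #|far_moved P Q| = #|far_moved P Q'|.
Proof.
move=> oP; suff le R R' : R \in nb P -> R' \in nb P -> #|far_moved P R| <= #|far_moved P R'|.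
  by move=> nQ nQ'; apply/eqP; rewrite eqn_leq !le.
move=> nR nR'; have [x nx ->] := nb_trans oP nR nR'; have [Gx nPx] := setIP nx.
rewrite -(card_imset (mem (far_moved P R)) (act_inj 'JG x)); apply: subset_leq_card.
apply/subsetP=> _ /imsetP[U /far_movedP[/setDP[/Syl_atP[oU iU] nUA] nDU] ->] /=.
have eA : P :&: R :^ x = (P :&: R) :^ x by rewrite conjIg (normP nPx).
apply/far_movedP; split; last first.
  by rewrite -(normsP (nb_core_norm P) x nx) /= conjSg.
rewrite in_setD; apply/andP; split; last first.
  by apply/Syl_atP; rewrite SylJ //= indexJg.
apply: contra nUA => /Syl_aboveP[_]; rewrite /= eA conjSg => sU.
exact/Syl_aboveP.
Qed.

Lemma Om_le23 P Q : P \in Om -> Q \in nb P -> #|Om| <= 23.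
Proof.
move=> oP nQ; have := card_Syl_split oP le25; rewrite (nb_card oP nQ).
have := dvdn_Syl_at 4 oP; have := dvdn_Syl_at 8 oP; have := dvdn_Syl_at 16 oP.
have := odd_card_Syl G; have := le25; clear.
move: #|Om| #|_| #|_| #|_| => n a b c; move=> le _ /dvdnP[q ->] /dvdnP[r ->] /dvdnP[s ->]; lia.
Qed.

(** So [nb_core P] fixes the neighbours of the neighbours of P. The number of
    points of [far P Q] that it moves is even, and the same for the six
    neighbours Q. The sets of moved points are disjoint for different Q, and
    there are at most sixteen points apart from P and its neighbours; so this
    number is 0 or 2. If it is 2, at most four of these sixteen points are not
    moved, and [far P Q] contains two of them, on a line with Q. The six pairs
    obtained in this way are distinct, so they are all the pairs from a set of
    four points; these four points are pairwise neighbours, hence on one line.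
    *)
Lemma far_moved0 P Q : P \in Om -> Q \in nb P -> far_moved P Q = set0.
Proof.
move=> oP nQ; apply/eqP; rewrite -cards_eq0; apply: contraT => ne0.
pose S := Om :\: (P |: nb P).
have c16 : #|S| <= 16.
  have sN : P |: nb P \subset Om.
    by rewrite subUset sub1set oP; apply/subsetP=> U /nb_Syl.
  rewrite cardsD (setIidPr sN) cardsU1 (nb_card oP nQ).
  have -> : P \notin nb P by apply/negP=> /Syl_atP[_]; rewrite indexgg.
  by have := Om_le23 oP nQ; clear; lia.
pose M := \bigcup_(R in nb P) far_moved P R.
have sMS : M \subset S.
  apply/bigcupsP=> R nR; apply/subsetP=> U /far_movedP[UR _].
  by have := far_off oP nR UR.
have cM : 6 * #|far_moved P Q| <= #|M|.
  rewrite -(nb_card oP nQ) -sum_nat_const.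
  rewrite (eq_bigr (fun R => #|far_moved P R|)) => [|R nR]; last exact: card_far_moved.
  apply: sum_disjoint_le => [R nR|R R' U nR nR' UR /far_movedP[/setDP[nU _] _]].
    exact: bigcup_sup.
  by rewrite (far_moved_uniq oP nR nR' UR nU).
have b2 : #|far_moved P Q| = 2.
  have := card_far_moved_even oP nQ; have := subset_leq_card sMS.
  by move: c16 cM ne0; clear; lia.
have cY : #|S :\: M| <= 4.
  rewrite cardsD (setIidPr sMS); move: c16 cM; rewrite b2; clear; lia.
set Y := S :\: M in cY; pose good R := far P R :\: far_moved P R.
have goodP R U : reflect (U \in far P R /\ nb_core P \subset U) (U \in good R).
  rewrite [X in reflect _ X]in_setD; apply: (iffP andP) => [[nU UR]|[UR sU]].
    by split=> //; apply: contraR nU => nU; apply/far_movedP.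
  by split=> //; apply/far_movedP => -[_]; rewrite sU.
have goodY R : R \in nb P -> good R \subset Y.
  move=> nR; apply/subsetP=> U /goodP[UR sU]; rewrite in_setD (far_off oP nR UR) andbT.
  by apply/bigcupP=> -[T nT /far_movedP[_]]; rewrite sU.
have cg R : R \in nb P -> #|good R| = 2.
  move=> nR; have sm : far_moved P R \subset far P R by apply/subsetP=> U /far_movedP[].
  by rewrite cardsD (setIidPr sm) (card_far oP nR) (card_far_moved oP nR nQ) b2.
have goodL R V : R \in nb P -> V \in good R -> good R = F (R :&: V) :\ R.
  move=> nR gV; have /goodP[VR sV] := gV; have /setDP[nV _] := VR.
  have oR := nb_Syl nR; have [lB RB VB neV] := line_join k2 oR nV.
  apply/eqP; rewrite eq_sym eqEcard cg // (card_line_pts lB RB) leqnn andbT.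
  apply/subsetP=> W WB; apply/goodP; split; first exact: subsetP (far_line oP nR VR) W WB.
  have /setD1P[_ {}WB] := WB; have oW := line_Syl WB.
  apply: Syl_norm oW (nb_core_pgroup nR) (nb_core_subG nR) _.
  apply/subsetP=> x Dx; rewrite eq_sym in neV.
  apply: (line3_fix lB RB VB neV WB).
  - rewrite inE (subsetP (nb_core_subG nR)) //.
    exact: subsetP (nb_core_norm_line nR lB RB) x Dx.
  - exact: subsetP (normG R) x (subsetP (nb_core_sub_nb nR) x Dx).
  exact: subsetP (normG V) x (subsetP sV x Dx).
have ginj : {in nb P &, injective good}.
  move=> R R' nR nR' eg; apply/eqP; apply: contraT => neR.
  have /card_gt0P[V gV] : 0 < #|good R| by rewrite cg.
  have /card_gt0P[W /setD1P[neW gW]] : 0 < #|good R :\ V|.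
    by have := cg R nR; rewrite (cardsD1 V) gV add1n => -[->].
  have gV' : V \in good R' by rewrite -eg.
  have gW' : W \in good R' by rewrite -eg.
  have line T : T \in nb P -> V \in good T -> W \in good T -> T :&: V = V :&: W.
    move=> nT gVT; rewrite (goodL T V nT gVT) => /setD1P[_ WB].
    have /goodP[/setDP[nV _] _] := gVT; have [lB _ VB _] := line_join k2 (nb_Syl nT) nV.
    by rewrite (line_cap min2 lB VB WB) // eq_sym.
  have /goodP[VR _] := gV; have /goodP[/setDP[nV _] _] := gV'.
  have := far_common oP nR nR'; rewrite eq_sym => /(_ V neR VR nV).
  by rewrite (line R nR gV gW) (line R' nR' gV' gW') eqxx.
pose X := [set A : {set {group gT}} | A \subset Y & #|A| == 2].
have sX : good @: nb P \subset X.
  by apply/subsetP=> _ /imsetP[R nR ->]; rewrite inE goodY //= cg.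
have c6 : #|good @: nb P| = 6 by rewrite card_in_imset // (nb_card oP nQ).
have := subset_leq_card sX; rewrite c6 cards_draws => le6.
have Y4 : #|Y| = 4.
  by move: cY le6; clear; move: #|Y| => [|[|[|[|[|y]]]]].
have eX : good @: nb P = X by apply/eqP; rewrite eqEcard sX c6 cards_draws Y4.
have adj V W : V \in Y -> W \in Y -> V != W -> W \in nb V.
  move=> YV YW ne; have : [set V; W] \in X.
    by rewrite inE subUset !sub1set YV YW cards2 ne.
  rewrite -eX => /imsetP[R nR eg].
  have gV : V \in good R by rewrite -eg set21.
  have : W \in good R by rewrite -eg set22.
  rewrite (goodL R V nR gV) => /setD1P[neW WB].
  have /goodP[/setDP[nV _] _] := gV; have [lB _ VB _] := line_join k2 (nb_Syl nR) nV.
  by apply: (line_Syl_at min2 lB VB WB); rewrite eq_sym.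
have /card_gt0P[V YV] : 0 < #|Y| by rewrite Y4.
have /card_gt0P[W /setD1P[neW YW]] : 0 < #|Y :\ V|.
  by move: Y4; rewrite (cardsD1 V) YV add1n => -[->].
rewrite eq_sym in neW; have oV : V \in Om by case/setDP: YV => /setDP[].
have nW := adj V W YV YW neW; have [lB VB WB _] := line_join k2 oV nW.
have : Y \subset F (V :&: W).
  apply/subsetP=> U YU; have [->//|neUV] := eqVneq U V.
  have [->//|neUW] := eqVneq U W; rewrite eq_sym in neUV; rewrite eq_sym in neUW.
  by apply: nb_triangle => //; apply: adj.
by move/subset_leq_card; rewrite Y4 (line2_card lB VB).
Qed.

Hypothesis nb_ex : forall P, P \in Om -> exists Q, Q \in nb P.

(** The normaliser of K contains the maximal subgroups 'N_G(P) and 'N_G(Q), so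
    K is normal in G, and it fixes all points because it fixes P. *)
Lemma normal_kernel P Q K : P \in Om -> Q \in Om -> P != Q ->
    K \subset 'N_G(P) -> 'N_G(P) \subset 'N(K) -> 'N_G(Q) \subset 'N(K) -> K :=: 1.
Proof.
move=> oP oQ ne /subsetIP[sKG nKP] nPK nQK.
have sN : 'N_G(P) \subset 'N_G(K) by rewrite subsetI subsetIl.
case: (prim oP sN (subsetIl _ _)) => /= eN; last first.
  case/eqP: ne; apply/esym/(Syl_eq oQ oP)/(Syl_norm oP (Syl_pgroup oQ) (Syl_sub oQ)).
  suff : Q \subset 'N_G(P) by case/subsetIP.
  rewrite -eN subsetI (Syl_sub oQ) (subset_trans _ nQK) //.
  by rewrite subsetI (Syl_sub oQ) normG.
apply/trivgP/subsetP=> x Kx; apply/set1P/faithful; first exact: subsetP sKG x Kx.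
move=> T oT; have [g Gg ->] := Syl_conj oP oT.
have : g \in 'N_G(K) by rewrite eN.
case/setIP=> _ /normP eK; rewrite /= normJ mem_conjg (subsetP nKP) //.
by rewrite -mem_conjg eK.
Qed.

Lemma nb_core_sub_nbs P Q : P \in Om -> Q \in nb P -> nb_core P \subset nb_core Q.
Proof.
move=> oP nQ; apply/bigcapsP=> U nU; rewrite subsetI (nb_core_sub_nb nQ) /=.
have [UA|nUA] := boolP (U \in F (P :&: Q)).
  by apply: subset_trans (nb_core_sub nQ) (line_sub UA).
have Uf : U \in far P Q by rewrite inE nUA.
apply: contraT => nDU; have : U \in far_moved P Q by apply/far_movedP.
by rewrite (far_moved0 oP nQ) inE.
Qed.

(** Since [nb_core P] fixes the neighbours of Q, it is equal to [nb_core Q],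
    and [normal_kernel] applies. *)
Lemma nb_core1 P : P \in Om -> nb_core P :=: 1.
Proof.
move=> oP; have [Q nQ] := nb_ex oP; have oQ := nb_Syl nQ.
have eD : nb_core P :=: nb_core Q.
  apply/eqP; rewrite eqEsubset !nb_core_sub_nbs //.
  exact: nb_sym.
have [_ _ _ ne] := line_join k2 oP nQ; rewrite eq_sym in ne.
apply: (@normal_kernel P Q (nb_core P) oP oQ ne).
- rewrite subsetI (nb_core_subG nQ).
  exact: subset_trans (nb_core_sub nQ) (subset_trans (subsetIl _ _) (normG P)).
- exact: nb_core_norm.
by have := @nb_core_norm Q; rewrite -eD.
Qed.

Lemma nb_sep P x : P \in Om -> x \in P -> (forall Q, Q \in nb P -> x \in Q) -> x = 1.
Proof.
move=> oP Px nx; have : x \in nb_core P.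
  by apply/bigcapP=> Q nQ; rewrite inE Px nx.
by rewrite (nb_core1 oP) => /set1P.
Qed.

Lemma index_nb P Q : Q \in nb P -> #|P : P :&: Q| = 2.
Proof. by case/Syl_atP=> _ <-; rewrite indexgI. Qed.

Lemma nb_mul P Q x y : Q \in nb P -> x \in P -> y \in P ->
  (x * y \in Q) = ((x \in Q) == (y \in Q)).
Proof.
move=> nQ Px Py; have := index2_mul (subsetIl P Q) (index_nb nQ) Px Py.
by rewrite !in_setI (groupM Px Py) Px Py.
Qed.

Lemma Syl_sqr1 P x : P \in Om -> x \in P -> x ^+ 2 = 1.
Proof.
move=> oP Px; apply: (nb_sep oP); first by rewrite groupX.
by move=> Q nQ; rewrite expgS expg1 (nb_mul nQ) // eqxx.
Qed.

Lemma Syl_abelian P : P \in Om -> abelian P.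
Proof.
move=> oP; apply: (@abelem_abelian _ 2); apply: exponent2_abelem; apply/exponentP=> x.
exact: Syl_sqr1.
Qed.

(** Suppose that x is on no line through P. The product of two such elements
    fixes all the neighbours of P, so x is unique and 'N_G(P) centralises it.
    A second point containing x is abelian and also centralises x, so by
    maximality of 'N_G(P) all of G does, and x belongs to all points. *)
Lemma nb_cover P x : P \in Om -> x \in P -> exists2 Q, Q \in nb P & x \in Q.
Proof.
move=> oP Px; apply/exists_inP; apply: contraT; rewrite negb_exists_in => /forall_inP nx.
have uz z : z \in P -> (forall Q, Q \in nb P -> z \notin Q) -> z = x.
  move=> Pz nz; apply: (mulIg x); rewrite [RHS](_ : _ = 1); last first.
    by have := Syl_sqr1 oP Px; rewrite expgS expg1.
  apply: (nb_sep oP) => [|Q nQ]; first exact: groupM.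
  by rewrite (nb_mul nQ) // (negPf (nx Q nQ)) (negPf (nz Q nQ)).
have cN : 'N_G(P) \subset 'C_G[x].
  apply/subsetP=> g ng; have [Gg nPg] := setIP ng; rewrite inE Gg; apply/cent1P.
  have e : x ^ g = x.
    apply: uz; first by rewrite memJ_norm.
    move=> Q nQ; rewrite -mem_conjgV; have := nx (Q :^ g^-1)%G; apply.
    by rewrite nbJ // groupV.
  by rewrite /commute -{1}e -conjgC.
have [Q [oQ neQ Qx]] := red oP Px.
case: (prim oP cN (subsetIl _ _)) => /= eC; last first.
  case/eqP: neQ; apply: (Syl_eq oQ oP); apply: (Syl_norm oP (Syl_pgroup oQ) (Syl_sub oQ)).
  suff : Q \subset 'N_G(P) by case/subsetIP.
  rewrite -eC subsetI (Syl_sub oQ) sub_cent1.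
  exact: subsetP (Syl_abelian oQ) x Qx.
have [R nR] := nb_ex oP; have oR := nb_Syl nR; have [g Gg eR] := Syl_conj oP oR.
case/negP: (nx R nR); rewrite eR /= mem_conjg.
have : g^-1 \in 'C_G[x] by rewrite eC groupV.
by case/setIP=> _ /cent1P c; rewrite /conjg -c mulKg.
Qed.

Lemma card_lines_through3 P : P \in Om -> #|lines P| = 3.
Proof.
move=> oP; have [Q nQ] := nb_ex oP.
have : #|nb P| = (#|lines P| * 2)%N.
  by apply: card_lines_through => // B; apply: line2_card.
by rewrite (nb_card oP nQ); clear; lia.
Qed.

Lemma lines_cover P x : P \in Om -> x \in P -> exists2 A, A \in lines P & x \in A.
Proof.
move=> oP Px; have [Q nQ Qx] := nb_cover oP Px.
by exists (P :&: Q)%G; [apply: imset_f | rewrite inE Px].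
Qed.

Lemma line_through_index P A : P \in Om -> A \in lines P ->
  A \subset P /\ #|P : A| = 2.
Proof.
move=> oP /(lines_throughP (isT : 1 < 2) min2 A oP)[lA PA].
by split; [apply: line_sub PA | case: lA => _ ->].
Qed.

(** Let x be in A and B but not in the third line C. For p outside A and B,
    both p and p * x are outside A and B; so they are in C, and x is too. *)
Lemma lines_meet1 P A B : P \in Om -> A \in lines P ->
  B \in lines P -> A != B -> A :&: B = 1.
Proof.
move=> oP LA LB ne; apply/trivgP/subsetP=> x /setIP[Ax Bx]; rewrite inE.
have [sAP iA] := line_through_index oP LA; have [sBP iB] := line_through_index oP LB.
apply: contraT => ntx; have Px := subsetP sAP x Ax.
have [C LC nCx] : exists2 C, C \in lines P & x \notin C.
  apply/exists_inP; apply: contraR ntx; rewrite negb_exists_in => /forall_inP nx.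
  apply/eqP/(nb_sep oP Px) => Q nQ.
  have : (P :&: Q)%G \in lines P by apply: imset_f.
  by move/nx; rewrite negbK => /setIP[].
have [neA neB] : C != A /\ C != B.
  by split; apply: contraNneq nCx => ->.
have eL : lines P = C |: [set A; B].
  apply/eqP; rewrite eq_sym eqEcard (card_lines_through3 oP) cardsU1 cards2 ne.
  rewrite in_set2 negb_or neA neB /= andbT !subUset !sub1set.
  by apply/and3P.
have inC y : y \in P -> y \notin A -> y \notin B -> y \in C.
  move=> Py nA nB; have [E LE Ey] := lines_cover oP Py.
  move: LE Ey; rewrite eL in_setU1 in_set2 => /or3P[] /eqP-> //.
    by rewrite (negPf nA).
  by rewrite (negPf nB).
have /subsetPn[p Pp] : ~~ (P \subset A :|: B).
  by apply/negP=> /sub_union_group; rewrite -!indexg_eq1 iA iB.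
rewrite inE => /norP[nAp nBp]; case/negP: nCx.
have Cp := inC p Pp nAp nBp.
have : p * x \in C by apply: inC; [apply: groupM | rewrite groupMr | rewrite groupMr].
by rewrite groupMl.
Qed.

Lemma card_Syl4 P : P \in Om -> #|P| = 4.
Proof.
move=> oP; have c3 := card_lines_through3 oP.
have /card_gt0P[A LA] : 0 < #|lines P| by rewrite c3.
have /card_gt0P[B /setD1P[ne LB]] : 0 < #|lines P :\ A|.
  by move: c3; rewrite (cardsD1 A) LA add1n => -[->].
have [sAP iA] := line_through_index oP LA; have [sBP iB] := line_through_index oP LB.
have nA : A <| P by apply: index2_normal.
have nBA : ~~ (B \subset A).
  apply: contra ne => sBA; rewrite -val_eqE eqEcard sBA /=.
  have := Lagrange sAP; rewrite -(Lagrange sBP) iA iB => /eqP.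
  by rewrite eqn_pmul2r // => /eqP->.
have := index2_meet nA iA sBP nBA; rewrite -indexgI (lines_meet1 oP LB LA ne) indexg1.
by rewrite -(Lagrange sBP) iB => ->.
Qed.

Lemma card_line_through P A : P \in Om -> A \in lines P -> #|A| = 2.
Proof.
move=> oP LA; have [sAP iA] := line_through_index oP LA.
by have := Lagrange sAP; rewrite iA (card_Syl4 oP); clear; lia.
Qed.

Lemma acts_line P A H : A \in lines P -> P \in Om ->
  H \subset 'N_G(P) -> H \subset 'N(A) -> [acts H, on F A :\ P | 'JG] /\ #|F A :\ P| <= 2.
Proof.
move=> LA oP /subsetIP[sHG nHP] nHA.
have [lA PA] := lines_throughP (isT : 1 < 2) min2 A oP LA; split; last first.
  by have := line2_card lA PA; rewrite (cardsD1 P) PA add1n => -[->].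
apply/actsP=> x Hx T; have eP : (P :^ x)%G = P by apply/group_inj/normP/(subsetP nHP).
rewrite !in_setD1 /= Syl_aboveJ ?in_setI ?(subsetP nHA) ?(subsetP sHG) //.
by rewrite -{1}eP (inj_eq (act_inj 'JG x)).
Qed.

Lemma line_nb P Q : P \in Om -> Q \in nb P ->
  (P :&: Q)%G \in lines P /\ Q \in F (P :&: Q)%G :\ P.
Proof.
move=> oP nQ; split; first exact: imset_f.
by have [_ _ QA neQ] := line_join k2 oP nQ; rewrite in_setD1 neQ.
Qed.

(** The kernel of the action of 'N_G(P) on the neighbours of P. *)
Definition nb_fixer P := ('N_G(P) :&: \bigcap_(Q in nb P) 'N(Q))%G.

Lemma nb_fixerP P x :
  reflect (x \in 'N_G(P) /\ forall Q, Q \in nb P -> x \in 'N(Q)) (x \in nb_fixer P).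
Proof.
rewrite [X in reflect _ X]in_setI; apply: (iffP andP) => -[nx nQ]; split=> //.
  by apply/bigcapP.
exact/bigcapP.
Qed.

Lemma nb_fixer_norm P : 'N_G(P) \subset 'N(nb_fixer P).
Proof.
apply/subsetP=> g ng; rewrite inE; apply/subsetP=> _ /imsetP[x /nb_fixerP[nx xQ] ->].
apply/nb_fixerP; split=> [|Q nQ]; first by rewrite memJ_norm // (subsetP (normG _)).
rewrite -mem_conjgV -normJ; have := xQ (Q :^ g^-1)%G; apply.
by rewrite nbJ // groupV.
Qed.

Lemma odd_nb_fixer P : P \in Om -> odd #|nb_fixer P|.
Proof.
move=> oP; rewrite -[odd _]negbK -dvdn2; apply/negP=> /(Cauchy (isT : prime 2))[x Lx ox].
have /nb_fixerP[/setIP[Gx nPx] xQ] := Lx.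
have p2x : 2.-elt x by rewrite /p_elt ox.
have inS T : T \in Om -> x \in 'N(T) -> x \in T.
  move=> oT nTx; rewrite -cycle_subG; apply: (Syl_norm oT p2x); by rewrite cycle_subG.
have x1 : x = 1.
  apply: (nb_sep oP) => [|Q nQ]; first exact: inS.
  by apply: inS (nb_Syl nQ) (xQ Q nQ).
by rewrite x1 order1 in ox.
Qed.

Lemma line_norm_cent A : #|A| = 2 -> forall H, H \subset 'N(A) -> H \subset 'C(A).
Proof.
move=> cA H nA; have := @card2_normal_cent _ (H <*> A)%G A.
rewrite /normal joing_subr join_subG nA normG => /(_ isT cA).
rewrite centsC join_subG => /andP[]; done.
Qed.

Lemma nb_fixer_line P Q : P \in Om -> Q \in nb P -> nb_fixer P \subset 'C(P :&: Q).
Proof.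
move=> oP nQ; have [LA _] := line_nb oP nQ.
apply: (@line_norm_cent (P :&: Q)%G) => //=; first exact: card_line_through oP LA.
apply/subsetP=> x /nb_fixerP[/setIP[_ nPx] xQ].
by rewrite inE conjIg (normP nPx) (normP (xQ Q nQ)).
Qed.

(** This group has odd order and centralises P :&: Q, and Q has only two
    elements outside P :&: Q. *)
Lemma nb_fixer_cent_nb P Q : P \in Om -> Q \in nb P -> nb_fixer P \subset 'C(Q).
Proof.
move=> oP nQ; have oQ := nb_Syl nQ; have sL := nb_fixer_line oP nQ.
have nLQ : nb_fixer P \subset 'N(Q).
  by apply/subsetP=> x /nb_fixerP[_]; apply.
have [LA _] := line_nb oP nQ; have cA := card_line_through oP LA.
have cS : #|Q :\: (P :&: Q)| <= 2.
  by rewrite cardsD (setIidPr (subsetIr P Q)) (card_Syl4 oQ) cA.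
have aS : [acts nb_fixer P, on Q :\: (P :&: Q) | 'J].
  by apply: actsD; rewrite astabsJ //; apply: cents_norm.
apply/centsP=> x Lx y Qy; have [Ay|nAy] := boolP (y \in P :&: Q).
  by have /centsP := sL; apply.
have Sy : y \in Q :\: (P :&: Q) by rewrite in_setD nAy.
have /= e := odd_acts2_fix (odd_nb_fixer oP) aS cS Sy Lx.
by rewrite /commute [RHS]conjgC e.
Qed.

(** Centralising Q, this group normalises the lines through Q, and being of
    odd order it fixes both other points of each of them. *)
Lemma nb_fixer_sub P Q : P \in Om -> Q \in nb P -> nb_fixer P \subset nb_fixer Q.
Proof.
move=> oP nQ; have oQ := nb_Syl nQ; have cQ := nb_fixer_cent_nb oP nQ.
have sLG : nb_fixer P \subset G by apply/subsetP=> x /nb_fixerP[/setIP[]].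
have sLN : nb_fixer P \subset 'N_G(Q) by rewrite subsetI sLG cents_norm.
apply/subsetP=> x Lx; apply/nb_fixerP; split; first exact: subsetP Lx.
move=> U nU; have [LB UB] := line_nb oQ nU.
have nLB : nb_fixer P \subset 'N(Q :&: U).
  by apply/cents_norm/(subset_trans cQ)/centS/subsetIl.
have [aL c2] := acts_line LB oQ sLN nLB.
by have /= e := odd_acts2_fix (odd_nb_fixer oP) aL c2 UB Lx; apply/normP; rewrite -[in RHS]e.
Qed.

Lemma nb_fixer1 P : P \in Om -> nb_fixer P :=: 1.
Proof.
move=> oP; have [Q nQ] := nb_ex oP; have oQ := nb_Syl nQ.
have eD : nb_fixer P :=: nb_fixer Q.
  by apply/eqP; rewrite eqEsubset !nb_fixer_sub // nb_sym.
have [_ _ _ ne] := line_join k2 oP nQ; rewrite eq_sym in ne.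
apply: (@normal_kernel P Q (nb_fixer P) oP oQ ne); first exact: subsetIl.
  exact: nb_fixer_norm.
by have := nb_fixer_norm Q; rewrite -eD.
Qed.

Lemma norm_sqr_Syl P x : P \in Om -> x \in 'N_G(P) -> x ^+ 2 \in P -> x \in P.
Proof.
move=> oP /setIP[Gx nPx] Px2; rewrite -cycle_subG.
apply: (Syl_norm oP); rewrite ?cycle_subG //.
have x4 : x ^+ 4 = 1 by rewrite (expgM x 2 2) (Syl_sqr1 oP Px2).
by apply: (@pnat_dvd _ 4) => //; rewrite -orderE order_dvdn x4.
Qed.

(** The square of an element centralising P fixes all the neighbours of P. *)
Lemma cent_Syl P : P \in Om -> 'C_G(P) \subset P.
Proof.
move=> oP; apply/subsetP=> x Cx; have [Gx cPx] := setIP Cx.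
have sCN : 'C_G(P) \subset 'N_G(P) by apply: setIS; apply: cent_sub.
have nx := subsetP sCN x Cx.
apply: (norm_sqr_Syl oP nx).
suff : x ^+ 2 \in nb_fixer P by rewrite (nb_fixer1 oP) => /set1P->.
apply/nb_fixerP; split=> [|Q nQ]; first exact: groupX.
have [LA QA] := line_nb oP nQ.
have nA : 'C_G(P) \subset 'N(P :&: Q).
  by apply/cents_norm/(subset_trans (subsetIr _ _))/centS/subsetIl.
have [aC c2] := acts_line LA oP sCN nA.
by have /= e := acts2_sqr_fix aC c2 QA Cx; apply/normP; rewrite -[in RHS]e.
Qed.

Lemma norm_line_Syl P A : P \in Om -> A \in lines P ->
  'N_G(P) :&: 'N(A) \subset P.
Proof.
move=> oP LA; have [sAP iA] := line_through_index oP LA; have cA := card_line_through oP LA.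
apply/subsetP=> x nx; have /setIP[nPx nAx] := nx; apply: (norm_sqr_Syl oP nPx).
have [Gx _] := setIP nPx.
apply: (subsetP (cent_Syl oP)); rewrite inE groupX //=.
have cS : #|P :\: A| <= 2 by rewrite cardsD (setIidPr sAP) (card_Syl4 oP) cA.
have aS : [acts 'N_G(P) :&: 'N(A), on P :\: A | 'J].
  by apply: actsD; rewrite astabsJ ?subsetIr //; apply: subset_trans (subsetIl _ _) (subsetIr _ _).
apply/centP=> y Py; have [Ay|nAy] := boolP (y \in A).
  have /centsP := line_norm_cent cA (subxx 'N(A)); apply; rewrite ?groupX //.
have Sy : y \in P :\: A by rewrite in_setD nAy.
have /= e := acts2_sqr_fix aS cS Sy nx.
by rewrite /commute [RHS]conjgC e.
Qed.

Lemma card_norm_Syl P : P \in Om -> #|'N_G(P)| = 12.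
Proof.
move=> oP; have [Q nQ] := nb_ex oP; have [LA _] := line_nb oP nQ.
have [lA PA] := lines_throughP (isT : 1 < 2) min2 _ oP LA.
have [c6 eC _] := nb_class oP nQ.
have := card_line_class (isT : 1 < 2) min2 lA PA.
rewrite eC c6 (line2_card lA PA) /= => w3.
have {}w3 : #|'N_G(P) : 'N(P :&: Q)| = 3 by move: w3; clear; lia.
have eP : 'N_G(P) :&: 'N(P :&: Q) = P.
  apply/eqP; rewrite eqEsubset (norm_line_Syl oP LA) !subsetI (Syl_sub oP) normG.
  exact: line2_normal lA PA.
have := Lagrange (subsetIl 'N_G(P) 'N(P :&: Q)).
by rewrite indexgI w3 /= eP (card_Syl4 oP) => <-.
Qed.

Lemma card_norm_line A P : P \in Om -> A \in lines P -> #|'N_G(A)| = 12.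
Proof.
move=> oP LA; have [lA PA] := lines_throughP (isT : 1 < 2) min2 A oP LA.
have eF : F A = orbit 'JG 'N_G(A) P.
  apply/setP=> T; apply/idP/orbitP=> [/(line_trans min2 lA PA)[x nx ->]|[x nx <-]].
    by exists x.
  by rewrite Syl_aboveJ.
have := line2_card lA PA; rewrite eF card_orbit astab1JG => i3.
have eP : 'N_('N_G(A))(P) = P.
  apply/eqP; rewrite eqEsubset; apply/andP; split.
    by apply: subset_trans (norm_line_Syl oP LA); rewrite setIAC.
  by rewrite !subsetI (Syl_sub oP) normG (line2_normal lA PA).
have := Lagrange (subsetIl 'N_G(A) 'N(P)).
by rewrite /= i3 eP (card_Syl4 oP) => <-.
Qed.

Lemma card_G P : P \in Om -> #|G| = (12 * #|Om|)%N.
Proof.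
move=> oP; rewrite (card_Syl (SylP oP)) -(card_norm_Syl oP) Lagrange //.
exact: subsetIl.
Qed.

(** Let q be the number of points, so |G| = 12 q. The Sylow q-subgroup R of G
    is normal and has a cyclic automorphism group, so some non-trivial element
    of P centralises R. This element generates a line, which R normalises; but
    by [card_norm_line] q does not divide the order of the normaliser of a
    line. *)
Lemma prime_count_contra P : P \in Om -> prime #|Om| -> 12 < #|Om| -> False.
Proof.
move=> oP; set q := #|Om| => pq q12; have cG : #|G| = (12 * q)%N by apply: card_G oP.
have cop : coprime q 12.
  by rewrite prime_coprime //; apply/negP=> /(dvdn_leq (isT : 0 < 12)); rewrite leqNgt q12.
have qG : q %| #|G| by rewrite cG dvdn_mull.
have [R sylR] := Sylow_exists q G.
have cR : #|R| = q.
  rewrite (card_Hall sylR) cG partnM ?(prime_gt0 pq) // part_p'nat ?mul1n.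
    by rewrite part_pnat_id // pnat_id.
  by rewrite p'natE // -prime_coprime.
have s1 : #|'Syl_q(G)| = 1%N.
  have sm := card_Syl_mod G pq; have := card_Syl_dvd q G.
  rewrite cG Gauss_dvdl; last first.
    by rewrite coprime_sym prime_coprime // /dvdn sm.
  by move/(dvdn_leq (isT : 0 < 12)) => le; rewrite -sm modn_small // (leq_ltn_trans le).
have nRG : G \subset 'N(R).
  by move: s1; rewrite (card_Syl sylR) => /eqP; rewrite indexg_eq1 => /subsetIP[].
have sPG := Syl_sub oP; have nRP := subset_trans sPG nRG.
have C1 : 'C_P(R) = 1.
  apply/trivgP/subsetP=> x /setIP[Px cRx]; rewrite inE; apply: contraT => ntx.
  have [A LA Ax] := lines_cover oP Px.
  have cA := card_line_through oP LA.
  have eA : A :=: <[x]>.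
    apply/eqP; rewrite eq_sym eqEcard cycle_subG Ax cA.
    by rewrite -orderE order_gt1.
  have sRN : R \subset 'N_G(A).
    rewrite subsetI (pHall_sub sylR) cents_norm // eA centsC cycle_subG //.
  have := cardSg sRN; rewrite cR (card_norm_line oP LA).
  by move/(dvdn_leq (isT : 0 < 12)); rewrite leqNgt q12.
have cycP : cyclic P.
  pose f := [morphism of restrm nRP (conj_aut R)].
  have injf : 'injm f by rewrite ker_restrm ker_conj_aut C1.
  have sfA : f @* P \subset Aut R.
    by have := morphim_restrm nRP (conj_aut R) P; rewrite /= => ->; apply: Aut_conj_aut.
  rewrite -(injm_cyclic injf (subxx P)); apply: cyclicS sfA (Aut_prime_cyclic _).
  by rewrite cR.
have [x eP] := cyclicP cycP; have Px : x \in P by rewrite eP cycle_id.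
have := card_Syl4 oP.
rewrite eP -orderE => o4; have := dvdn_leq (isT : 0 < 2) (_ : #[x] %| 2).
by rewrite order_dvdn (Syl_sqr1 oP Px) eqxx o4 => /(_ isT).
Qed.

(** X and A generate an abelian subgroup of order six; it has index two in
    'N_G(A) and so contains Y, and it has only one subgroup of order three. *)
Lemma card3_uniq P A X Y : P \in Om -> A \in lines P ->
  X \subset 'N_G(A) -> Y \subset 'N_G(A) -> #|X| = 3 -> #|Y| = 3 -> X :=: Y.
Proof.
move=> oP LA sX sY cX cY; have cA := card_line_through oP LA.
have cN := card_norm_line oP LA.
have [sXG nAX] := subsetIP sX; have cXA := line_norm_cent cA nAX.
have [sAP _] := line_through_index oP LA.
have sH : X <*> A \subset 'N_G(A).
  by rewrite join_subG sX subsetI normG (subset_trans sAP (Syl_sub oP)).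
have cH : #|X <*> A| = 6.
  rewrite cent_joinEl // TI_cardMg ?cX ?cA //.
  by apply: coprime_TIg; rewrite cX cA.
have iH : #|'N_G(A) : X <*> A| = 2.
  by have := Lagrange sH; rewrite cH cN; clear; move: #|_ : _| => i; lia.
have sYH : Y \subset X <*> A.
  apply/subsetP=> y Yy; apply: (odd_index2 sH iH); first exact: subsetP sY y Yy.
  by apply: dvdn_odd (order_dvdG Yy) _; rewrite cY.
have abH : abelian (X <*> A).
  rewrite (cent_joinEl cXA) abelianM (cyclic_abelian (prime_cyclic _)) ?cX //.
  by rewrite (cyclic_abelian (prime_cyclic _)) ?cA // centsC.
have hall (Z : {group gT}) : Z \subset X <*> A -> #|Z| = 3 -> 'O_3(X <*> A) = Z :> {set gT}.
  move=> sZ cZ; apply: normal_Hall_pcore; last by rewrite /normal sZ (sub_abelian_norm abH sZ).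
  by rewrite pHallE /= sZ cZ cH p_part.
by rewrite -(hall X) ?joing_subl // -(hall Y).
Qed.

Lemma nb_join P Q R : P \in Om -> Q \in nb P -> R \in nb P -> R \notin F (P :&: Q) ->
  P \subset (P :&: Q) <*> (P :&: R).
Proof.
move=> oP nQ nR nRA; have [LR _] := line_nb oP nR; have [LQ _] := line_nb oP nQ.
have cR := card_line_through oP LR.
have cQ := card_line_through oP LQ.
have sJ : (P :&: Q) <*> (P :&: R) \subset P by rewrite join_subG !subsetIl.
have iQ : #|P : P :&: Q| = 2 := index_nb nQ.
have := index2_between (M := (P :&: Q)%G) (L := ((P :&: Q) <*> (P :&: R))%G).
move/(_ P (joing_subl _ _) sJ iQ) => /orP[//|sJQ]; case/negP: nRA.
apply/Syl_aboveP; split; first exact: nb_Syl nR.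
have sRQ := subset_trans (joing_subr _ _) sJQ.
have e : P :&: R = P :&: Q by apply/eqP; rewrite eqEcard sRQ cR cQ.
by rewrite /= -e subsetIr.
Qed.

(** In the quadrangle P, Q, W, R, the sides P :&: Q and R :&: W both
    centralise the two other sides. If the common centraliser of these two has
    no element of order three, it is a 2-group, hence abelian, and R :&: W
    centralises P :&: Q and P :&: R, thus P; then R :&: W is contained in P,
    and W is on the line P :&: R. *)
Lemma quadrangle_card3 P Q R W : P \in Om -> W \in Om -> Q \in nb P -> R \in nb P ->
    Q \in nb W -> R \in nb W -> R \notin F (P :&: Q) -> W \notin F (P :&: R) ->
  exists Y : {group gT}, [/\ #|Y| = 3, Y \subset 'C_G(P :&: R) & Y \subset 'C_G(Q :&: W)].
Proof.
move=> oP oW nQ nR nQW nRW nRA nWA; have oQ := nb_Syl nQ; have oR := nb_Syl nR.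
pose X := ('C_G(P :&: R) :&: 'C_G(Q :&: W))%G.
have [LR _] := line_nb oP nR; have [LQ _] := line_nb oP nQ.
have cR := card_line_through oP LR.
have cQ := card_line_through oP LQ.
have [d3|n3] := boolP (3 %| #|X|).
  have [x Xx ox] := Cauchy (isT : prime 3) d3; exists <[x]>%G.
  by have /setIP[Cx Cx'] := Xx; split; rewrite ?cycle_subG.
have aC S (T : {set gT}) : S \in Om -> T \subset S -> T \subset 'C_G(S).
  move=> oS sT; rewrite subsetI (subset_trans sT (Syl_sub oS)).
  exact: subset_trans sT (Syl_abelian oS).
have cS (S T : {set gT}) : T \subset S -> 'C_G(S) \subset 'C_G(T).
  by move=> s; apply: setIS; apply: centS.
have sX1 : P :&: Q \subset X.
  rewrite subsetI (subset_trans (aC P _ oP (subsetIl P Q))) ?cS ?subsetIl //.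
  by rewrite (subset_trans (aC Q _ oQ (subsetIr P Q))) ?cS ?subsetIl.
have sX2 : R :&: W \subset X.
  rewrite subsetI (subset_trans (aC R _ oR (subsetIl R W))) ?cS ?subsetIr //.
  by rewrite (subset_trans (aC W _ oW (subsetIr R W))) ?cS ?subsetIr.
have pX : 2.-group X.
  have : #|X| %| 12.
    rewrite -(card_norm_line oP LR); apply: cardSg.
    by rewrite subIset //; apply/orP; left; apply: setIS; apply: cent_sub.
  rewrite -[12]/(4 * 3)%N Gauss_dvdl; last by rewrite coprime_sym prime_coprime.
  by move/pnat_dvd; apply.
have sXG : X \subset G by rewrite /= subIset // subsetIl.
have [T sylT sXT] := Sylow_superset sXG pX.
have abX : abelian X by apply: abelianS sXT (Syl_abelian (introT (SylP) sylT)).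
have eP := nb_join oP nQ nR nRA.
have cRW : R :&: W \subset 'C_G(P).
  rewrite subsetI (subset_trans (subsetIl R W) (Syl_sub oR)) /=.
  rewrite centsC; apply: subset_trans eP _; rewrite join_subG; apply/andP; split.
    by rewrite centsC; apply: subset_trans sX2 (subset_trans abX (centS sX1)).
  by rewrite centsC; apply: subset_trans sX2 (subset_trans (subsetIl _ _) (subsetIr _ _)).
have sRW : R :&: W \subset P :&: R.
  by rewrite subsetI subsetIl andbT (subset_trans cRW (cent_Syl oP)).
case/negP: nWA; apply/Syl_aboveP; split=> //.
have [LW _] := line_nb oR (nb_sym oW nRW).
have cW := card_line_through oR LW.
have e : R :&: W = P :&: R by apply/eqP; rewrite eqEcard sRW cR cW.
by rewrite /= -e subsetIr.
Qed.

(** Otherwise Q and R are neighbours, and their common neighbour W is on the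
    line joining them, which is a line through P. *)
Lemma far_distinct_lines P Q R W : P \in Om -> Q \in nb P -> R \in nb P -> Q != R ->
  W \in far P Q -> W \in nb R -> R \notin F (P :&: Q).
Proof.
move=> oP nQ nR ne WQ nWR; apply/negP=> RA; have oQ := nb_Syl nQ.
have /setDP[nWQ nWA] := WQ; rewrite eq_sym in ne.
have [lA PA QA neQP] := line_join k2 oP nQ.
have nRQ : R \in nb Q := line_Syl_at min2 lA QA RA ne.
have := nb_triangle oQ nRQ nWQ nWR.
by rewrite /= (line_cap min2 lA QA RA) 1?eq_sym // (negPf nWA).
Qed.

(** The 24 pairs of a neighbour Q of P and a point of [far P Q] involve only
    eight points, so some W has three neighbours Q, R and T in common with P,
    and these are on the three lines through P. The quadrangles P, Q, W, R and
    P, Q, W, T give two subgroups of order three in the centraliser of Q :&: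
    W, equal by [card3_uniq], that centralise P :&: R and P :&: T
    respectively. So a subgroup of order three centralises P, contrary to
    [cent_Syl]. *)
Lemma count15_contra P : P \in Om -> #|Om| = 15 -> False.
Proof.
move=> oP c15; have [Q0 nQ0] := nb_ex oP; have c6 := nb_card oP nQ0.
pose S := Om :\: (P |: nb P).
have cS : #|S| = 8.
  have sN : P |: nb P \subset Om.
    by rewrite subUset sub1set oP; apply/subsetP=> U /nb_Syl.
  rewrite cardsD (setIidPr sN) cardsU1 c6 c15.
  by have -> : P \notin nb P by apply/negP=> /Syl_atP[_]; rewrite indexgg.
pose N W := [set Q in nb P | W \in far P Q].
have sumN : \sum_(W in S) #|N W| = 24.
  have sfS Q : Q \in nb P -> far P Q \subset S.
    by move=> nQ; apply/subsetP=> W WQ; have := far_off oP nQ WQ.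
  transitivity (\sum_(Q in nb P) #|far P Q|); last first.
    rewrite (eq_bigr (fun=> 4)) => [|Q nQ]; last exact: card_far.
    by rewrite sum_nat_const c6.
  transitivity (\sum_(W in S) \sum_(Q in nb P) (W \in far P Q)).
    apply: eq_bigr => W SW; rewrite -sum1_card big_mkcond [RHS]big_mkcond /=.
    by apply: eq_bigr => Q _; rewrite in_set; case: (Q \in nb P) => //=; case: (W \in _).
  rewrite exchange_big /=; apply: eq_bigr => Q nQ.
  rewrite -sum1_card big_mkcond [RHS]big_mkcond /=.
  apply: eq_bigr => W _; case WQ: (W \in far P Q); last by case: ifP.
  by rewrite (subsetP (sfS Q nQ)).
have [W SW N3] : exists2 W, W \in S & 2 < #|N W|.
  apply/exists_inP; apply: contraT; rewrite negb_exists_in => /forall_inP le2.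
  have : \sum_(W in S) #|N W| <= \sum_(W in S) 2.
    by apply: leq_sum => W SW; rewrite leqNgt le2.
  by rewrite sumN sum_nat_const cS.
have oW : W \in Om by case/setDP: SW.
have nWP : W \notin nb P by case/setDP: SW => _; rewrite !inE negb_or => /andP[].
have NP Q : Q \in N W -> Q \in nb P /\ W \in far P Q.
  by rewrite in_set => /andP[].
have /card_gt0P[Q NQ] : 0 < #|N W| by apply: ltn_trans N3.
have /card_gt0P[R /setD1P[neR NR]] : 0 < #|N W :\ Q|.
  by move: N3; rewrite (cardsD1 Q) NQ; clear; lia.
have /card_gt0P[T /setD1P[neT /setD1P[neTQ NT]]] : 0 < #|N W :\ Q :\ R|.
  move: N3; rewrite (cardsD1 Q) NQ (cardsD1 R (N W :\ Q)) in_setD1 neR NR; clear; lia.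
have [nQ WQ] := NP Q NQ; have [nR WR] := NP R NR; have [nT WT] := NP T NT.
have adj U : U \in N W -> U \in nb W.
  by case/NP=> nU /setDP[nWU _]; apply: nb_sym nWU; apply: nb_Syl nU.
have farP U V : U \in N W -> V \in N W -> U != V -> V \notin F (P :&: U).
  move=> /NP[nU WU] /NP[nV /setDP[nWV _]] ne; exact: far_distinct_lines oP nU nV ne WU nWV.
have off U : U \in N W -> W \notin F (P :&: U).
  by case/NP=> _ /setDP[].
have quad U : U \in N W -> U != Q -> exists Y : {group gT},
    [/\ #|Y| = 3, Y \subset 'C_G(P :&: U) & Y \subset 'C_G(Q :&: W)].
  move=> NU neU; have [nU _] := NP U NU.
  apply: quadrangle_card3 => //; [exact: adj|exact: adj|apply: farP|exact: off] => //.
  by rewrite eq_sym.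
have [Y [cY Y1 Y2]] := quad R NR neR.
have [Z [cZ Z1 Z2]] := quad T NT neTQ.
have oQ := nb_Syl nQ; have [LW _] := line_nb oQ (nb_sym oW (adj Q NQ)).
have sCN : 'C_G(Q :&: W) \subset 'N_G(Q :&: W) by apply: setIS; apply: cent_sub.
have eYZ := card3_uniq oQ LW (subset_trans Y2 sCN) (subset_trans Z2 sCN) cY cZ.
have cYP : Y \subset 'C_G(P).
  rewrite subsetI; move: Y1; rewrite subsetI => /andP[-> c1] /=.
  have c2 : Y \subset 'C(P :&: T) by rewrite eYZ; case/subsetIP: Z1.
  have nTR : T \notin F (P :&: R) by apply: farP; rewrite // eq_sym.
  rewrite centsC; apply: subset_trans (nb_join oP nR nT nTR) _.
  by rewrite join_subG centsC c1 centsC c2.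
have := cardSg (subset_trans cYP (cent_Syl oP)).
by rewrite cY (card_Syl4 oP).
Qed.

Lemma distance2_count P : P \in Om -> #|Om| \in [:: 15; 19; 23].
Proof.
move=> oP; have [Q nQ] := nb_ex oP; have [c6 _ ge15] := nb_class oP nQ.
have := card_Syl_split oP le25; rewrite c6.
have := dvdn_Syl_at 4 oP; have := dvdn_Syl_at 8 oP; have := dvdn_Syl_at 16 oP.
have := le25; move: ge15; clear.
move: #|Om| #|_| #|_| #|_| => n a b c; move=> ge le /dvdnP[q ->] /dvdnP[r ->] /dvdnP[s ->] en.
by rewrite !inE; have : [|| c == 15, c == 19 | c == 23] by lia.
Qed.

Lemma distance2_contra P : P \in Om -> False.
Proof.
move=> oP; have := distance2_count oP; rewrite !inE => /or3P[] /eqP cn.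
- exact: count15_contra oP cn.
- by apply: (prime_count_contra oP); rewrite cn.
by apply: (prime_count_contra oP); rewrite cn.
Qed.

End DistanceTwo.

(** * Reduction to faithful actions *)

Section Faithful.

Variables (gT : finGroupType) (G : {group gT}).
Implicit Types (P Q T U H : {group gT}).
Local Notation Om := 'Syl_2(G).

Hypotheses (red : redundant G) (le25 : #|Om| <= 25).
Hypothesis faithful : forall x, x \in G -> (forall T, T \in Om -> x \in 'N(T)) -> x = 1.

Lemma redundant_primitive : Syl_primitive G.
Proof.
move=> P H oP sNH sHG.
have [->|neG] := eqVneq (H :> {set gT}) G; first by left.
have [->|neN] := eqVneq (H :> {set gT}) 'N_G(P); first by right.
by case: (@no_intermediate _ G P H oP sNH sHG).
Qed.

Lemma faithful_contra : False.
Proof.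
have [P /SylP oP] := Sylow_exists 2 G; have prim := redundant_primitive.
have none k : #|Syl_at G P k| = 0 -> forall T U, T \in Om -> U \in Om -> #|T : U| <> k.
  move=> ck T U oT oU iTU; have := card_Syl_at k oP oT; rewrite ck => /esym/card0_eq/(_ U).
  by move/negP; case; apply/Syl_atP.
have [c2|/eqP c2] := eqVneq #|Syl_at G P 2| 0; last first.
  apply: (distance2_contra red prim le25 faithful _ oP) => T oT; apply/card_gt0P.
  by rewrite -(card_Syl_at 2 oP oT) lt0n; apply/eqP.
have min4 T U : T \in Om -> U \in Om -> T != U -> 4 <= #|T : U|.
  move=> oT oU ne; have := none 2 c2 T U oT oU; rewrite eq_sym in ne.
  by case: (index_Syl_cases oT oU ne le25) => ->.
have [c4|/eqP c4] := eqVneq #|Syl_at G P 4| 0; last first.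
  have /card_gt0P[Q Q4] : 0 < #|Syl_at G P 4| by rewrite lt0n; apply/eqP.
  exact: (distance4_contra red prim le25 min4 oP Q4).
have min8 T U : T \in Om -> U \in Om -> T != U -> 8 <= #|T : U|.
  move=> oT oU ne; have := none 4 c4 T U oT oU; have := min4 T U oT oU ne; rewrite eq_sym in ne.
  by case: (index_Syl_cases oT oU ne le25) => ->.
exact: (distance8_contra red prim le25 min8 faithful oP).
Qed.

End Faithful.

Section Reduction.

Variables (gT : finGroupType) (G : {group gT}).
Implicit Types (P Q T U H : {group gT}).
Local Notation Om := 'Syl_2(G).

(** The kernel of the action of G on the points. *)
Definition Syl_kernel := (G :&: \bigcap_(T in Om) 'N(T))%G.

Lemma Syl_kernelP x :
  reflect (x \in G /\ forall T, T \in Om -> x \in 'N(T)) (x \in Syl_kernel).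
Proof.
rewrite [X in reflect _ X]in_setI; apply: (iffP andP) => -[Gx nx]; split=> //.
  exact/bigcapP.
exact/bigcapP.
Qed.

Lemma Syl_kernel_norm : G \subset 'N(Syl_kernel).
Proof.
apply/subsetP=> g Gg; rewrite inE; apply/subsetP=> _ /imsetP[x /Syl_kernelP[Gx nx] ->].
apply/Syl_kernelP; split=> [|T oT]; first exact: groupJ.
rewrite -mem_conjgV -normJ; have := nx (T :^ g^-1)%G; apply.
by rewrite SylJ ?groupV.
Qed.

Lemma Syl_quotient T : T \in Om -> (T / Syl_kernel)%G \in 'Syl_2(G / Syl_kernel).
Proof.
move=> oT; apply/SylP; apply: quotient_pHall (SylP oT).
exact: subset_trans (Syl_sub oT) Syl_kernel_norm.
Qed.

(** The kernel normalises T, so T is the only Sylow 2-subgroup of its product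
    with the kernel. *)
Lemma Syl_quotient_inj T U : T \in Om -> U \in Om ->
  T / Syl_kernel = U / Syl_kernel -> T = U.
Proof.
move=> oT oU eq; apply/esym/(Syl_eq oU oT)/(Syl_norm oT (Syl_pgroup oU) (Syl_sub oU)).
have nU := subset_trans (Syl_sub oU) Syl_kernel_norm.
have nT := subset_trans (Syl_sub oT) Syl_kernel_norm.
have : U \subset Syl_kernel * T by rewrite -quotientSK // eq.
move/subset_trans; apply; rewrite mul_subG ?normG //.
by apply/subsetP=> x /Syl_kernelP[_]; apply.
Qed.

Lemma Syl_quotient_all X : X \in 'Syl_2(G / Syl_kernel) ->
  exists2 T, T \in Om & X = (T / Syl_kernel)%G.
Proof.
move=> oX; have [P /SylP oP] := Sylow_exists 2 G.
have [xb /morphimP[x nx Gx ->] ->] := Syl_conj (Syl_quotient oP) oX.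
exists (P :^ x)%G; first by rewrite SylJ.
by apply: group_inj; rewrite /= quotientJ.
Qed.

Lemma card_Syl_quotient : #|'Syl_2(G / Syl_kernel)| = #|Om|.
Proof.
pose f T := (T / Syl_kernel)%G.
have injf : {in Om &, injective f}.
  by move=> T U oT oU /(congr_group) /=; apply: Syl_quotient_inj.
rewrite -(card_in_imset injf); apply: eq_card => X; apply/idP/imsetP.
  by case/Syl_quotient_all=> T oT ->; exists T.
by case=> T oT ->; apply: Syl_quotient.
Qed.

Lemma redundant_quotient : redundant G -> redundant (G / Syl_kernel).
Proof.
move=> red _ xb /Syl_quotient_all[T oT ->] /morphimP[x nx Tx ->].
have [Q [oQ neQ Qx]] := red T x oT Tx.
exists (Q / Syl_kernel)%G; split; first exact: Syl_quotient.
  by apply: contra neQ => /eqP/(congr_group) /= e; apply/eqP/Syl_quotient_inj.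
by rewrite /= mem_quotient.
Qed.

Lemma faithful_quotient xb : xb \in G / Syl_kernel ->
  (forall X, X \in 'Syl_2(G / Syl_kernel) -> xb \in 'N(X)) -> xb = 1.
Proof.
case/morphimP=> x nx Gx ->{xb} nX; apply: coset_id; apply/Syl_kernelP; split=> // T oT.
have /normP e := nX _ (Syl_quotient oT).
apply/normP; have := @Syl_quotient_inj (T :^ x)%G T; rewrite SylJ //= => /(_ oT oT).
by rewrite quotientJ // e => /(_ erefl)/(congr_group).
Qed.

End Reduction.

Theorem theorem3 (gT : finGroupType) (G : {group gT}) :
  (exists P : {group gT}, redundant_Sylow 2 G P) -> (27 <= nu 2 G)%N.
Proof.
case=> P [sylP redP]; have oP : P \in 'Syl_2(G) by apply/SylP.
have red : redundant G.
  move=> T x oT Tx; have [g Gg eT] := Syl_conj oT oP.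
  have Px : x ^ g \in P by rewrite eT memJ_conjg.
  have [||Q [sylQ neQ Qx]] := redP (x ^ g).
  - exact: subsetP (Syl_sub oP) _ Px.
  - exact: mem_p_elt (Syl_pgroup oP) Px.
  exists (Q :^ g^-1)%G; split; first by rewrite SylJ ?groupV //; apply/SylP.
    apply: contra neQ => /eqP/(congr_group) /= e; apply/eqP/group_inj.
    by rewrite eT /= -e conjsgKV.
  by rewrite /= mem_conjgV.
rewrite ltnNge; apply/negP=> le26.
have le25 : #|'Syl_2(G)| <= 25.
  have := odd_card_Syl G; move: le26; rewrite /nu; clear; move: #|_| => n; lia.
apply: (@faithful_contra _ (G / Syl_kernel G)%G (redundant_quotient red)).
  by rewrite card_Syl_quotient.
exact: faithful_quotient.
Qed.
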